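(* For each $k\in\mathbb{N}=\{1,2,3,\dots\}$, there exists a strictly ergodic, topologically weak mixing system such that $Z_k$ is a nontrivial extension of $Z_{k-1}$.
   Context: A system $(X,\mu,T)$ is a compact metric space $X$ with its Borel $\sigma$-algebra, a homeomorphism $T\colon X\to X$, and a $T$-invariant Borel probability measure $\mu$. It is strictly ergodic if it is minimal and uniquely ergodic. A minimal system is topologically weak mixing if $T\times T$ is topologically transitive on $X\times X$; equivalently, it has no non-constant continuous eigenfunctions (continuous $f\colon X\to\mathbb{S}^1$ with $f\circ T=\lambda f$ for some $\lambda\in\mathbb{S}^1$). A measurable factor map $\pi\colon (X,\mu,T)\to (Y,\nu,S)$ is a measurable map with $S\circ\pi=\pi\circ T$ $\mu$-a.e. and $\pi_*\mu=\nu$; it is a measurable isomorphism if it is (modulo null sets) a bijection with measurable inverse. A $k$-step nilsystem is $(G/\Gamma,m,x\mapsto g\cdot x)$ where $G$ is a $k$-step nilpotent Lie group, $\Gamma\le G$ a discrete cocompact subgroup, $g\in G$, and $m$ is Haar measure. For an ergodic system, $Z_k$ denotes its maximal measurable factor that is an inverse limit of $k$-step nilsystems (every measurable factor of this kind is a measurable factor of $Z_k$); $Z_0$ is the one-point system. There is always a measurable factor map $Z_k\to Z_{k-1}$; ''$Z_k$ is a nontrivial extension of $Z_{k-1}$'' means it is not a measurable isomorphism. *)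

(* Defs.v *)
From HB Require Import structures.
From mathcomp Require Import all_boot all_order all_algebra.
From mathcomp Require Import all_classical all_reals all_analysis.

Set Implicit Arguments.
Unset Strict Implicit.
Unset Printing Implicit Defensive.

Import Order.TTheory GRing.Theory Num.Theory.
Import numFieldNormedType.Exports.

Local Open Scope classical_set_scope.
Local Open Scope ring_scope.

(* Pointedness, required by measurableType, is harmless: the phase spaces below
   carry a probability measure, hence are nonempty. *)
#[short(type="pmetricType")]
HB.structure Definition PointedMetric (R : numDomainType) :=
  {M of Pointed M & Metric R M}.

#[short(type="groupTopologicalType")]
HB.structure Definition GroupTopological := {G of Group G & Topological G}.

Definition borel (X : ptopologicalType) := g_sigma_algebraType (@open X).

HB.instance Definition _ (X : ptopologicalType) := Measurable.on (borel X).

Definition borel_set (X : ptopologicalType) : set (set X) :=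
  @measurable _ (borel X).

Definition homeomorphism (X Y : topologicalType) (f : X -> Y) : Prop :=
  continuous f /\
  exists g : Y -> X, [/\ continuous g, cancel f g & cancel g f].

Definition invariant_measure (R : realType) (X : ptopologicalType) (T : X -> X)
    (m : probability (borel X) R) : Prop :=
  forall A : set X, borel_set A -> m (T @^-1` A) = m A.

Record system (R : realType) : Type := System {
  space :> pmetricType R;
  space_compact : compact [set: space];
  trans : space -> space;
  trans_homeo : homeomorphism trans;
  mu : probability (borel space) R;
  mu_invariant : invariant_measure trans mu }.

Arguments trans {R} s _.
Arguments mu {R} s.

Section topological_dynamics.
Variable R : realType.

Definition minimal (X : system R) : Prop :=
  forall A : set X, closed A -> A !=set0 -> trans X @` A `<=` A -> A = setT.

Definition uniquely_ergodic (X : system R) : Prop :=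
  forall m : probability (borel X) R, invariant_measure (trans X) m ->
    forall A : set X, borel_set A -> m A = mu X A.

Definition strictly_ergodic (X : system R) : Prop :=
  minimal X /\ uniquely_ergodic X.

Definition topologically_transitive (X : topologicalType) (f : X -> X) : Prop :=
  forall U V : set X, open U -> open V -> U !=set0 -> V !=set0 ->
    exists n : nat, (iter n f @` U) `&` V !=set0.

Definition topologically_weak_mixing (X : system R) : Prop :=
  @topologically_transitive (X * X)%type
    (fun xy => (trans X xy.1, trans X xy.2)).

End topological_dynamics.

Section factors.
Variable R : realType.
Implicit Types X Y : system R.

Definition factor_map X Y (pi : X -> Y) : Prop :=
  [/\ measurable_fun [set: borel X] (pi : borel X -> borel Y),
      {ae mu X, forall x, trans Y (pi x) = pi (trans X x)} &
      forall B : set Y, borel_set B -> mu X (pi @^-1` B) = mu Y B].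

(* A factor map is an isomorphism when it restricts to a bijection with
   measurable inverse between sets of full measure. *)
Definition is_isomorphism X Y (pi : X -> Y) : Prop :=
  factor_map pi /\
  exists (X0 : set X) (Y0 : set Y),
    [/\ borel_set X0 /\ mu X X0 = 1%E,
        borel_set Y0 /\ mu Y Y0 = 1%E,
        set_bij X0 Y0 pi &
        forall A : set X, borel_set A -> A `<=` X0 -> borel_set (pi @` A)].

End factors.

Section smooth.
Variables (R : realType) (V W : normedModType R).

(* [f] is of class C^r on the open set [U]: all iterated directional derivatives
   of order at most [r] exist and are continuous on [U].  In finite dimension
   this is the usual notion. *)
Fixpoint class_C (r : nat) (U : set V) (f : V -> W) : Prop :=
  (forall x, U x -> {for x, continuous f}) /\
  (if r is r'.+1 then
     forall v : V, (forall x, U x -> derivable f x v) /\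
                   class_C r' U (fun x => 'D_v f x)
   else True).

Definition smooth_on (U : set V) (f : V -> W) : Prop := forall r, class_C r U f.

End smooth.

(* A homeomorphism [cmap], with inverse [cinv], from the open subset [cdom] of
   [M] onto the open subset [cimg] of R^n; values outside are irrelevant. *)
Record chart (R : realType) (n : nat) (M : topologicalType) : Type := Chart {
  cdom : set M;
  cimg : set 'rV[R]_n;
  cmap : M -> 'rV[R]_n;
  cinv : 'rV[R]_n -> M;
  cdom_open : open cdom;
  cimg_open : open cimg;
  cmap_fun : forall x, cdom x -> cimg (cmap x);
  cinv_fun : forall u, cimg u -> cdom (cinv u);
  cmapK : forall x, cdom x -> cinv (cmap x) = x;
  cinvK : forall u, cimg u -> cmap (cinv u) = u;
  cmap_continuous : forall x, cdom x -> {for x, continuous cmap};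
  cinv_continuous : forall u, cimg u -> {for u, continuous cinv} }.

Definition smooth_atlas (R : realType) (n : nat) (M : topologicalType)
    (A : set (chart R n M)) : Prop :=
  (forall x : M, exists2 c, A c & cdom c x) /\
  (forall c d, A c -> A d ->
     smooth_on (cimg c `&` cinv c @^-1` cdom d) (cmap d \o cinv c)).

(* The group [G] is a Lie group of dimension [n], with respect to some smooth
   structure compatible with its topology. *)
Definition lie_group (R : realType) (n : nat) (G : groupTopologicalType) : Prop :=
  [/\ hausdorff_space G,
      second_countable (T := G),
      continuous (fun xy : G * G => (xy.1 * xy.2)%g),
      continuous (fun x : G => (x^-1)%g) &
      exists A : set (chart R n G),
      [/\ smooth_atlas A,
          forall c d e, A c -> A d -> A e ->
            smooth_on
              [set uv : 'rV[R]_n * 'rV[R]_n |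
                 [/\ cimg c uv.1, cimg d uv.2 &
                     cdom e (cinv c uv.1 * cinv d uv.2)%g]]
              (fun uv => cmap e (cinv c uv.1 * cinv d uv.2)%g) &
          forall c d, A c -> A d ->
            smooth_on
              [set u : 'rV[R]_n | cimg c u /\ cdom d ((cinv c u)^-1)%g]
              (fun u => cmap d ((cinv c u)^-1)%g)]].

Section groups.
Variable G : groupType.

Definition subgroup (H : set G) : Prop :=
  [/\ H 1%g, forall x y, H x -> H y -> H (x * y)%g & forall x, H x -> H (x^-1)%g].

(* [lower_central j] is G_(j+1) in the numbering G_1 = G, G_(j+1) = [G_j, G]. *)
Fixpoint lower_central (j : nat) : set G :=
  if j is j'.+1 then
    smallest subgroup
      [set z | exists x y, lower_central j' x /\ z = [~ x, y]%g]
  else setT.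

(* Nilpotent of step at most [k]. *)
Definition nilpotent_of_step (k : nat) : Prop := lower_central k = [set 1%g].

End groups.

Section nilfactors.
Variable R : realType.
Implicit Types X Y Z W : system R.

(* [p] identifies [Y] with the quotient space G/Gamma of left cosets a Gamma;
   Gamma is cocompact because [Y] is compact.  The last clause says that [mu Y]
   is invariant under all left translations by G. *)
Definition nilsystem (k : nat) Y : Prop :=
  exists (n : nat) (G : groupTopologicalType) (Gamma : set G) (g : G)
         (p : G -> Y),
    [/\ lie_group R n G /\ nilpotent_of_step G k,
        subgroup Gamma /\ Gamma `<=` isolated Gamma,
        [/\ forall y, exists a, p a = y,
            forall a b, p a = p b <-> Gamma (a^-1 * b)%g &
            forall U : set Y, open U <-> open (p @^-1` U)],
        forall a, trans Y (p a) = p (g * a)%g &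
        forall (h : G) (B : set Y), borel_set B ->
          mu Y [set p (h * a)%g | a in p @^-1` B] = mu Y B].

(* [Y] is the inverse limit of a sequence of [k]-step nilsystems: these form a
   tower of factors of [Y] that jointly generate its Borel sigma-algebra modulo
   null sets. *)
Definition inverse_limit_of_nilsystems (k : nat) Y : Prop :=
  exists (N : nat -> system R) (p : forall i, Y -> N i)
         (q : forall i, N i.+1 -> N i),
    [/\ forall i, nilsystem k (N i),
        forall i, factor_map (p i),
        forall i, factor_map (q i),
        forall i, {ae mu Y, forall y, q i (p i.+1 y) = p i y} &
        forall A : set Y, borel_set A ->
          exists2 B : set Y,
            <<s \bigcup_i preimage_set_system setT (p i) (@borel_set (N i)) >> B &
            mu Y ((A `\` B) `|` (B `\` A)) = 0%E].

(* [pi : X -> Z] presents [Z] as the factor Z_k of [X].  Maximality is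
   in the lattice of factors of [X]: the factor map Z -> W commutes a.e. with the
   factor maps from [X]. *)
Definition is_Z (k : nat) X Z (pi : X -> Z) : Prop :=
  factor_map pi /\
  (if k is 0 then forall z z' : Z, z = z'
   else
     inverse_limit_of_nilsystems k Z /\
     forall W (rho : X -> W),
       factor_map rho -> inverse_limit_of_nilsystems k W ->
       exists2 theta : Z -> W, factor_map theta &
         {ae mu X, forall x, theta (pi x) = rho x}).

(* Z_k and Z_(k-1) are determined up to isomorphism and the factor map
   Z_k -> Z_(k-1) over [X] up to null sets. *)
Definition Z_nontrivial_extension (k : nat) X : Prop :=
  exists Z Z' (pi : X -> Z) (pi' : X -> Z') (theta : Z -> Z'),
    [/\ is_Z k pi, is_Z k.-1 pi', factor_map theta,
        {ae mu X, forall x, theta (pi x) = pi' x} &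
        ~ is_isomorphism theta].

End nilfactors.

(* Main.v *)
Require Import Defs.
From HB Require Import structures.
From mathcomp Require Import all_boot all_order all_algebra.
From mathcomp Require Import all_classical all_reals all_analysis.
From mathcomp Require Import perm measurable_realfun ring lra zify.

Set Implicit Arguments.
Unset Strict Implicit.
Unset Printing Implicit Defensive.

Import Order.TTheory GRing.Theory Num.Theory.
Import numFieldNormedType.Exports.

Local Open Scope classical_set_scope.
Local Open Scope ring_scope.

(* Let Y be the torus R^(k+1)/Z^(k+1) with coordinates (x_k, ..., x_1, z) under the unipotent
   affine map S which adds x_(j-1) to x_j, rotates x_1 by a and z by b, where no nontrivial
   integer combination of a and b is rational. Y is a uniquely ergodic k-step nilsystem.

   X is the same torus with T = lim H_n S H_n^-1, where H_n = h_1 o ... o h_n and every h_n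
   preserves Haar measure, almost commutes with S and is the identity off a set of measure
   2^-n. By Borel-Cantelli the H_n converge almost everywhere to an isomorphism from Y to X,
   although the conjugates converge uniformly to a homeomorphism. Each h_n is a product of two
   shears y |-> y + W(z) and y |-> y + W(x_1), which suffices to move two orbit segments so as
   to join prescribed pairs of points, whence topological weak mixing. Smallness of a Birkhoff
   sum, uniformly over the space, is an open condition, which passes to the limit and gives
   unique ergodicity and minimality.

   A van der Corput argument along the lower central series shows that orbits of a
   (k-1)-step nilsystem are asymptotically orthogonal to polynomial phases of degree k with
   irrational leading coefficient. So factors of Y which are inverse limits of (k-1)-step
   nilsystems are orthogonal to characters involving x_k, that is, they factor through the
   projection forgetting x_k. This identifies Z_(k-1) with the corresponding system on
   (x_(k-1), ..., x_1, z), or with a point if k = 1, while Z_k = Y. *)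

(** * Tori *)

(** The rotation underlying Y has measurable eigenfunctions, which X inherits; topological weak
    mixing asks that none of them keeps a continuous version. So every coordinate must be displaced,
    those of the rotation included. A shear fixes its own base coordinate, and this is what z is
    for: over z all the x-coordinates can be moved, and z itself is then moved over x_1.

    Almost commuting with S is possible because 1 + N is unipotent: a displacement can be built up
    and undone along a long orbit of the base rotation by small pushes, and W lives near that orbit.

    The H_n do not converge uniformly and their Lipschitz constants grow. Hence h_(n+1) is chosen
    after H_n, so close to commuting with S that conjugation by H_n still changes the map very
    little. The requirements (rational points, a character, a precision) are countably many and
    treated one per step; each concerns finitely many iterates, so it survives all later, small
    enough changes. *)

Section distance_to_Z.
Variable R : realType.
Implicit Types s t : R.

Definition frac t : R := t - (Num.floor t)%:~R.

Lemma frac_ge0 t : 0 <= frac t.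
Proof. by rewrite subr_ge0 floor_le. Qed.

Lemma frac_lt1 t : frac t < 1.
Proof. by have /andP[_] := floor_itv t; rewrite intrD ltrBlDl. Qed.

Lemma frac_id t : 0 <= t < 1 -> frac t = t.
Proof.
move=> t01; rewrite /frac (_ : Num.floor t = 0) ?subr0 //.
by apply/eqP; rewrite floor_eq add0r.
Qed.

Lemma fracDz t (m : int) : frac (t + m%:~R) = frac t.
Proof. rewrite /frac floorDrz ?intr_int // intrKfloor intrD /=; ring. Qed.

Definition dZ t : R := Num.min (frac t) (1 - frac t).

Lemma dZ_le t (m : int) : dZ t <= `|t - m%:~R|.
Proof.
have [f0 f1] := (frac_ge0 t, frac_lt1 t).
have tE : t = (Num.floor t)%:~R + frac t by rewrite /frac; ring.
have [mt|mt] := leP m (Num.floor t).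
  have : (m%:~R : R) <= (Num.floor t)%:~R by rewrite ler_int.
  move=> h; rewrite ger0_norm; last lra.
  by rewrite ge_min; apply/orP; left; lra.
have : ((Num.floor t)%:~R + 1 : R) <= m%:~R by rewrite -[1]/(1%:~R) -intrD ler_int; lia.
move=> h; rewrite ler0_norm; last lra.
by rewrite ge_min; apply/orP; right; lra.
Qed.

Lemma dZ_ex t : exists m : int, dZ t = `|t - m%:~R|.
Proof.
have [f0 f1] := (frac_ge0 t, frac_lt1 t).
rewrite /dZ; case: leP => _.
  by exists (Num.floor t); rewrite ger0_norm // -/(frac t).
exists (Num.floor t + 1); rewrite intrD /=; rewrite /frac in f0 f1 *.
by rewrite ler0_norm; lra.
Qed.

Lemma dZ_ge0 t : 0 <= dZ t.
Proof. by have [m ->] := dZ_ex t. Qed.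

Lemma dZ_norm t : dZ t <= `|t|.
Proof. by have := dZ_le t 0; rewrite subr0. Qed.

Lemma dZD s t : dZ (s + t) <= dZ s + dZ t.
Proof.
have [m ->] := dZ_ex s; have [m' ->] := dZ_ex t.
apply: (le_trans (dZ_le _ (m + m'))).
by rewrite intrD opprD addrACA ler_normD.
Qed.

Lemma dZN t : dZ (- t) = dZ t.
Proof.
suff h u : dZ (- u) <= dZ u.
  by apply/eqP; rewrite eq_le h; have := h (- t); rewrite opprK.
have [m ->] := dZ_ex u; apply: (le_trans (dZ_le _ (- m))).
by rewrite -normrN intrN !opprB !opprK addrC.
Qed.

Lemma dZDz t (m : int) : dZ (t + m%:~R) = dZ t.
Proof. by rewrite /dZ fracDz. Qed.

Lemma dZ0 : dZ 0 = 0.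
Proof. by apply/eqP; rewrite eq_le dZ_ge0 andbT; have := dZ_norm 0; rewrite normr0. Qed.

Lemma dZ_int (m : int) : dZ m%:~R = 0.
Proof. by rewrite -[m%:~R]add0r dZDz dZ0. Qed.

Lemma dZ_eq0 t : (dZ t == 0) = (t \is a Num.int).
Proof.
apply/eqP/idP => [|/intrP[m ->]]; last exact: dZ_int.
by have [m ->] := dZ_ex t => /normr0_eq0/subr0_eq ->; rewrite intr_int.
Qed.

Lemma dZ_gt0 t : (0 < dZ t) = (t \isn't a Num.int).
Proof. by rewrite lt_neqAle dZ_ge0 andbT eq_sym dZ_eq0. Qed.

Lemma dZB s t : `|dZ s - dZ t| <= dZ (s - t).
Proof.
have := dZD (s - t) t; have := dZD (t - s) s; rewrite !subrK -(dZN (t - s)) opprB.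
by move=> h1 h2; rewrite ler_norml; apply/andP; split; lra.
Qed.

Lemma frac_eq s t : (frac s = frac t) <-> (s - t \is a Num.int).
Proof.
split=> [h|/intrP[m h]].
  have -> : s - t = (Num.floor s)%:~R - (Num.floor t)%:~R.
    by move: h; rewrite /frac => h; lra.
  by rewrite -intrB intr_int.
by rewrite -(subrK t s) h addrC fracDz.
Qed.

End distance_to_Z.

Section row_vectors.
Variables (R : realType) (d : nat).
Implicit Types u v : 'rV[R]_d.

Lemma rV_norm_le u (c : R) : 0 <= c -> (forall i, `|u 0 i| <= c) -> `|u| <= c.
Proof.
move=> c0 h; rewrite [`|u|]mx_normrE; apply: bigmax_le => //= -[i j] _ /=.
by rewrite (ord1 i).
Qed.

Lemma rV_norm_lt u (c : R) : 0 < c -> (forall i, `|u 0 i| < c) -> `|u| < c.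
Proof.
move=> c0 h; rewrite [`|u|]mx_normrE; apply: bigmax_lt => //= -[i j] _ /=.
by rewrite (ord1 i).
Qed.

Lemma rV_norm_entry u i : `|u 0 i| <= `|u|.
Proof.
rewrite [`|u|]mx_normrE (bigmaxD1 (0, i)) //=.
by rewrite le_max lexx.
Qed.

Definition mx_bound (A : 'M[R]_d) : R := \sum_i \sum_j `|A i j|.

Lemma mx_bound_ge0 A : 0 <= mx_bound A.
Proof. by apply: sumr_ge0 => i _; apply: sumr_ge0. Qed.

Lemma mulmx_norm u (A : 'M[R]_d) : `|u *m A| <= mx_bound A * `|u|.
Proof.
apply: rV_norm_le => [|j]; first by rewrite mulr_ge0 ?mx_bound_ge0.
rewrite mxE (le_trans (ler_norm_sum _ _ _)) // mulr_suml.
apply: ler_sum => i _; rewrite normrM mulrC.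
apply: ler_pM => //; last exact: rV_norm_entry.
by rewrite (bigD1 j) //= lerDl sumr_ge0.
Qed.

Definition intv u : bool := [forall i, u 0 i \is a Num.int].

Lemma intvP u : reflect (forall i, u 0 i \is a Num.int) (intv u).
Proof. exact: forallP. Qed.

End row_vectors.

Section torus.
Variables (R : realType) (d : nat).

(** A point is its representative in the half-open unit cube, so equality is equality of vectors.
    The topology comes from [tdist], which takes coordinate differences modulo 1, and not from the
    cube. *)
Record torus := Torus {
  tval :> 'rV[R]_d;
  tval_in : [forall i, 0 <= tval 0 i < 1] }.

HB.instance Definition _ := [isSub for tval].
HB.instance Definition _ := [Choice of torus by <:].

Implicit Types x y : torus.

Lemma tproj_in (u : 'rV[R]_d) : [forall i, 0 <= (map_mx (@frac R) u) 0 i < 1].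
Proof. by apply/forallP => i; rewrite mxE frac_ge0 frac_lt1. Qed.

Definition tproj (u : 'rV[R]_d) : torus := Torus (tproj_in u).

Lemma tproj_val x : tproj (tval x) = x.
Proof.
apply/val_inj/rowP => i; rewrite /= mxE frac_id //.
by have /forallP := tval_in x; apply.
Qed.

Lemma tprojP (u v : 'rV[R]_d) : tproj u = tproj v <-> intv (u - v).
Proof.
split=> [[/rowP h]|/intvP h].
  by apply/intvP => i; have := h i; rewrite !mxE => /frac_eq.
by apply/val_inj/rowP => i; rewrite /= !mxE; apply/frac_eq; have := h i; rewrite !mxE.
Qed.

Lemma tval_proj (u : 'rV[R]_d) : intv (tval (tproj u) - u).
Proof. by apply/tprojP; rewrite tproj_val. Qed.

Definition tdist x y : R := `|map_mx (@dZ R) (tval x - tval y)|.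

Lemma tdist_projE (u v : 'rV[R]_d) :
  tdist (tproj u) (tproj v) = `|map_mx (@dZ R) (u - v)|.
Proof.
congr (`|_|); apply/rowP => i; rewrite !mxE.
have /intvP/(_ i) := tval_proj u; have /intvP/(_ i) := tval_proj v.
rewrite !mxE => /intrP[m hm] /intrP[n hn].
have -> : frac (u 0 i) - frac (v 0 i) = (u 0 i - v 0 i) + (n - m)%:~R.
  by rewrite intrB -hm -hn; ring.
by rewrite dZDz.
Qed.

Lemma tdist_le x y (c : R) : 0 <= c ->
  (forall i, dZ (tval x 0 i - tval y 0 i) <= c) -> tdist x y <= c.
Proof.
move=> c0 h; apply: rV_norm_le => // i; rewrite !mxE ger0_norm ?dZ_ge0 //.
Qed.

Lemma tdist_entry x y i : dZ (tval x 0 i - tval y 0 i) <= tdist x y.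
Proof.
have := rV_norm_entry (map_mx (@dZ R) (tval x - tval y)) i.
by rewrite !mxE ger0_norm ?dZ_ge0.
Qed.

Lemma tdist_ge0 x y : 0 <= tdist x y. Proof. exact: normr_ge0. Qed.

Lemma tdistxx x : tdist x x = 0.
Proof.
apply/eqP; rewrite eq_le tdist_ge0 andbT.
by apply: tdist_le => // i; rewrite subrr dZ0.
Qed.

Lemma tdist_eq0 x y : tdist x y = 0 -> x = y.
Proof.
move=> h; rewrite -(tproj_val x) -(tproj_val y); apply/tprojP/intvP => i.
rewrite -dZ_eq0 eq_le dZ_ge0 andbT -h.
by have := tdist_entry x y i; rewrite !mxE.
Qed.

Lemma tdistC x y : tdist x y = tdist y x.
Proof.
by congr (`|_|); apply/rowP => i; rewrite !mxE -dZN opprB.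
Qed.

Lemma tdist_triangle y x z : tdist x z <= tdist x y + tdist y z.
Proof.
apply: tdist_le => [|i]; first by rewrite addr_ge0 ?tdist_ge0.
have -> : x 0 i - z 0 i = (x 0 i - y 0 i) + (y 0 i - z 0 i) by ring.
by rewrite (le_trans (dZD _ _)) // lerD // tdist_entry.
Qed.

HB.instance Definition _ := isPointed.Build torus (tproj 0).

HB.instance Definition _ := @isMetric.Build R torus tdist tdistxx tdist_eq0 tdistC tdist_triangle.

Lemma torus_ballE x (e : R) : ball x e = [set y | tdist x y < e].
Proof. by []. Qed.

Lemma tdist_proj_le (u v : 'rV[R]_d) : tdist (tproj u) (tproj v) <= `|u - v|.
Proof.
rewrite tdist_projE; apply: rV_norm_le => // i; rewrite mxE ger0_norm ?dZ_ge0 //.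
by rewrite (le_trans (dZ_norm _)) // rV_norm_entry.
Qed.


End torus.

Section metric_helpers.
Variable R : realType.

Lemma ball_continuousP (X Y : pseudoMetricType R) (f : X -> Y) :
  (forall x e, 0 < e -> exists2 r, 0 < r & forall y, ball x r y -> ball (f x) e (f y)) <->
  continuous f.
Proof.
split=> [h x|fc x e e0].
  apply/cvg_ballP => e e0; have [r r0 hr] := h x e e0.
  by apply/nbhs_ballP; exists r => //= y /hr.
have /cvg_ballP/(_ e e0) := fc x.
by move=> /nbhs_ballP[r /= r0 hr]; exists r => // y /hr.
Qed.

Lemma compact_finite_cover (X : ptopologicalType) (U : X -> set X) :
  compact [set: X] -> (forall x, nbhs x (U x)) ->
  exists s : seq X, forall y, exists2 x, x \in s & U x y.
Proof.
rewrite compact_cover => cX hU.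
have [||D _ hD] := cX X setT (fun x => (U x)°).
- by move=> x _; exact: open_interior.
- by move=> y _; exists y => //; exact: hU.
exists (finmap.enum_fset D) => y; have [x xD /interior_subset Ux] := hD y I.
by exists x.
Qed.

Lemma tproj_continuous d : continuous (@tproj R d).
Proof.
apply/ball_continuousP => u e e0; exists e => // v.
rewrite -ball_normE /= torus_ballE /=.
by apply: le_lt_trans; exact: tdist_proj_le.
Qed.

Lemma torus_compact d : compact [set: torus R d].
Proof.
have -> : [set: torus R d] = [set tproj u | u in [set v : 'rV[R]_d | forall i, `[0, 1]%classic (v ord0 i)]].
  apply/seteqP; split=> // x _; exists (tval x); last exact: tproj_val.
  move=> i /=; have /forallP/(_ i) := tval_in x.
  by rewrite in_itv /= => /andP[-> /ltW].
apply: continuous_compact; first exact/continuous_subspaceT/tproj_continuous.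
exact: (@rV_compact R d (fun=> `[(0:R), 1]%classic) (fun _ => @segment_compact R 0 1)).
Qed.

End metric_helpers.

(** * The Stone-Weierstrass theorem and trigonometric polynomials *)

Section stone_weierstrass.
Variables (R : realType) (X : ptopologicalType).
Hypothesis Xcompact : compact [set: X].
Variable P : set (X -> R).
Hypothesis Pcont : forall f, P f -> continuous f.
Hypothesis Pcst : forall c : R, P (fun=> c).
Hypothesis PD : forall f g, P f -> P g -> P (fun x => f x + g x).
Hypothesis PM : forall f g, P f -> P g -> P (fun x => f x * g x).
Hypothesis Psep : forall x y, x <> y -> exists2 f, P f & f x <> f y.

Let le_bigmax_mem c (F : X -> R) y (s : seq X) :
  y \in s -> F y <= \big[Num.max/c]_(z <- s) F z.
Proof.
elim: s => // a s IH; rewrite inE big_cons le_max => /orP[/eqP ->|/IH ->].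
  by rewrite lexx.
by rewrite orbT.
Qed.

Let ge_bigmin_mem c (F : X -> R) y (s : seq X) :
  y \in s -> \big[Num.min/c]_(z <- s) F z <= F y.
Proof.
elim: s => // a s IH; rewrite inE big_cons ge_min => /orP[/eqP ->|/IH ->].
  by rewrite lexx.
by rewrite orbT.
Qed.

Let Q (f : X -> R) := forall e : R, 0 < e -> exists2 g, P g & forall x, `|f x - g x| <= e.

Let PQ f : P f -> Q f.
Proof. by move=> Pf e e0; exists f => // x; rewrite subrr normr0 ltW. Qed.

Let Pbounded f : P f -> exists2 M : R, 0 < M & forall x, `|f x| <= M.
Proof.
move=> Pf.
have [||s hs] := @compact_finite_cover X (fun x => [set y | `|f x - f y| < 1]).
- exact: Xcompact.
- move=> x; have /cvgrPdist_lt/(_ 1 ltr01) := @Pcont f Pf x.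
  by [].
exists (\sum_(x <- s) `|f x| + 1) => [|y].
  by rewrite ltr_wpDl // sumr_ge0.
have [x xs /= h] := hs y.
have : `|f x| <= \sum_(x <- s) `|f x|.
  by rewrite (big_rem x) //= lerDl sumr_ge0.
have : `|f y| <= `|f x| + `|f x - f y|.
  by rewrite -{1}(subKr (f x) (f y)) (le_trans (ler_normB _ _)).
by move=> h1 h2; apply: (le_trans h1); rewrite lerD // ltW.
Qed.

Let Qbounded f : Q f -> exists2 M : R, 0 < M & forall x, `|f x| <= M.
Proof.
move=> /(_ 1 ltr01)[g /Pbounded[M M0 hM] h]; exists (1 + M) => [|x].
  by rewrite addr_gt0.
rewrite -(subrK (g x) (f x)) (le_trans (ler_normD _ _)) // lerD //.
Qed.

Let QD f g : Q f -> Q g -> Q (fun x => f x + g x).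
Proof.
move=> Qf Qg e e0; have e2 : 0 < e / 2 by rewrite divr_gt0.
have [f' Pf hf] := Qf _ e2; have [g' Pg hg] := Qg _ e2.
exists (fun x => f' x + g' x); first exact: PD.
move=> x; rewrite opprD addrACA (splitr e) (le_trans (ler_normD _ _)) // lerD //.
Qed.

Let QM f g : Q f -> Q g -> Q (fun x => f x * g x).
Proof.
move=> Qf Qg e e0; have [M M0 hM] := Qbounded Qf.
have e1 : 0 < e / (2 * M) by rewrite divr_gt0 // mulr_gt0.
have [g' Pg hg] := Qg _ e1; have [N N0 hN] := Pbounded Pg.
have e2 : 0 < e / (2 * N) by rewrite divr_gt0 // mulr_gt0.
have [f' Pf hf] := Qf _ e2.
exists (fun x => f' x * g' x); first exact: PM.
move=> x; have -> : f x * g x - f' x * g' x = f x * (g x - g' x) + (f x - f' x) * g' x by ring.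
have -> : e = M * (e / (2 * M)) + e / (2 * N) * N by field; rewrite !gt_eqF.
rewrite (le_trans (ler_normD _ _)) // lerD // normrM ler_pM //.
Qed.

Let Qcst c : Q (fun=> c). Proof. exact: PQ. Qed.

Let QZ c f : Q f -> Q (fun x => c * f x).
Proof. by move=> Qf; exact: (QM (Qcst c) Qf). Qed.

Let Qclosed f : (forall e : R, 0 < e -> exists2 g, Q g & forall x, `|f x - g x| <= e) -> Q f.
Proof.
move=> h e e0; have e2 : 0 < e / 2 by rewrite divr_gt0.
have [g Qg hg] := h _ e2; have [g' Pg hg'] := Qg _ e2.
exists g' => // x; have -> : f x - g' x = (f x - g x) + (g x - g' x) by ring.
by rewrite (splitr e) (le_trans (ler_normD _ _)) // lerD.
Qed.

(** The square-root iteration for [t ^+ 2] started at 0: polynomials in [t] increasing to the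
    absolute value on [-1, 1]. *)
Fixpoint abs_approx (n : nat) (t : R) : R :=
  if n is m.+1 then abs_approx m t + (t ^+ 2 - abs_approx m t ^+ 2) / 2 else 0.

(** With s the absolute value, a step multiplies the error by 1 - (s + p) / 2 <= 1 - s / 2, and (1 -
    s / 2) (1 + c + s / 2) <= 1 + c. The product form yields an error of at most 2 / n, uniformly up
    to t = 0, where the contraction degenerates. *)
Lemma abs_approxP n t : `|t| <= 1 ->
  0 <= abs_approx n t <= `|t| /\ (`|t| - abs_approx n t) * (1 + n%:R * (`|t| / 2)) <= `|t|.
Proof.
move=> t1; elim: n => [|n [/andP[h0 h1] h2]] /=.
  by rewrite lexx normr_ge0 mul0r addr0 mulr1 subr0.
set p := abs_approx n t in h0 h1 h2 *.
have -> : t ^+ 2 = `|t| ^+ 2 by rewrite real_normK // num_real.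
set s := `|t| in t1 h1 h2 *; have s0 : 0 <= s by exact: normr_ge0.
have E : s - (p + (s ^+ 2 - p ^+ 2) / 2) = (s - p) * (1 - (s + p) / 2) by field.
have n0 : 0 <= n%:R :> R by [].
split; first by nra.
have -> : (n.+1%:R : R) = n%:R + 1 by rewrite -natr1.
rewrite E; apply: le_trans h2.
rewrite -mulrA ler_wpM2l ?subr_ge0 //.
have : 0 <= n%:R * (s / 2) by rewrite mulr_ge0 // divr_ge0.
set c := n%:R * (s / 2) => c0.
have -> : (n%:R + 1) * (s / 2) = c + s / 2 by rewrite /c; field.
nra.
Qed.

Let Q_abs_approx n f : Q f -> Q (fun x => abs_approx n (f x)).
Proof.
move=> Qf; elim: n => [|n IH] /=; first exact: Qcst.
apply: QD => //.
have -> : (fun x => (f x ^+ 2 - abs_approx n (f x) ^+ 2) / 2) =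
  (fun x => 2^-1 * (f x * f x + (-1) * (abs_approx n (f x) * abs_approx n (f x)))).
  by apply/funext => x; field.
by apply/QZ/QD; [exact: QM|apply/QZ/QM].
Qed.

Let Qabs f : Q f -> Q (fun x => `|f x|).
Proof.
move=> Qf; have [M M0 hM] := Qbounded Qf.
have -> : (fun x => `|f x|) = (fun x => M * `|M^-1 * f x|).
  by apply/funext => x; rewrite normrM normfV (gtr0_norm M0) mulrA mulfV ?gt_eqF // mul1r.
apply: QZ; apply: Qclosed => e e0.
pose n := (Num.truncn (2 / e)).+1.
exists (fun x => abs_approx n (M^-1 * f x)); first exact/Q_abs_approx/QZ.
move=> x; have : `|M^-1 * f x| <= 1.
  by rewrite normrM normfV (gtr0_norm M0) mulrC ler_pdivrMr // mul1r.
move=> /(@abs_approxP n)[/andP[a0 a1] a2].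
set s := `|M^-1 * f x| in a1 a2 *.
have hn : 2 / e < n%:R by rewrite /n truncnS_gt.
have s0 : 0 <= s by exact: normr_ge0.
rewrite ger0_norm ?subr_ge0 //.
have [s00|sn0] := eqVneq s 0; first by rewrite s00 lerBlDr (le_trans (ltW e0)) // lerDl.
have sp : 0 < s by rewrite lt_neqAle eq_sym sn0.
rewrite ltr_pdivrMr // in hn.
set D := s - abs_approx n _ in a2 *; have D0 : 0 <= D by rewrite subr_ge0.
have N0 : 0 <= n%:R :> R by [].
have h : D * (n%:R * (s / 2)) <= s by apply: le_trans a2; rewrite mulrDr mulr1 lerDr.
have h' : D * n%:R <= 2.
  rewrite -(ler_pM2r sp); apply: le_trans (_ : 2 * (D * (n%:R * (s / 2))) <= _); last lra.
  by rewrite le_eqVlt; apply/orP; left; apply/eqP; field.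
rewrite leNgt; apply/negP => De.
have : n%:R * e <= D * n%:R by rewrite mulrC ler_wpM2r // ltW.
by move=> h3; have := lt_le_trans hn (le_trans h3 h'); rewrite ltxx.
Qed.

Let Qmax f g : Q f -> Q g -> Q (fun x => Num.max (f x) (g x)).
Proof.
move=> Qf Qg.
have -> : (fun x => Num.max (f x) (g x)) =
    (fun x => 2^-1 * ((f x + g x) + `|f x + (-1) * g x|)).
  by apply/funext => x; rewrite maxr_absE mulN1r; field.
by apply/QZ/QD; [exact: QD|apply/Qabs/QD => //; exact: QZ].
Qed.

Let Qmin f g : Q f -> Q g -> Q (fun x => Num.min (f x) (g x)).
Proof.
move=> Qf Qg.
have -> : (fun x => Num.min (f x) (g x)) =
    (fun x => 2^-1 * ((f x + g x) + (-1) * `|f x + (-1) * g x|)).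
  by apply/funext => x; rewrite minr_absE !mulN1r; field.
by apply/QZ/QD; [exact: QD|apply/QZ/Qabs/QD => //; exact: QZ].
Qed.

Let Qcont f : Q f -> continuous f.
Proof.
move=> Qf x; apply/cvgrPdist_lt => e e0; have e3 : 0 < e / 3 by rewrite divr_gt0.
have [g Pg hg] := Qf _ e3.
have /cvgrPdist_lt/(_ _ e3) := @Pcont g Pg x.
apply: filterS => y hy.
have -> : f x - f y = (f x - g x) + (g x - g y) - (f y - g y) by ring.
rewrite (le_lt_trans (ler_normB _ _)) // (le_lt_trans (lerD (ler_normD _ _) (hg y))) //.
have := hg x; set a := `|f x - _|; set b := `|g x - _| in hy *; lra.
Qed.

Let Qinterp x y (a b : R) : (x = y -> a = b) -> exists2 g, Q g & g x = a /\ g y = b.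
Proof.
move=> h; have [xy|xy] := pselect (x = y).
  by exists (fun=> a) => //; split => //; apply: h.
have [f Pf fxy] := Psep xy.
have D0 : f y - f x != 0 by rewrite subr_eq0; apply/eqP => /esym.
exists (fun z => a + (b - a) / (f y - f x) * (f z + (- f x))).
  by apply: QD => //; apply: QZ; apply: QD => //; exact: PQ.
by split; field.
Qed.

Theorem stone_weierstrass (f : X -> R) : continuous f ->
  forall e : R, 0 < e -> exists2 g, P g & forall x, `|f x - g x| <= e.
Proof.
move=> fc; suff : Q f by []; apply: Qclosed => e e0.
have below x : exists2 g, Q g & g x = f x /\ forall y, f y - e < g y.
  have /choice[g hg] y : exists g, Q g /\ (g x = f x /\ g y = f y).
    by have [|g Qg gxy] := @Qinterp x y (f x) (f y); [move=> ->|exists g].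
  have [|s hs] := @compact_finite_cover X (fun y => [set z | f z - e < g y z]) Xcompact.
    move=> y; have [Qg [_ gy]] := hg y.
    have : {for y, continuous (fun z => g y z - f z)}.
      by apply: cvgB; [exact: Qcont|exact: fc].
    move=> /cvgrPdist_lt/(_ e e0); apply: filterS => z /=.
    by rewrite gy subrr sub0r normrN ltr_norml => /andP[h _]; lra.
  (* The default [g x] takes the value [f x] at [x] like every [g y], so the maximum equals [f x]
     there even for an empty list. *)
  exists (fun z => \big[Num.max/g x z]_(y <- s) g y z).
    elim: s {hs} => [|y s IH].
      by under eq_fun do rewrite big_nil; have [] := hg x.
    by under eq_fun do rewrite big_cons; apply: Qmax => //; have [] := hg y.
  split.
    elim: s {hs} => [|y s IH]; first by rewrite big_nil; have [_ []] := hg x.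
    by rewrite big_cons IH; have [_ [-> _]] := hg y; rewrite maxxx.
  move=> z; have [y ys /= h] := hs z; apply: (lt_le_trans h).
  exact: (@le_bigmax_mem _ (g^~ z)).
have /choice[G hG] x : exists g, Q g /\ (g x = f x /\ forall y, f y - e < g y).
  by have [g Qg h] := below x; exists g.
have [|s hs] := @compact_finite_cover X (fun y => [set z | G y z < f z + e]) Xcompact.
  move=> y; have [Qg [gy _]] := hG y.
  have : {for y, continuous (fun z => G y z - f z)}.
    by apply: cvgB; [exact: Qcont|exact: fc].
  move=> /cvgrPdist_lt/(_ e e0); apply: filterS => z /=.
  by rewrite gy subrr sub0r normrN ltr_norml => /andP[_ h]; lra.
exists (fun z => \big[Num.min/G point z]_(y <- s) G y z).
  elim: s {hs} => [|y s IH].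
    by under eq_fun do rewrite big_nil; have [] := hG point.
  by under eq_fun do rewrite big_cons; apply: Qmin => //; have [] := hG y.
move=> z; rewrite ler_norml; apply/andP; split.
  have [y ys /= h] := hs z.
  suff : \big[Num.min/G point z]_(y <- s) G y z <= G y z by lra.
  exact: (@ge_bigmin_mem _ (G^~ z)).
suff : f z - e < \big[Num.min/G point z]_(y <- s) G y z by lra.
elim: s {hs} => [|y s IH].
  by rewrite big_nil; have [_ [_ ->]] := hG point.
by rewrite big_cons lt_min IH andbT; have [_ [_ ->]] := hG y.
Qed.

End stone_weierstrass.

Section normalized_cosine.
Variable R : realType.
Implicit Types s t : R.

(** The cosine of period 1. Characters are real throughout: cosines with an arbitrary phase, the
    shift by 1/4 supplying the sine. *)
Definition tc t : R := cos (pi *+ 2 * t).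

Lemma tcDz t (m : int) : tc (t + m%:~R) = tc t.
Proof.
have nat_case u (n : nat) : tc (u + n%:R) = tc u.
  rewrite /tc mulrDr mulr_natr.
  exact/periodicn/cosD2pi.
case: m => n; first exact: nat_case.
by rewrite NegzE intrN -{2}(subrK (n.+1%:R) t) [in RHS]nat_case.
Qed.

Lemma tc_int t (m : R) : m \is a Num.int -> tc (t + m) = tc t.
Proof. by move=> /intrP[k ->]; rewrite tcDz. Qed.

Lemma tc_max t : `|tc t| <= 1. Proof. exact: cos_max. Qed.

Lemma tc0 : tc 0 = 1. Proof. by rewrite /tc mulr0 cos0. Qed.

Lemma tc_half t : tc (t + 2^-1) = - tc t.
Proof. by rewrite /tc mulrDr (_ : pi *+ 2 * 2^-1 = pi) ?cosDpi //; rewrite mulr2n; field. Qed.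

Lemma tcM s t : tc s * tc t = 2^-1 * tc (s + t) + 2^-1 * tc (s - t).
Proof. by rewrite /tc mulrDr mulrBr cosD cosB; field. Qed.

Lemma tc_quarter t : tc (t - 4^-1) = sin (pi *+ 2 * t).
Proof.
rewrite /tc mulrBr (_ : pi *+ 2 * 4^-1 = pi / 2); first exact: cosBpihalf.
by rewrite -mulr_natr; field.
Qed.

(** The addition formula with sines written as shifted cosines: summed over the phases 0 and 1/4,
    products of two cosines collapse to the cosine of the difference. This replaces multiplication
    by a complex conjugate. *)
Lemma tcB s t : tc (s - t) = tc s * tc t + tc (s - 4^-1) * tc (t - 4^-1).
Proof. by rewrite !tc_quarter /tc mulrBr cosB. Qed.

Lemma tc_double t : tc t = 1 - 2 * sin (pi * t) ^+ 2.
Proof.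
have -> : tc t = cos (pi * t *+ 2) by rewrite /tc mulrnAl.
by rewrite cos_mulr2n cos2sin2; rewrite -mulr_natr; ring.
Qed.

Lemma tc_eq1 t : tc t = 1 -> t \is a Num.int.
Proof.
have -> : tc t = tc (frac t) by rewrite /frac -intrN tcDz.
have := frac_lt1 t; have := frac_ge0 t; rewrite le_eqVlt => /orP[/eqP f0 _ _|f0 f1].
  by rewrite -(subrK (Num.floor t)%:~R t) -/(frac t) -f0 add0r intr_int.
rewrite tc_double => h.
have : 0 < sin (pi * frac t).
  by apply: sin_gt0_pi; rewrite mulr_gt0 ?pi_gt0 //= gtr_pMr ?pi_gt0.
by nra.
Qed.

Lemma continuous_tc : continuous tc.
Proof.
move=> t; apply: (@continuous_comp _ _ _ (fun t => pi *+ 2 * t) cos).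
  exact: mulrl_continuous.
exact: continuous_cos.
Qed.

(** Multiplication by 2 sin(pi c) telescopes the sum. The bound depends neither on [b] nor on [N];
    the uniformity of all later averages over starting points originates here. *)
Lemma tc_progression (c b : R) (N : nat) : c \isn't a Num.int ->
  `|\sum_(n < N) tc (n%:R * c + b)| <= `|sin (pi * c)|^-1.
Proof.
move=> cZ; have s0 : sin (pi * c) != 0.
  apply: contra cZ => /eqP h; apply: tc_eq1.
  by rewrite tc_double h expr0n mulr0 subr0.
pose F n := sin (pi *+ 2 * (n%:R * c + b) - pi * c).
have E n : 2 * sin (pi * c) * tc (n%:R * c + b) = F n.+1 - F n.
  rewrite /F.
  have -> : pi *+ 2 * (n.+1%:R * c + b) - pi * c = pi *+ 2 * (n%:R * c + b) + pi * c.
    by rewrite -natr1; ring.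
  by rewrite sinD sinB /tc; ring.
have S : 2 * sin (pi * c) * \sum_(n < N) tc (n%:R * c + b) = F N - F 0%N.
  rewrite mulr_sumr; under eq_bigr do rewrite E.
  by rewrite -(big_mkord xpredT (fun n => F n.+1 - F n)) telescope_sumr.
rewrite -div1r ler_pdivlMr ?normr_gt0 // mulrC -normrM.
rewrite -(ler_pM2l (ltr0n R 2)) mulr1 -[X in X * _](ger0_norm (ler0n R 2)) -normrM mulrA S.
rewrite (le_trans (ler_normB _ _)) // -[leRHS]/(1 + 1) lerD // sin_max //.
Qed.

End normalized_cosine.

Section trigonometric_polynomials.
Variables (R : realType) (d : nat).
Implicit Types (x y : torus R d) (m : 'rV[int]_d).

Lemma torus_lift x y : exists2 v, y = tproj (tval x + v) & `|v| = tdist x y.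
Proof.
have /choice[m hm] (i : 'I_d) := dZ_ex (y 0 i - x 0 i).
exists (\row_i (y 0 i - x 0 i - (m i)%:~R)).
  rewrite -{1}(tproj_val y); apply/tprojP/intvP => i; rewrite !mxE.
  have -> : y 0 i - (x 0 i + (y 0 i - x 0 i - (m i)%:~R)) = (m i)%:~R by ring.
  exact: intr_int.
rewrite tdistC; apply/eqP; rewrite eq_le; apply/andP; split.
  apply: rV_norm_le => [|i]; first exact: tdist_ge0.
  by rewrite mxE -hm; exact: tdist_entry.
by apply: tdist_le => // i; rewrite hm; have := rV_norm_entry (\row_i (y 0 i - x 0 i - (m i)%:~R)) i; rewrite mxE.
Qed.

Lemma torus_continuous (Y : pseudoMetricType R) (f : torus R d -> Y) :
  continuous (f \o @tproj R d) -> continuous f.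
Proof.
move=> fc; apply/ball_continuousP => x e e0.
have /ball_continuousP/(_ (tval x) e e0)[r r0 hr] := fc.
exists r => // y; rewrite torus_ballE /= => xy.
have [v vE vn] := torus_lift x y.
have := hr (tval x + v); rewrite /= tproj_val vE; apply.
by rewrite mx_norm_ball /ball_ /= opprD addNKr normrN vn.
Qed.

Definition dotp m (u : 'rV[R]_d) : R := \sum_i (m 0 i)%:~R * u 0 i.

Lemma dotpD m u v : dotp m (u + v) = dotp m u + dotp m v.
Proof. by rewrite -big_split; apply: eq_bigr => i _; rewrite mxE mulrDr. Qed.

Lemma dotpN m u : dotp m (- u) = - dotp m u.
Proof. by rewrite -sumrN; apply: eq_bigr => i _; rewrite mxE mulrN. Qed.

Lemma dotpB m u v : dotp m (u - v) = dotp m u - dotp m v.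
Proof. by rewrite dotpD dotpN. Qed.

Lemma dotpDl m n u : dotp (m + n) u = dotp m u + dotp n u.
Proof. by rewrite -big_split; apply: eq_bigr => i _; rewrite mxE intrD mulrDl. Qed.

Lemma dotpNl m u : dotp (- m) u = - dotp m u.
Proof. by rewrite -sumrN; apply: eq_bigr => i _; rewrite mxE intrN mulNr. Qed.

Lemma dotp0l u : dotp 0 u = 0.
Proof. by rewrite /dotp big1 // => i _; rewrite mxE mul0r. Qed.

Lemma dotp_int m u : intv u -> dotp m u \is a Num.int.
Proof. by move=> /intvP h; apply: rpred_sum => i _; rewrite rpredM ?intr_int. Qed.

Lemma dotp_delta i c u : dotp (c *: delta_mx 0 i) u = c%:~R * u 0 i.
Proof.
rewrite /dotp (bigD1 i) //= big1 => [|j ji]; rewrite !mxE !eqxx ?mulr1 ?addr0 //=.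
by rewrite (negPf ji) mulr0 mul0r.
Qed.

Definition tchar m (c : R) x : R := tc (dotp m (tval x) + c).

Lemma tchar_proj m c u : tchar m c (tproj u) = tc (dotp m u + c).
Proof.
rewrite /tchar.
have -> : dotp m (tproj u) + c = (dotp m u + c) + dotp m (tval (tproj u) - u).
  by rewrite dotpB; ring.
by apply/tc_int/dotp_int; exact: tval_proj.
Qed.

Lemma dotp_bound m u : `|dotp m u| <= (\sum_i `|(m 0 i)%:~R|) * `|u|.
Proof.
rewrite (le_trans (ler_norm_sum _ _ _)) // mulr_suml ler_sum // => i _.
by rewrite normrM ler_wpM2l // rV_norm_entry.
Qed.

Lemma dotp_continuous m : continuous (dotp m).
Proof.
apply/ball_continuousP => u e e0.
exists (e / (1 + \sum_i `|(m 0 i)%:~R|)).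
  by rewrite divr_gt0 // ltr_wpDr ?sumr_ge0.
move=> v; rewrite mx_norm_ball /ball_ /= ltr_pdivlMr; last by rewrite ltr_wpDr ?sumr_ge0.
rewrite -ball_normE /= -dotpB; apply: le_lt_trans.
by rewrite (le_trans (dotp_bound _ _)) // mulrC ler_wpM2l // lerDr.
Qed.

Lemma tchar_continuous m c : continuous (tchar m c).
Proof.
apply: torus_continuous => u.
have -> : tchar m c \o @tproj R d = @tc R \o (fun u => dotp m u + c).
  by apply/funext => v; rewrite /= tchar_proj.
apply: continuous_comp; last exact: continuous_tc.
exact: (cvgD (@dotp_continuous m u) (cvg_cst c)).
Qed.

Lemma tchar_max m c x : `|tchar m c x| <= 1. Proof. exact: tc_max. Qed.

Inductive trig : (torus R d -> R) -> Prop :=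
| trig_char m c : trig (tchar m c)
| trigD f g : trig f -> trig g -> trig (fun x => f x + g x)
| trigZ a f : trig f -> trig (fun x => a * f x).

Lemma trig_cst c : trig (fun=> c).
Proof.
have -> : (fun=> c) = (fun x => c * tchar 0 0 x).
  by apply/funext => x; rewrite /tchar dotp0l addr0 tc0 mulr1.
exact/trigZ/trig_char.
Qed.

Lemma trig_continuous f : trig f -> continuous f.
Proof.
elim=> [m c|{}f g _ fc _ gc|a {}f _ fc] x; first exact: tchar_continuous.
  exact: (cvgD (fc x) (gc x)).
exact: (cvgM (cvg_cst a) (fc x)).
Qed.

Lemma trigM f g : trig f -> trig g -> trig (fun x => f x * g x).
Proof.
move=> tf; elim=> [m c|g1 g2 _ h1 _ h2|a h _ IH]; last 2 first.
- have -> : (fun x => f x * (g1 x + g2 x)) = (fun x => f x * g1 x + f x * g2 x).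
    by apply/funext => x; rewrite mulrDr.
  exact: trigD.
- have -> : (fun x => f x * (a * h x)) = (fun x => a * (f x * h x)).
    by apply/funext => x; rewrite mulrCA.
  exact: trigZ.
elim: tf => [m' c'|g1 g2 _ h1 _ h2|a h _ IH]; last 2 first.
- have -> : (fun x => (g1 x + g2 x) * tchar m c x) =
      (fun x => g1 x * tchar m c x + g2 x * tchar m c x).
    by apply/funext => x; rewrite mulrDl.
  exact: trigD.
- have -> : (fun x => a * h x * tchar m c x) = (fun x => a * (h x * tchar m c x)).
    by apply/funext => x; rewrite mulrA.
  exact: trigZ.
have -> : (fun x => tchar m' c' x * tchar m c x) =
    (fun x => 2^-1 * tchar (m' + m) (c' + c) x + 2^-1 * tchar (m' - m) (c' - c) x).
  apply/funext => x; rewrite /tchar tcM dotpDl dotpDl dotpNl.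
  by congr (_ * tc _ + _ * tc _); ring.
by apply: trigD; apply: trigZ; exact: trig_char.
Qed.

(** The phases 0 and -1/4 give the cosine and the sine of each coordinate; if both agree, the cosine
    of the coordinate difference is 1 and that difference is an integer. *)
Lemma trig_sep x y : x <> y -> exists2 f, trig f & f x <> f y.
Proof.
move=> xy; apply: contrapT => h.
have eq_tr m c : tchar m c x = tchar m c y.
  by apply: contrapT => hn; apply: h; exists (tchar m c) => //; exact: trig_char.
apply: xy; rewrite -(tproj_val x) -(tproj_val y); apply/tprojP/intvP => i.
apply: tc_eq1; rewrite !mxE.
have := eq_tr (1 *: delta_mx 0 i) 0; have := eq_tr (1 *: delta_mx 0 i) (- 4^-1).
rewrite /tchar !dotp_delta !mul1r !addr0 => h1 h2; rewrite tcB h1 h2.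
by rewrite -tcB subrr tc0.
Qed.

Lemma trig_dense (f : torus R d -> R) : continuous f ->
  forall e, 0 < e -> exists2 g, trig g & forall x, `|f x - g x| <= e.
Proof.
apply: stone_weierstrass.
- exact: torus_compact.
- exact: trig_continuous.
- exact: trig_cst.
- exact: trigD.
- exact: trigM.
- exact: trig_sep.
Qed.

End trigonometric_polynomials.

(** * Integration against Borel probabilities; Haar measure *)

Section bounded_integral.
Context d (T : measurableType d) (R : realType) (P : probability T R).
Implicit Types f g : T -> R.

Definition bmeas f := measurable_fun setT f /\ exists M, forall x, `|f x| <= M.

Lemma bmeas_cst c : bmeas (fun=> c).
Proof. by split; [exact: measurable_cst|exists `|c|]. Qed.

Lemma bmeasD f g : bmeas f -> bmeas g -> bmeas (fun x => f x + g x).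
Proof.
move=> [mf [M hM]] [mg [N hN]]; split; first exact: measurable_funD.
by exists (M + N) => x; rewrite (le_trans (ler_normD _ _)) // lerD.
Qed.

Lemma bmeasM f g : bmeas f -> bmeas g -> bmeas (fun x => f x * g x).
Proof.
move=> [mf [M hM]] [mg [N hN]]; split; first exact: measurable_funM.
by exists (M * N) => x; rewrite normrM ler_pM.
Qed.

Lemma bmeasZ c f : bmeas f -> bmeas (fun x => c * f x).
Proof. by move=> bf; apply: bmeasM => //; exact: bmeas_cst. Qed.

Lemma bmeas_indic (A : set T) : measurable A -> bmeas (\1_A : T -> R).
Proof.
move=> mA; split; first exact: measurable_indic.
by exists 1 => x; rewrite indicE; case: (x \in A); rewrite /= ?normr1 ?normr0.
Qed.

Lemma bmeas_sum (I : Type) (s : seq I) (F : I -> T -> R) :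
  (forall i, bmeas (F i)) -> bmeas (fun x => \sum_(i <- s) F i x).
Proof.
move=> bF; elim: s => [|i s IH].
  by under eq_fun do rewrite big_nil; exact: bmeas_cst.
by under eq_fun do rewrite big_cons; exact: bmeasD.
Qed.

Lemma bmeas_integrable f : bmeas f -> P.-integrable setT (EFin \o f).
Proof.
move=> [mf [M hM]]; apply: measurable_bounded_integrable => //.
  exact: le_lt_trans (probability_le1 _ _) (ltry 1).
exists M; split; first exact: num_real.
by move=> x Mx y _; exact: le_trans (hM y) (ltW Mx).
Qed.

Definition expect f : R := \int[P]_x f x.

Lemma expect_cst c : expect (fun=> c) = c.
Proof. rewrite /expect Rintegral_cst //= (_ : fine _ = 1) ?mulr1 //.
  by have -> := @probability_setT _ _ _ P. Qed.

Lemma expectD f g : bmeas f -> bmeas g ->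
  expect (fun x => f x + g x) = expect f + expect g.
Proof. by move=> bf bg; apply: RintegralD => //; exact: bmeas_integrable. Qed.

Lemma expectZ c f : bmeas f -> expect (fun x => c * f x) = c * expect f.
Proof. by move=> bf; apply: RintegralZl => //; exact: bmeas_integrable. Qed.

Lemma expectN f : bmeas f -> expect (fun x => - f x) = - expect f.
Proof.
by move=> bf; rewrite -mulN1r -expectZ //; congr expect; apply/funext => x; rewrite mulN1r.
Qed.

Lemma expectB f g : bmeas f -> bmeas g ->
  expect (fun x => f x - g x) = expect f - expect g.
Proof.
move=> bf bg; rewrite expectD ?expectN //.
by under eq_fun do rewrite -mulN1r; exact: bmeasZ.
Qed.

Lemma expect_sum (I : Type) (s : seq I) (F : I -> T -> R) : (forall i, bmeas (F i)) ->
  expect (fun x => \sum_(i <- s) F i x) = \sum_(i <- s) expect (F i).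
Proof.
move=> bF; elim: s => [|i s IH].
  rewrite big_nil -[RHS]expect_cst; congr expect; apply/funext => x; exact: big_nil.
rewrite big_cons -IH -expectD //; last exact: bmeas_sum.
by congr expect; apply/funext => x; exact: big_cons.
Qed.

Lemma expect_ge0 f : (forall x, 0 <= f x) -> 0 <= expect f.
Proof. by move=> f0; exact: Rintegral_ge0. Qed.

Lemma expect_norm f e : bmeas f -> (forall x, `|f x| <= e) -> `|expect f| <= e.
Proof.
move=> bf h.
have be c : bmeas (fun x => e + c * f x) by apply: bmeasD; [exact: bmeas_cst|exact: bmeasZ].
have bc c : bmeas (fun x => c * f x) by exact: bmeasZ.
have H c : `|c| = 1 -> 0 <= e + c * expect f.
  move=> c1; rewrite -(expect_cst e) -expectZ // -expectD //; last exact: bmeas_cst.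
  apply: expect_ge0 => x; have : `|c * f x| <= e by rewrite normrM c1 mul1r.
  by rewrite ler_norml => /andP[h1 _]; lra.
have h1 := H 1 (normr1 _); have := H (-1); rewrite normrN1 => /(_ erefl) h2.
by rewrite ler_norml; apply/andP; split; lra.
Qed.

Lemma expect_ae f g : bmeas f -> bmeas g -> {ae P, forall x, f x = g x} ->
  expect f = expect g.
Proof.
move=> [mf _] [mg _] fg; congr fine; apply: ae_eq_integral => //.
- exact/measurable_EFinP.
- exact/measurable_EFinP.
- by apply: filterS fg => x h _; rewrite /= h.
Qed.

Lemma expect_indic (A : set T) : measurable A -> expect (\1_A : T -> R) = fine (P A).
Proof.
by move=> mA; rewrite /expect /Rintegral integral_indic // setIT.
Qed.

Lemma expect_dct (F : nat -> T -> R) f M :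
  (forall n, measurable_fun setT (F n)) -> (forall n x, `|F n x| <= M) ->
  measurable_fun setT f -> (forall x, F ^~ x @ \oo --> f x) ->
  expect (F n) @[n --> \oo] --> expect f.
Proof.
move=> mF hM mf Ff.
have [|||||intf _] := @dominated_convergence _ _ _ P setT measurableT
    (fun n x => (F n x)%:E) (EFin \o f) (fun=> M%:E).
- by move=> n; exact/measurable_EFinP.
- exact/measurable_EFinP.
- by apply: nearW => x _; apply/fine_cvgP => /=; split; [exact: nearW|exact: Ff].
- have bM : bmeas (fun=> M) by exact: bmeas_cst.
  exact: (bmeas_integrable bM).
- by apply: nearW => x n _; rewrite /= lee_fin.
rewrite -[X in _ --> X -> _]fineK; last exact: integrable_fin_num.
by move=> h; exact: fine_cvg.
Qed.

Definition push d' (T' : measurableType d') (f : T -> T') (mf : measurable_fun setT f) :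
    probability T' R :=
  distribution P (MeasurableFun.Pack (MeasurableFun.Class (isMeasurableFun.Build _ _ _ _ _ mf))).

Lemma pushE d' (T' : measurableType d') (f : T -> T') (mf : measurable_fun setT f) A :
  push mf A = P (f @^-1` A).
Proof. by []. Qed.

End bounded_integral.

Lemma bmeas_comp d d' (T : measurableType d) (T' : measurableType d') (R : realType)
    (f : T -> T') (g : T' -> R) :
  measurable_fun setT f -> bmeas g -> bmeas (g \o f).
Proof.
move=> mf [mg [M hM]]; split; first exact: measurableT_comp.
by exists M => x; exact: hM.
Qed.

Lemma expect_push d d' (T : measurableType d) (T' : measurableType d') (R : realType)
    (P : probability T R) (f : T -> T') (mf : measurable_fun setT f) (g : T' -> R) :
  bmeas g -> expect (push P mf) g = expect P (g \o f).
Proof.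
move=> bg; congr fine; rewrite /push integral_pushforward //=.
  by apply/measurable_EFinP; case: bg.
by rewrite preimage_setT; have /(bmeas_integrable P) := bmeas_comp mf bg.
Qed.

Section borel_sets.
Variables (R : realType) (X : pmetricType R).

Lemma borel_open (U : set X) : open U -> borel_set U.
Proof. exact: sub_sigma_algebra. Qed.

Lemma continuous_measurable (Y : pmetricType R) (f : X -> Y) :
  continuous f -> measurable_fun [set: borel X] (f : borel X -> borel Y).
Proof.
move=> /continuousP fc; apply: (@measurability _ _ (borel X) (borel Y) setT f (@open Y)) => //.
by move=> _ [B oB <-]; rewrite setTI; apply: borel_open; exact: fc.
Qed.

Lemma continuous_measurableR (f : X -> R) :
  continuous f -> measurable_fun [set: borel X] (f : borel X -> R).
Proof.
move=> /continuousP fc.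
apply: (@measurability _ _ (borel X) _ setT f _ (measurable_realfun.RGenOpens.measurableE R)).
move=> _ [_ [a [b ->]] <-]; rewrite setTI; apply: borel_open; apply: fc.
exact: interval_open.
Qed.

Lemma dist_to_closed (A : set X) : closed A -> A !=set0 ->
  exists f : X -> R, [/\ continuous f, forall x, 0 <= f x & forall x, f x = 0 <-> A x].
Proof.
move=> cA [a0 Aa0]; pose f x := inf [set mdist x a | a in A].
have lb x : has_lbound [set mdist x a | a in A].
  by exists 0 => _ [a _ <-]; exact: mdist_ge0.
have ne x : [set mdist x a | a in A] !=set0 by exists (mdist x a0), a0.
have f0 x : 0 <= f x by apply: lb_le_inf => // _ [a _ <-]; exact: mdist_ge0.
have fle x a : A a -> f x <= mdist x a by move=> Aa; apply: ge_inf => //; exists a.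
have lip x y : f x <= mdist x y + f y.
  rewrite -lerBlDl; apply: lb_le_inf => // _ [a Aa <-].
  by rewrite lerBlDl (le_trans (fle _ _ Aa)) // metric_triangle.
exists f; split => // [|x].
  apply/ball_continuousP => x e e0; exists e => // y; rewrite ballEmdist /= => xy.
  rewrite -ball_normE /=; apply: le_lt_trans xy.
  by rewrite ler_norml; have := lip x y; have := lip y x; rewrite (metric_sym y x); lra.
split=> [fx0|Ax]; last first.
  by apply/eqP; rewrite eq_le f0 andbT -(mdistxx x) fle.
apply: cA => U /nbhs_ballP[e /= e0 hU].
have : inf [set mdist x a | a in A] < e by rewrite -/(f x) fx0.
move=> /inf_lt -/(_ (ne x))[_ [a Aa <-] xa]; exists a; split => //.
by apply: hU; rewrite ballEmdist.
Qed.

Lemma open_indic_limit (U : set X) : open U -> exists F : nat -> X -> R,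
  [/\ forall n, continuous (F n), forall n x, 0 <= F n x <= 1 &
      forall x, F ^~ x @ \oo --> (\1_U x : R)].
Proof.
move=> oU; have [UT|/set0P AU] := eqVneq (~` U) set0.
  exists (fun _ _ => 1); split.
  - by move=> n; exact: cst_continuous.
  - by move=> *; rewrite lexx ler01.
  - have -> : U = setT by rewrite -(setCK U) UT setC0.
    by move=> x; rewrite indicT; exact: cvg_cst.
have [f [fc f0 fU]] := dist_to_closed (open_closedC oU) AU.
exists (fun n x => Num.min 1 (n%:R * f x)); split.
- move=> n x; apply: (@continuous_min _ _ (fun=> 1) (fun x => n%:R * f x)).
    exact: cvg_cst.
  exact: (cvgM (cvg_cst (n%:R : R)) (fc x)).
- move=> n x; rewrite ge_min lexx andbT le_min ler01 /=.
  by rewrite mulr_ge0.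
- move=> x; have [Ux|Ux] := pselect (U x); last first.
    have fx0 : f x = 0 by apply/fU.
    rewrite indicE memNset //= fx0.
    apply: cvg_near_cst; apply: nearW => n; rewrite mulr0.
    by apply/eqP; rewrite minEle ler10.
  rewrite indicE mem_set //=; apply: cvg_near_cst.
  have fx : 0 < f x by rewrite lt_neqAle f0 andbT eq_sym; apply/eqP => /fU; exact.
  exists (Num.truncn (f x)^-1).+1 => // n /= hn.
  apply/eqP; rewrite minEle ifT // -ler_pdivrMr // div1r.
  rewrite (le_trans (ltW (truncnS_gt _))) // ler_nat //.
Qed.

Lemma borel_lambda (H : set (set X)) : lambda_system setT H ->
  (forall U, open U -> H U) -> forall A, borel_set A -> H A.
Proof.
move=> lH oH A mA.
have := @lambda_system_subset X open _ setT H lH oH.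
by apply => //; exact: openI.
Qed.

Lemma bmeas_continuous (f : X -> R) M : continuous f -> (forall x, `|f x| <= M) ->
  bmeas (f : borel X -> R).
Proof. by move=> fc fM; split; [exact: continuous_measurableR|exists M]. Qed.

Lemma min1_norm (F : X -> R) : (forall x, 0 <= F x <= 1) -> forall x, `|F x| <= 1.
Proof. by move=> h x; have /andP[h0 h1] := h x; rewrite ger0_norm. Qed.

Lemma prob_eq_continuous (m1 m2 : probability (borel X) R) :
  (forall f : X -> R, continuous f -> (forall x, 0 <= f x <= 1) ->
     expect m1 f = expect m2 f) ->
  forall A, borel_set A -> m1 A = m2 A.
Proof.
move=> h A mA; apply: (@measure_unique _ _ (borel X) open (fun=> setT)) => //.
- exact: openI.
- by move=> _; exact: openT.
- by rewrite bigcup_const.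
- move=> U oU; have [F [Fc F01 FU]] := open_indic_limit oU.
  have mU : measurable (U : set (borel X)) by exact: borel_open.
  have lim (m : probability (borel X) R) : expect m (F n) @[n --> \oo] --> expect m (\1_U : X -> R).
    apply: (@expect_dct _ _ _ _ _ _ 1) => //.
    - by move=> n; apply: continuous_measurableR; exact: Fc.
    - by move=> n; apply: min1_norm; exact: F01.
  have E : expect m1 (\1_U : borel X -> R) = expect m2 (\1_U : borel X -> R).
    apply: (cvg_unique _ (lim m1)); first exact: norm_hausdorff.
    rewrite (_ : (fun n => _) = (fun n => expect m2 (F n))); first exact: lim.
    by apply/funext => n; apply: h; [exact: Fc|exact: F01].
  rewrite -[LHS]fineK; last exact: fin_num_measure.
  rewrite -[RHS]fineK; last exact: fin_num_measure.
  by rewrite -!expect_indic // E.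
- by move=> k; exact: le_lt_trans (probability_le1 _ _) (ltry 1).
Qed.

(** The sets over which [G] integrates to 0 form a lambda-system. It contains the open sets, whose
    indicators are limits of continuous functions, hence all Borel sets, in particular those where
    [G] is positive or negative. *)
Lemma expect_orth_continuous (m : probability (borel X) R) (G : X -> R) :
  bmeas (G : borel X -> R) ->
  (forall f : X -> R, continuous f -> (forall x, 0 <= f x <= 1) ->
     expect m (fun x => G x * f x) = 0) ->
  {ae m, forall x, G x = 0}.
Proof.
move=> bG h; pose H := [set A : set X | borel_set A /\ expect m (fun x => G x * \1_A x) = 0].
have bG1 (A : set X) : borel_set A -> bmeas (fun x : borel X => G x * \1_A x).
  by move=> mA; apply: bmeasM => //; exact: bmeas_indic.
have HB A : borel_set A -> H A.
  apply: borel_lambda => [|U oU].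
    split => //.
    - split; first exact: (@measurableT _ (borel X)).
      rewrite -(h (fun=> 1)); last 2 first.
        exact: cst_continuous.
        by move=> _; rewrite ler01 lexx.
      by congr expect; apply/funext => x; rewrite indicT.
    - move=> C B BA [mC hC] [mB hB].
      have mAB : borel_set (C `\` B) by exact: (@measurableD _ (borel X)).
      split => //; rewrite -[RHS]subr0 -{1}hC -hB -expectB; [|exact: bG1|exact: bG1].
      congr expect; apply/funext => x; rewrite -mulrBr; congr (_ * _).
      rewrite !indicE in_setD; case: (boolP (x \in B)) => xB; rewrite ?andbF ?andbT ?subr0 //.
      by rewrite (_ : x \in C) ?subrr //; apply/mem_set/BA/set_mem.
    - move=> F ndF HF.
      have mF n : borel_set (F n) by case: (HF n).
      have mU : borel_set (\bigcup_n F n) by exact: (@bigcupT_measurable _ (borel X)).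
      split => //.
      have : expect m (fun x => G x * \1_(F n) x) @[n --> \oo] -->
          expect m (fun x => G x * \1_(\bigcup_n F n) x).
        have [M hM] := bG.2.
        apply: (@expect_dct _ _ _ _ _ _ M) => //.
        - by move=> n; have [] := bG1 _ (mF n).
        - move=> n x; rewrite normrM (le_trans _ (hM x)) // ler_piMr //.
          by rewrite indicE; case: (_ \in _); rewrite ?normr1 ?normr0.
        - by have [] := bG1 _ mU.
        move=> x; apply: cvgM; first exact: cvg_cst.
        apply: cvg_near_cst; have [[N _ FNx]|nx] := pselect ((\bigcup_n F n) x).
          exists N => // n /= Nn; rewrite !indicE !mem_set //; first by exists N.
          by move: FNx; apply/subsetPset/ndF.
        apply: nearW => n; rewrite !indicE !memNset // => Fx; apply: nx; by exists n.
      rewrite (_ : (fun n => _) = fun=> 0); last by apply/funext => n; case: (HF n).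
      move=> hl; apply/esym; apply: (cvg_unique _ _ hl); first exact: norm_hausdorff.
      exact: cvg_cst.
  split; first exact: borel_open.
  have [F [Fc F01 FU]] := open_indic_limit oU.
  have : expect m (fun x => G x * F n x) @[n --> \oo] --> expect m (fun x => G x * \1_U x).
    have [M hM] := bG.2.
    apply: (@expect_dct _ _ _ _ _ _ M) => //.
    - move=> n; have [] // := bmeasM bG (@bmeas_continuous (F n) 1 (Fc n) (min1_norm (F01 n))).
    - move=> n x; rewrite normrM (le_trans _ (hM x)) // ler_piMr //.
      by apply: min1_norm; exact: F01.
    - by have [] := bG1 _ (borel_open oU).
    by move=> x; apply: cvgM; [exact: cvg_cst|exact: FU].
  rewrite (_ : (fun n => _) = fun=> 0); last by apply/funext => n; apply: h; [exact: Fc|exact: F01].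
  move=> hl; apply/esym; apply: (cvg_unique _ _ hl); first exact: norm_hausdorff.
  exact: cvg_cst.
have mpos : borel_set [set x | 0 < G x].
  have := bG.1 (@measurableT _ (borel X)) _ (measurable_itv `]0, +oo[); rewrite setTI.
  by congr measurable; apply/seteqP; split => x /=; rewrite in_itv /= andbT.
have mneg : borel_set [set x | G x < 0].
  have := bG.1 (@measurableT _ (borel X)) _ (measurable_itv `]-oo, 0[); rewrite setTI.
  by congr measurable; apply/seteqP; split => x /=; rewrite in_itv /=.
have E : expect m (fun x => `|G x|) = 0.
  rewrite (_ : (fun x => _) = fun x => G x * \1_[set x | 0 < G x] x - G x * \1_[set x | G x < 0] x).
    rewrite expectB; [|exact: bG1|exact: bG1].
    by rewrite (HB _ mpos).2 (HB _ mneg).2 subrr.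
  apply/funext => x; rewrite !indicE; case: (ltgtP (G x) 0) => Gx.
  - by rewrite memNset ?mem_set //= ?mulr0 ?mulr1 ?sub0r ?ltr0_norm // => /lt_trans/(_ Gx); rewrite ltxx.
  - by rewrite mem_set ?memNset //= ?mulr0 ?mulr1 ?subr0 ?gtr0_norm // => /lt_trans/(_ Gx); rewrite ltxx.
  - by rewrite Gx normr0 !mul0r subr0.
have mG : measurable_fun setT (fun x : borel X => (G x)%:E) by apply/measurable_EFinP; case: bG.
have : (\int[m]_x `|(G x)%:E| = 0)%E.
  move: E; rewrite /expect /Rintegral => E.
  rewrite -[LHS]fineK ?E //.
  have := bmeas_integrable m bG => /integrableP[_ h1].
  by rewrite ge0_fin_numE //; apply: integral_ge0.
move=> /(ae_eq_integral_abs _ measurableT mG).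
by apply: filterS => x h0; have /= := h0 I => -[].
Qed.

End borel_sets.

Lemma countable_bigcup_measurable d (T : measurableType d) (U : Type) (I : set U)
    (F : U -> set T) :
  countable I -> (forall i, I i -> measurable (F i)) -> measurable (\bigcup_(i in I) F i).
Proof.
move=> /pfcard_geP[-> _|[f] mF]; first by rewrite bigcup_set0.
have -> : \bigcup_(i in I) F i = \bigcup_n F (f n).
  apply/seteqP; split => [x [i Ii Fx]|x [n _ Fx]].
    by have [n _ ni] := @surj _ _ _ _ f _ Ii; exists n => //; rewrite ni.
  by exists (f n) => //; exact: funS.
by apply: bigcupT_measurable => n; apply: mF; exact: funS.
Qed.

(** Product measures live on the product sigma-algebra, while continuity provides open sets of the
    product space; second countability writes these as countable unions of rectangles. *)
Lemma prod_open_measurable (R : realType) (X Y : pmetricType R) (W : set (X * Y)) :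
  compact [set: X] -> compact [set: Y] -> open W ->
  measurable (W : set (borel X * borel Y)).
Proof.
move=> cX cY oW.
have [B cB [oB bB]] := compact_second_countable cX.
have [C cC [oC bC]] := compact_second_countable cY.
pose I := [set p : set X * set Y | [/\ B p.1, C p.2 & p.1 `*` p.2 `<=` W]].
have cI : countable I.
  apply: (@sub_countable _ _ _ (B `*` C)).
    by apply: subset_card_le => p [].
  exact: countableX.
have -> : W = \bigcup_(p in I) (p.1 `*` p.2).
  apply/seteqP; split => [[x y] Wxy|z [p [_ _ pW] /pW]] //.
  have [[P Q] /= [Px Qy] PQ] := oW _ Wxy.
  have [U [BU Ux] UP] := bB x _ Px; have [V [CV Vy] VQ] := bC y _ Qy.
  exists (U, V) => //=; split => //= -[a b] [Ua Vb]; apply: PQ; split.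
    exact: UP.
  exact: VQ.
apply: countable_bigcup_measurable => // p [Bp Cp _].
apply: (@measurableX _ _ (borel X) (borel Y)); first exact: (borel_open (oB _ Bp)).
exact: (borel_open (oC _ Cp)).
Qed.

Lemma expect_prod d1 d2 (T1 : measurableType d1) (T2 : measurableType d2) (R : realType)
    (P1 : probability T1 R) (P2 : probability T2 R) (f : T1 * T2 -> R) :
  bmeas f ->
  expect (P1 \x P2)%E f = expect P1 (fun x => expect P2 (fun y => f (x, y))).
Proof.
move=> bf; rewrite /expect /Rintegral.
rewrite -(integral12_prod_meas1 (bmeas_integrable (P1 \x P2)%E bf)).
congr fine; apply: eq_integral => x _; rewrite /fubini_F fineK //.
apply: integrable_fin_num => //.
have : bmeas (fun y => f (x, y)).
  by apply: (bmeas_comp _ bf); exact: measurable_pair1.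
by move/(bmeas_integrable P2).
Qed.

Section circle_measure.
Variable R : realType.

Definition circle_proj (t : R) : torus R 1 := tproj (const_mx t).

Lemma circle_proj_continuous : continuous circle_proj.
Proof.
apply/ball_continuousP => t e e0; exists e => // s.
rewrite -ball_normE /= torus_ballE /=; apply: le_lt_trans.
rewrite (le_trans (tdist_proj_le _ _)) //; apply: rV_norm_le => // i.
by rewrite !mxE.
Qed.

Lemma measurable_circle_proj :
  measurable_fun setT (circle_proj : measurableTypeR R -> borel (torus R 1)).
Proof.
have /continuousP fc := circle_proj_continuous.
apply: (@measurability _ _ _ (borel (torus R 1)) setT _ (@open (torus R 1))) => //.
by move=> _ [B oB <-]; rewrite setTI; apply: open_measurable; exact: fc.
Qed.

Definition circle_haar : probability (borel (torus R 1)) R :=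
  push (uniform_prob (@ltr01 R)) measurable_circle_proj.

(** The constant 1 keeps the integrand nonnegative for the integral against the uniform law; the
    antiderivative of the cosine term takes equal values at 0 and 1. *)
Lemma integral_tc (k : int) (c : R) : k != 0 ->
  (\int[lebesgue_measure]_(t in `[0%R, 1%R]) (1 + tc (k%:~R * t + c))%:E = 1)%E.
Proof.
move=> k0; pose a : R := pi *+ 2 * k%:~R.
have a0 : a != 0 by rewrite mulf_neq0 ?intr_eq0 // mulrn_eq0 negb_or /= gt_eqF ?pi_gt0.
pose F t := t + a^-1 * sin (a * t + pi *+ 2 * c).
have dF (t : R) : is_derive t 1 F (1 + tc (k%:~R * t + c)).
  rewrite /F; apply: is_derive_eq.
  rewrite /tc /GRing.scale /= mulr1 addr0.
  by rewrite (mulrC _ a) mulrA mulVf // mul1r mulrDr mulrA.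
have Fc : continuous F.
  by move=> t; apply: differentiable_continuous; apply/derivable1_diffP; case: (dF t).
have fc : continuous (fun t : R => 1 + tc (k%:~R * t + c)).
  move=> t; apply: cvgD; first exact: cvg_cst.
  apply: continuous_comp; last exact: continuous_tc.
  by apply: cvgD; [exact: mulrl_continuous|exact: cvg_cst].
rewrite (@continuous_FTC2 _ _ F) //.
- rewrite /F -EFinB mulr0 add0r mulr1 add0r; congr EFin.
  have -> : sin (a + pi *+ 2 * c) = sin (pi *+ 2 * c).
    rewrite /a; have := tcDz (c - 4^-1) k; rewrite -tc_quarter => <-.
    by rewrite -mulrDr -tc_quarter; congr tc; ring.
  ring.
- exact/continuous_subspaceT.
- split.
  + by move=> t _; case: (dF t).
  + exact/cvg_at_right_filter/Fc.
  + exact/cvg_at_left_filter/Fc.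
- by move=> t _; rewrite derive1E; apply: derive_val.
Qed.

Lemma circle_haar_char (m : 'rV[int]_1) c : m != 0 -> expect circle_haar (tchar m c) = 0.
Proof.
move=> m0; have k0 : m 0 0 != 0.
  by apply: contra m0 => /eqP h; apply/eqP/rowP => i; rewrite ord1 h mxE.
rewrite expect_push; last exact: (bmeas_continuous (@tchar_continuous _ _ m c) (@tchar_max _ _ m c)).
set g := _ \o _.
have gE t : g t = tc ((m 0 0)%:~R * t + c).
  by rewrite /g /= /circle_proj tchar_proj /dotp big_ord1 mxE.
have bg : bmeas (g : measurableTypeR R -> R).
  apply: (bmeas_comp measurable_circle_proj).
  exact: (bmeas_continuous (@tchar_continuous _ _ m c) (@tchar_max _ _ m c)).
have : expect (uniform_prob (@ltr01 R)) (fun t => 1 + g t) = 1.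
  rewrite /expect /Rintegral integral_uniform; last 2 first.
  - by apply/measurable_EFinP; have [] := bmeasD (bmeas_cst _ 1) bg.
  - by move=> t; rewrite lee_fin; have := tc_max ((m 0 0)%:~R * t + c); rewrite gE ler_norml; lra.
  rewrite subr0 invr1 mul1e.
  under eq_integral do rewrite gE.
  by rewrite integral_tc.
rewrite expectD //; last exact: bmeas_cst.
rewrite expect_cst; lra.
Qed.

End circle_measure.

Section haar_measure.
Variable R : realType.

Definition tcons d (x : torus R 1 * torus R d) : torus R d.+1 :=
  tproj (row_mx (tval x.1) (tval x.2) : 'rV_(1 + d)).

Lemma tcons_val d (x : torus R 1 * torus R d) : tval (tcons x) = row_mx (tval x.1) (tval x.2).
Proof.
apply/rowP => i; rewrite /tcons /= [LHS]mxE frac_id //.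
rewrite -(@splitK 1 d i); case: (@fintype.split 1 d i) => j /=.
  by rewrite (@row_mxEl R 1 1 d); have /forallP := tval_in x.1; apply.
by rewrite row_mxEr; have /forallP := tval_in x.2; apply.
Qed.

Lemma tcons_continuous d : continuous (@tcons d).
Proof.
apply/ball_continuousP => -[x y] e e0; exists e => // -[x' y'] [/=].
rewrite !torus_ballE /= => xx yy; apply: rV_norm_lt => // i.
rewrite !tcons_val /= !mxE ger0_norm ?dZ_ge0 //.
case: (@fintype.split 1 d i) => j.
  exact: le_lt_trans (tdist_entry _ _ _) xx.
exact: le_lt_trans (tdist_entry _ _ _) yy.
Qed.

Lemma measurable_tcons d :
  measurable_fun setT (@tcons d : borel (torus R 1) * borel (torus R d) -> borel (torus R d.+1)).
Proof.
have /continuousP fc := @tcons_continuous d.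
apply: (@measurability _ _ _ (borel (torus R d.+1)) setT _ (@open (torus R d.+1))) => //.
move=> _ [B oB <-]; rewrite setTI.
apply: prod_open_measurable; [exact: torus_compact|exact: torus_compact|exact: fc].
Qed.

(** Built one circle at a time with the new coordinate in front, so that integrating out coordinate
    0, the top fibre of the tower, is Fubini's theorem. *)
Fixpoint haar (d : nat) : probability (borel (torus R d)) R :=
  if d is d'.+1 then push (circle_haar R \x haar d')%E (@measurable_tcons d')
  else @dirac _ (borel (torus R 0)) point R.

Lemma bmeas_tchar d m c : bmeas (tchar m c : borel (torus R d) -> R).
Proof. exact: (bmeas_continuous (@tchar_continuous _ _ m c) (@tchar_max _ _ m c)). Qed.

Lemma haar_char d (m : 'rV[int]_d) c : m != 0 -> expect (haar d) (tchar m c) = 0.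
Proof.
elim: d m c => [|d IH] m c m0.
  by move: m0; rewrite (_ : m = 0) ?eqxx //; apply/rowP => -[].
rewrite /= expect_push; last exact: bmeas_tchar.
rewrite expect_prod; last exact/(bmeas_comp (@measurable_tcons d))/bmeas_tchar.
pose m1 : 'rV[int]_1 := lsubmx (m : 'rV_(1 + d)).
pose m2 : 'rV[int]_d := rsubmx (m : 'rV_(1 + d)).
have E x y : tchar m c (tcons (x, y)) = tchar m2 (dotp m1 (tval x) + c) y.
  rewrite /tchar tcons_val /=; congr tc; rewrite addrA addrC [RHS]addrC; congr (_ + _).
  rewrite /dotp (@big_split_ord _ _ _ 1 d) /= addrC; congr (_ + _); apply: eq_bigr => i _.
    by rewrite (@row_mxEr R 1 1 d) !mxE.
  by rewrite (@row_mxEl R 1 1 d) !mxE.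
have [m20|m20] := eqVneq m2 0; last first.
  rewrite -[RHS](expect_cst (circle_haar R)); congr expect; apply/funext => x.
  under eq_fun do rewrite /= E.
  exact: IH.
have m10 : m1 != 0.
  apply: contra m0 => /eqP m10; apply/eqP.
  by rewrite -[m](@hsubmxK _ 1 1 d) -/m1 -/m2 m10 m20 row_mx0.
rewrite -[RHS](circle_haar_char c m10); congr expect; apply/funext => x.
rewrite -[RHS](expect_cst (haar d)); congr expect; apply/funext => y.
by rewrite /= E m20 /tchar dotp0l add0r.
Qed.

Section uniqueness.
Variable d : nat.
Implicit Types (P : probability (borel (torus R d)) R).

Lemma haar_unique P :
  (forall (m : 'rV[int]_d) c, m != 0 -> expect P (tchar m c) = 0) ->
  forall A, borel_set A -> P A = haar d A.
Proof.
move=> hP; apply: prob_eq_continuous => f fc f01.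
have bt g : trig g -> bmeas (g : borel (torus R d) -> R).
  elim=> [m c|g1 g2 _ h1 _ h2|a {}g _ h].
  - exact: bmeas_tchar.
  - exact: bmeasD.
  - exact: bmeasZ.
have T g : trig g -> expect P g = expect (haar d) g.
  elim=> [m c|g1 g2 t1 h1 t2 h2|a {}g t h].
  - have [->|m0] := eqVneq m 0; last by rewrite hP // haar_char.
    by rewrite /tchar; under eq_fun do rewrite dotp0l add0r; rewrite !expect_cst.
  - by rewrite !expectD ?h1 ?h2 //; exact: bt.
  - by rewrite !expectZ ?h //; exact: bt.
have bf : bmeas (f : borel (torus R d) -> R).
  by apply: (bmeas_continuous fc (M := 1)); exact: min1_norm.
apply/eqP; rewrite -subr_eq0 -normr_le0; apply/ler_addgt0Pl => e e0; rewrite addr0.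
have e2 : 0 < e / 2 by rewrite divr_gt0.
have [g tg hg] := trig_dense fc e2.
have H (Q : probability (borel (torus R d)) R) : `|expect Q f - expect Q g| <= e / 2.
  rewrite -expectB //; last exact: bt.
  apply: expect_norm => //; under eq_fun do rewrite -mulN1r.
  by apply: bmeasD => //; apply: bmeasZ; exact: bt.
have -> : expect P f - expect (haar d) f =
    (expect P f - expect P g) - (expect (haar d) f - expect (haar d) g).
  by rewrite (T g tg); ring.
by rewrite (splitr e) (le_trans (ler_normB _ _)) // lerD.
Qed.

(** Uniqueness applied to the image measure reduces invariance to a computation with characters;
    translations, affine maps, shears and the limit homeomorphism are all treated this way. *)
Lemma haar_preserved (f : torus R d -> torus R d) :
  measurable_fun setT (f : borel (torus R d) -> borel (torus R d)) ->
  (forall (m : 'rV[int]_d) c, m != 0 -> expect (haar d) (tchar m c \o f) = 0) ->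
  forall A, borel_set A -> haar d (f @^-1` A) = haar d A.
Proof.
move=> mf h A mA; rewrite -[RHS](haar_unique (P := push (haar d) mf)) //.
by move=> m c m0; rewrite expect_push ?h //; exact: bmeas_tchar.
Qed.

Lemma expect_haar_preserved (f : torus R d -> torus R d)
    (mf : measurable_fun setT (f : borel (torus R d) -> borel (torus R d))) g :
  (forall A, borel_set A -> haar d (f @^-1` A) = haar d A) ->
  bmeas (g : borel (torus R d) -> R) ->
  expect (haar d) (g \o f) = expect (haar d) g.
Proof.
move=> fh bg; rewrite -(expect_push (haar d) mf bg); congr fine.
by apply: eq_measure_integral => A mA _; exact: fh.
Qed.

End uniqueness.

End haar_measure.

(** * Polynomial phases along nilpotent orbits *)

Section van_der_corput.
Variable R : realType.

Lemma cauchy_schwarz_sum (N : nat) (a : nat -> R) :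
  (\sum_(n < N) a n) ^+ 2 <= N%:R * \sum_(n < N) a n ^+ 2.
Proof.
elim: N => [|N IH]; first by rewrite !big_ord0 expr0n mul0r.
rewrite !big_ord_recr /=; set S := \sum_(n < N) _ in IH *; set Q := \sum_(n < N) _ in IH *.
have : 0 <= \sum_(n < N) (a n - a N) ^+ 2 by apply: sumr_ge0 => n _; rewrite sqr_ge0.
have -> : \sum_(n < N) (a n - a N) ^+ 2 = Q - 2 * a N * S + N%:R * a N ^+ 2.
  have -> : N%:R * a N ^+ 2 = \sum_(n < N) a N ^+ 2 by rewrite sumr_const card_ord mulr_natl.
  rewrite /Q /S mulr_sumr -sumrB -big_split /=.
  by apply: eq_bigr => n _; ring.
by rewrite -natr1 => h; nra.
Qed.

Lemma sum_shift_bound (v : nat -> R) (M : R) (N s : nat) : (forall n, `|v n| <= M) ->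
  `|\sum_(n < N) v (n + s)%N - \sum_(n < N) v n| <= 2 * s%:R * M.
Proof.
move=> hM; elim: s => [|s IH].
  by under eq_bigr do rewrite addn0; rewrite subrr normr0 mulr0 mul0r.
have E : \sum_(n < N) v (n + s.+1)%N = \sum_(n < N) v (n + s)%N + (v (N + s)%N - v s).
  have := telescope_sumr (fun n => v (n + s)%N) (leq0n N).
  rewrite big_mkord add0n sumrB => <-.
  by rewrite addrC subrK; apply: eq_bigr => n _; rewrite addnS addSn.
rewrite E addrAC (le_trans (ler_normD _ _)) //.
rewrite -[s.+1%:R]natr1 mulrDr mulr1 mulrDl lerD // (le_trans (ler_normB _ _)) //.
by have := hM (N + s)%N; have := hM s; lra.
Qed.

(** Each sum is compared with sums over windows of length [H], up to a boundary error, and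
    Cauchy-Schwarz squares the windows: the diagonal contributes M^2 / H, the rest correlations. A
    family is needed because the correlations become small only after summation over it, that is,
    over translates and phases. *)
Lemma van_der_corput (I : Type) (r : seq I) (v : I -> nat -> R) (M e : R) (H N : nat) :
  (0 < H)%N -> 0 <= e -> (forall i n, `|v i n| <= M) ->
  (forall s h, (s < H)%N -> (0 < h < H)%N ->
     \sum_(i <- r) \sum_(n < N) v i (n + s + h)%N * v i (n + s)%N <= e * N%:R * (size r)%:R) ->
  \sum_(i <- r) (\sum_(n < N) v i n) ^+ 2 <=
    (size r)%:R * (2 * N%:R ^+ 2 * (M ^+ 2 / H%:R + e) + 8 * H%:R ^+ 2 * M ^+ 2).
Proof.
move=> H0 e0 hM hc; have M0 (i : I) : 0 <= M by exact: le_trans (hM i 0%N).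
have Hp : 0 < H%:R :> R by rewrite ltr0n.
pose V i n := \sum_(s < H) v i (n + s)%N.
have E1 i : `|H%:R * (\sum_(n < N) v i n) - \sum_(n < N) V i n| <= 2 * H%:R ^+ 2 * M.
  rewrite exchange_big /= mulr_natl -{1}(card_ord H) -sumr_const -sumrB.
  rewrite (le_trans (ler_norm_sum _ _ _)) //.
  apply: (@le_trans _ _ (\sum_(s < H) 2 * H%:R * M)).
    apply: ler_sum => s _; rewrite distrC (le_trans (sum_shift_bound _ _ (hM i))) //.
    by rewrite ler_wpM2r ?(M0 i) // ler_wpM2l // ler_nat ltnW.
  by rewrite sumr_const card_ord -mulr_natl le_eqVlt; apply/orP; left; apply/eqP; ring.
have E2 i : (H%:R * (\sum_(n < N) v i n)) ^+ 2 <=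
    2 * N%:R * (\sum_(n < N) V i n ^+ 2) + 8 * H%:R ^+ 4 * M ^+ 2.
  have := E1 i; have := cauchy_schwarz_sum N (V i).
  set A := \sum_(n < N) V i n; set B := _ * \sum_(n < N) v i n; set Q := \sum_(n < N) V i n ^+ 2.
  move=> h1 h2.
  have h3 : (B - A) ^+ 2 <= (2 * H%:R ^+ 2 * M) ^+ 2.
    by rewrite -real_normK ?num_real // ler_sqr ?nnegrE // ?mulr_ge0 ?(M0 i).
  have h4 : 0 <= (B - 2 * A) ^+ 2 by rewrite sqr_ge0.
  have -> : 8 * H%:R ^+ 4 * M ^+ 2 = 2 * (2 * H%:R ^+ 2 * M) ^+ 2 :> R by ring.
  clear -h1 h3 h4; nra.
have E3 : \sum_(i <- r) \sum_(n < N) V i n ^+ 2 <=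
    (H%:R * M ^+ 2 + H%:R ^+ 2 * e) * N%:R * (size r)%:R.
  have -> : \sum_(i <- r) \sum_(n < N) V i n ^+ 2 =
     \sum_(s < H) \sum_(t < H) \sum_(i <- r) \sum_(n < N) v i (n + s)%N * v i (n + t)%N.
    under eq_bigr => i _.
      under eq_bigr do rewrite expr2 big_distrlr /=.
      rewrite exchange_big /=; under eq_bigr do rewrite exchange_big /=.
      over.
    rewrite exchange_big /=; apply: eq_bigr => s _.
    by rewrite exchange_big /=.
  have D s t : (s < H)%N -> (t < H)%N ->
     \sum_(i <- r) \sum_(n < N) v i (n + s)%N * v i (n + t)%N <=
     (if s == t then M ^+ 2 else 0) * N%:R * (size r)%:R + e * N%:R * (size r)%:R.
    move=> sH tH; have e1 : 0 <= e * N%:R * (size r)%:R by rewrite !mulr_ge0.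
    case: (ltngtP s t) => st.
    - rewrite !mul0r add0r; have := hc s (t - s)%N sH; rewrite subn_gt0 st.
      rewrite (leq_ltn_trans (leq_subr _ _) tH) => /(_ isT); apply: le_trans.
      rewrite le_eqVlt; apply/orP; left; apply/eqP; apply: eq_bigr => i _; apply: eq_bigr => n _.
      by rewrite -addnA subnKC 1?mulrC // ltnW.
    - rewrite !mul0r add0r; have := hc t (s - t)%N tH; rewrite subn_gt0 st.
      rewrite (leq_ltn_trans (leq_subr _ _) sH) => /(_ isT); apply: le_trans.
      rewrite le_eqVlt; apply/orP; left; apply/eqP; apply: eq_bigr => i _; apply: eq_bigr => n _.
      by rewrite -addnA subnKC // ltnW.
    - rewrite st; apply: (@le_trans _ _ (M ^+ 2 * N%:R * (size r)%:R)); last by rewrite lerDl.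
      rewrite [X in _ <= X]mulr_natr -sum1_size -sumrMnr.
      apply: ler_sum => i _; rewrite mulr1n.
      have -> : M ^+ 2 * N%:R = \sum_(n < N) M ^+ 2 by rewrite sumr_const card_ord mulr_natr.
      by apply: ler_sum => n _; rewrite -expr2 -real_normK ?num_real // ler_sqr ?nnegrE // (M0 i).
  apply: (@le_trans _ _ (\sum_(s < H) (M ^+ 2 * N%:R * (size r)%:R + H%:R * (e * N%:R * (size r)%:R)))).
    apply: ler_sum => s _.
    apply: (@le_trans _ _ (\sum_(t < H) ((if s == t :> nat then M ^+ 2 else 0) * N%:R * (size r)%:R + e * N%:R * (size r)%:R))).
      by apply: ler_sum => t _; exact: D.
    rewrite big_split /= sumr_const card_ord -[X in _ + X <= _]mulr_natl lerD2r.
    rewrite -mulr_suml -mulr_suml (bigD1 s) //= eqxx big1 ?addr0 // => t ts.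
    by rewrite ifF //; apply/negbTE; rewrite eq_sym.
  rewrite sumr_const card_ord -[X in X <= _]mulr_natl le_eqVlt; apply/orP; left; apply/eqP; ring.
have H2 : 0 < H%:R ^+ 2 :> R by rewrite exprn_gt0.
rewrite -(ler_pM2l H2).
apply: (@le_trans _ _ (\sum_(i <- r) (2 * N%:R * (\sum_(n < N) V i n ^+ 2) + 8 * H%:R ^+ 4 * M ^+ 2))).
  by rewrite mulr_sumr; apply: ler_sum => i _; rewrite -exprMn.
rewrite big_split /= -mulr_sumr.
have -> : \sum_(i <- r) (8 * H%:R ^+ 4 * M ^+ 2) = (size r)%:R * (8 * H%:R ^+ 4 * M ^+ 2) :> R.
  by rewrite -sum1_size natr_sum mulr_suml; apply: eq_bigr => i _; rewrite mul1r.
have : 2 * N%:R * (\sum_(i <- r) \sum_(n < N) V i n ^+ 2) <=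
  2 * N%:R * ((H%:R * M ^+ 2 + H%:R ^+ 2 * e) * N%:R * (size r)%:R) by rewrite ler_wpM2l // mulr_ge0.
move=> h; rewrite -lerBrDr (le_trans h) // le_eqVlt; apply/orP; left; apply/eqP.
by field; rewrite gt_eqF.
Qed.

End van_der_corput.

Section phases.
Variable R : realType.
Implicit Types (u : nat -> R) (c : R).

Definition irr c := forall h : nat, (0 < h)%N -> h%:R * c \isn't a Num.int.

Definition dif u : nat -> R := fun n => u n.+1 - u n.

(** A polynomial sequence of degree at most [d], encoded by its constant [d]-th difference, which is
    d! times the coefficient of degree [d]. Lower coefficients stay free, so bounds quantified over
    [u] are uniform in them. *)
Definition phase (d : nat) c u := forall n, iter d dif u n = c.

Lemma irrM c h : irr c -> (0 < h)%N -> irr (h%:R * c).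
Proof. by move=> ic h0 k k0; rewrite mulrA -natrM; apply: ic; rewrite muln_gt0 k0. Qed.

Lemma iter_dif_shift d u s n : iter d dif (fun n => u (n + s)%N) n = iter d dif u (n + s)%N.
Proof. by elim: d n => // d IH n; rewrite !iterS /dif !IH. Qed.

Lemma phase_shift d c u s : phase d c u -> phase d c (fun n => u (n + s)%N).
Proof. by move=> hu n; rewrite iter_dif_shift. Qed.

Lemma iter_difB d u w n : iter d dif (fun n => u n - w n) n = iter d dif u n - iter d dif w n.
Proof. by elim: d n => // d IH n; rewrite !iterS /dif !IH; ring. Qed.

Lemma phase_dif d c u h : phase d.+1 c u -> phase d (h%:R * c) (fun n => u (n + h)%N - u n).
Proof.
move=> hu n; rewrite iter_difB iter_dif_shift.
elim: h => [|h IH]; first by rewrite addn0 subrr mul0r.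
have := hu (n + h)%N; rewrite iterS {1}/dif addnS => E.
rewrite -natr1 mulrDl mul1r -IH; move: E; lra.
Qed.

Lemma phase_dif_shift d c u s h :
  phase d.+1 c u -> phase d (h%:R * c) (fun n => u (n + s + h)%N - u (n + s)%N).
Proof.
move=> /(@phase_dif _ _ _ h)/(@phase_shift _ _ _ s) hu n; rewrite -(hu n).
by congr (iter d dif _ n).
Qed.

Lemma phase1 c u : phase 1 c u -> forall n, u n = n%:R * c + u 0%N.
Proof.
move=> hu; elim=> [|n IH]; first by rewrite mul0r add0r.
by have := hu n; rewrite /= /dif -natr1 IH => h; lra.
Qed.

Lemma tc_phase1 c : irr c -> exists2 C, 0 <= C &
  forall u, phase 1 c u -> forall N, `|\sum_(n < N) tc (u n)| <= C.
Proof.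
move=> ic; exists `|sin (pi * c)|^-1; first by rewrite invr_ge0.
move=> u hu N; under eq_bigr do rewrite (phase1 hu).
by apply: tc_progression; have := ic 1%N isT; rewrite mul1r.
Qed.

End phases.

(** The limit is the supremum of the lower bounds f_n - D_n, all of which lie below every f_m +
    D_m. *)
Lemma uniform_sup_limit (R : realType) (T : Type) (f : nat -> T -> R) (D : nat -> R) :
  (forall n m, (n <= m)%N -> forall a, `|f m a - f n a| <= D n) ->
  exists F : T -> R, forall n a, `|F a - f n a| <= D n.
Proof.
move=> h; pose S a := [set f n a - D n | n in [set: nat]].
have ub a m : ubound (S a) (f m a + D m).
  move=> _ [n _ <-]; have := h n (maxn n m) (leq_maxl _ _) a.
  have := h m (maxn n m) (leq_maxr _ _) a.
  by rewrite !ler_norml => /andP[h1 h2] /andP[h3 h4]; lra.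
have hs a : has_sup (S a) by split; [exists (f 0%N a - D 0%N), 0%N|exists (f 0%N a + D 0%N); exact: ub].
exists (fun a => sup (S a)) => n a; rewrite ler_norml; apply/andP; split.
  have : f n a - D n <= sup (S a) by apply: sup_ubound; [case: (hs a)|exists n].
  lra.
have : sup (S a) <= f n a + D n by apply: ge_sup; [case: (hs a)|exact: ub].
lra.
Qed.

Section group_facts.
Variable G : groupType.
Implicit Types x y z : G.

(* [mulgA] and its kin, used at a [groupTopologicalType], leave coercions that block rewriting. *)
Lemma gA x y z : (x * (y * z) = x * y * z)%g. Proof. exact: mulgA. Qed.
Lemma g1l x : (1 * x = x)%g. Proof. exact: mul1g. Qed.
Lemma g1r x : (x * 1 = x)%g. Proof. exact: mulg1. Qed.
Lemma gV x : (x * x^-1 = 1)%g. Proof. exact: mulgV. Qed.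
Lemma gVK x y : (x * y^-1 * y = x)%g. Proof. exact: mulgVK. Qed.
Lemma gVKl x y : (x * (x^-1 * y) = y)%g. Proof. exact: mulVKg. Qed.
Lemma gKl x y : (x^-1 * (x * y) = y)%g. Proof. exact: mulKg. Qed.

End group_facts.

(** Arithmetic of the van der Corput step: the two terms bounded by e^2 / (64 q) use up e^2 / 8, and
    [N] is large enough for the boundary term to stay below the other e^2 / 8. The right-hand side
    is the lower bound that a large orbit sum would force. *)
Lemma vdc_bound (R : realType) (e q N x H M : R) : 0 < e -> 1 <= q -> 0 <= M ->
  x <= e ^+ 2 / (64 * q) -> 0 <= H -> 0 <= N -> H * M * 32 * q < e * N ->
  2 * q * (2 * N ^+ 2 * (x + e ^+ 2 / (64 * q)) + 8 * H ^+ 2 * M ^+ 2) < e ^+ 2 / 4 * N ^+ 2.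
Proof.
move=> e0 q1 M0 hx H0 N0 h1; have q0 : 0 < q by lra.
have E1 : 2 * q * (2 * N ^+ 2 * (x + e ^+ 2 / (64 * q))) <= e ^+ 2 / 8 * N ^+ 2.
  have -> : e ^+ 2 / 8 * N ^+ 2 = 2 * q * (2 * N ^+ 2 * (e ^+ 2 / (64 * q) + e ^+ 2 / (64 * q))).
    by field; rewrite gt_eqF.
  by rewrite ler_wpM2l ?mulr_ge0 ?(ltW q0) // ler_wpM2l ?mulr_ge0 ?exprn_ge0 // lerD2r.
have h0 : 0 <= H * M * 32 * q by rewrite !mulr_ge0 // ltW.
have h2 : (H * M * 32 * q) ^+ 2 < (e * N) ^+ 2.
  by rewrite ltr_sqr ?nnegrE // mulr_ge0 // ltW.
have h3 : (H * M * 32 * q) ^+ 2 = 32 * (32 * ((H * M) ^+ 2 * (q * q))) by ring.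
have h4 : (H * M) ^+ 2 * q <= (H * M) ^+ 2 * (q * q).
  apply: ler_wpM2l; first exact: sqr_ge0.
  by rewrite ler_peMr // ltW.
have E2 : 2 * q * (8 * H ^+ 2 * M ^+ 2) = (H * M) ^+ 2 * 16 * q by ring.
have E3 : e ^+ 2 / 8 * N ^+ 2 = (e * N) ^+ 2 / 8 by field.
have E4 : e ^+ 2 / 4 * N ^+ 2 = e ^+ 2 / 8 * N ^+ 2 + (e * N) ^+ 2 / 8 by field.
have h5 : 0 <= (H * M) ^+ 2 * q by rewrite mulr_ge0 ?sqr_ge0 // ltW.
rewrite mulrDr E2 E4; move: h2 h4 E1; rewrite h3 => h2 h4 E1.
by apply: ler_ltD => //; lra.
Qed.

Section lower_central_series.
Variable G : groupType.
Local Open Scope group_scope.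

Lemma lower_central_normal i :
  subgroup (lower_central (G:=G) i) /\
  forall x y, lower_central (G:=G) i x -> lower_central (G:=G) i (x ^ y)%g.
Proof.
elim: i => [|i [IHs IHn]]; first by split.
have sg : subgroup (lower_central (G:=G) i.+1).
  split=> [H [[H1 _ _] _]|x y hx hy H HH|x hx H HH] //.
    by have [[_ HM _] _] := HH; apply: HM; [exact: hx|exact: hy].
  by have [[_ _ HV] _] := HH; apply: HV; exact: hx.
split=> // x y hx.
have [sg1 sgM sgV] := sg.
suff : [set z | lower_central (G:=G) i.+1 (z ^ y)%g] x by [].
apply: hx; split; last first.
  move=> _ [a [b [ha ->]]] /=; rewrite conjRg => H [_ HH]; apply: HH.
  by exists (a ^ y)%g, (b ^ y)%g; split => //; exact: IHn.
split=> /= [|a b|a]; first by rewrite conj1g.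
  by rewrite conjMg; exact: sgM.
by rewrite conjVg; exact: sgV.
Qed.

Lemma lower_central_comm i x z : lower_central (G:=G) i z ->
  exists2 c, lower_central (G:=G) i.+1 c & (x * z = c * (z * x))%g.
Proof.
move=> hz; exists [~ x^-1, z^-1]%g; last exact: commgCV.
have [[_ sgM sgV] _] := lower_central_normal i.+1.
rewrite -invgR; apply: sgV => H [_ HH]; apply: HH; exists z^-1%g, x^-1%g; split => //.
by have [[_ _ h] _] := lower_central_normal i; exact: h.
Qed.

End lower_central_series.

(** * Orbit sums against polynomial phases in an abstract group *)

Section nilpotent_equidistribution.
Variables (R : realType) (G : groupType) (Gamma : set G) (nb : set_system G) (g : G).
Hypothesis nbF : Filter nb.
Hypothesis nbJ : forall (x : G) U, nb U -> nb [set u | U (x * u * x^-1)%g].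
Hypothesis cocompact : forall U : set G, nb U -> exists s : seq G,
  forall a, exists b, b \in s /\ exists u c, [/\ U u, Gamma c & a = (u * b * c)%g].
Implicit Types f F : G -> R.

Local Notation L := (@lower_central G).

(** Lifts to G of continuous functions on G/Gamma, described without a topology on G: [nb] stands
    for the neighbourhoods of 1. *)
Definition admissible f := [/\ exists M, forall a, `|f a| <= M,
  forall a c, Gamma c -> f (a * c)%g = f a &
  forall e, 0 < e -> nb [set u | forall a, `|f (u * a)%g - f a| <= e]].

Definition linv i f := forall z a, L i z -> f (z * a)%g = f a.

(** Moving [z] past [x] costs a commutator in [L i.+1], under which [f] is invariant: for such
    functions the elements of [L i] act as if they were central. *)
Lemma linv_comm i f x z a : linv i.+1 f -> L i z -> f (x * (z * a))%g = f (z * (x * a))%g.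
Proof.
move=> hf hz; have [c hc E] := lower_central_comm x hz.
by rewrite gA E -gA hf // gA.
Qed.

Lemma L1 i : L i 1%g. Proof. by have [[]] := lower_central_normal G i. Qed.

Lemma LM i x y : L i x -> L i y -> L i (x * y)%g.
Proof. by have [[_ h _] _] := lower_central_normal G i; exact: h. Qed.

Lemma LV i x : L i x -> L i (x^-1)%g.
Proof. by have [[_ _ h] _] := lower_central_normal G i; exact: h. Qed.

Lemma LJ i x y : L i x -> L i (x ^ y)%g.
Proof. by have [_ h] := lower_central_normal G i; exact: h. Qed.

Lemma linv_trans i f x : linv i f -> linv i (fun a => f (x * a)%g).
Proof.
move=> hf z a hz; rewrite gA (conjgCV x z) -gA hf //; exact: LJ.
Qed.

Lemma adm_trans f x : admissible f -> admissible (fun a => f (x * a)%g).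
Proof.
move=> [[M hM] hG hU]; split; first by exists M.
  by move=> a c hc; rewrite gA hG.
move=> e e0; have := nbJ x (hU e e0); apply: filterS => u /= hu a.
by have := hu (x * a)%g; rewrite !gA gVK.
Qed.

Lemma adm_cst c : admissible (fun=> c).
Proof.
split=> //; first by exists `|c|.
by move=> e e0; apply: filterS (@filterT _ nb _) => u _ a; rewrite subrr normr0 ltW.
Qed.

Lemma admD f F : admissible f -> admissible F -> admissible (fun a => f a + F a).
Proof.
move=> [[M hM] hG hU] [[M' hM'] hG' hU']; split.
- by exists (M + M') => a; rewrite (le_trans (ler_normD _ _)) // lerD.
- by move=> a c hc; rewrite hG // hG'.
move=> e e0; have e2 : 0 < e / 2 by rewrite divr_gt0.
apply: filterS2 (hU _ e2) (hU' _ e2) => u h1 h2 a.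
by rewrite opprD addrACA (splitr e) (le_trans (ler_normD _ _)) // lerD.
Qed.

Lemma admM f F : admissible f -> admissible F -> admissible (fun a => f a * F a).
Proof.
move=> [[M hM] hG hU] [[M' hM'] hG' hU']; split.
- by exists (M * M') => a; rewrite normrM ler_pM.
- by move=> a c hc; rewrite hG // hG'.
move=> e e0.
have M0 : 0 <= M by exact: le_trans (hM (1%g : G)).
have M0' : 0 <= M' by exact: le_trans (hM' (1%g : G)).
have K0 : 0 < 1 + M + M' by lra.
have e2 : 0 < e / (1 + M + M') by rewrite divr_gt0.
apply: filterS2 (hU _ e2) (hU' _ e2) => u h1 h2 a.
have -> : f (u * a)%g * F (u * a)%g - f a * F a =
  (f (u * a)%g - f a) * F (u * a)%g + f a * (F (u * a)%g - F a) by ring.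
rewrite (le_trans (ler_normD _ _)) // !normrM.
apply: (@le_trans _ _ (e / (1 + M + M') * M' + M * (e / (1 + M + M')))).
  by rewrite lerD // ler_pM.
rewrite mulrC -mulrDl mulrA ler_pdivrMr // mulrC ler_wpM2l ?ltW //; lra.
Qed.

Lemma adm_lim F : (forall e, 0 < e -> exists2 f, admissible f & forall a, `|F a - f a| <= e) ->
  admissible F.
Proof.
move=> h; split.
- have [f [[M hM] _ _] hf] := h 1 ltr01; exists (1 + M) => a.
  by rewrite -(subrK (f a) (F a)) (le_trans (ler_normD _ _)) // lerD.
- move=> a c hc; apply/eqP; rewrite -subr_eq0 -normr_le0; apply/ler_addgt0Pl => e e0.
  have e2 : 0 < e / 2 by rewrite divr_gt0.
  have [f [_ hG _] hf] := h _ e2; rewrite addr0.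
  have := hf (a * c)%g; have := hf a; rewrite hG // !ler_norml.
  by move=> /andP[h1 h2] /andP[h3 h4]; apply/andP; split; lra.
- move=> e e0; have e3 : 0 < e / 3 by rewrite divr_gt0.
  have [f [_ _ hU] hf] := h _ e3; apply: filterS (hU _ e3) => u /= hu a.
  have := hf (u * a)%g; have := hf a; have := hu a; rewrite !ler_norml.
  by move=> /andP[h1 h2] /andP[h3 h4] /andP[h5 h6]; apply/andP; split; lra.
Qed.

Definition avg (zs : seq G) f : G -> R :=
  fun a => (size zs)%:R^-1 * \sum_(z <- zs) f (z * a)%g.

Lemma adm_avg zs f : admissible f -> admissible (avg zs f).
Proof.
move=> af; apply: admM; first exact: adm_cst.
elim: zs => [|z zs IH].
  by under eq_fun do rewrite big_nil; exact: adm_cst.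
by under eq_fun do rewrite big_cons; apply: admD => //; exact: adm_trans.
Qed.

Lemma linv_avg i zs f : linv i f -> linv i (avg zs f).
Proof.
move=> hf z a hz; congr (_ * _); apply: eq_bigr => w _.
exact: (linv_trans w hf).
Qed.

Definition Lseq i (zs : seq G) := (0 < size zs)%N /\ forall z, z \in zs -> L i z.

Lemma sum_seq_cst (zs : seq G) (x : R) : \sum_(z <- zs) x = (size zs)%:R * x.
Proof. by rewrite big_const_seq count_predT iter_addr_0 mulr_natl. Qed.

Lemma sum_allpairs (h : G -> G -> G) (F : G -> R) zs ws :
  \sum_(i <- [seq h z w | z <- zs, w <- ws]) F i = \sum_(z <- zs) \sum_(w <- ws) F (h z w).
Proof.
by elim: zs => [|z zs IH]; rewrite ?big_nil //= big_cat /= big_map IH big_cons.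
Qed.

Lemma avg_comp zs ws f a : avg zs (avg ws f) a = avg [seq (w * z)%g | z <- zs, w <- ws] f a.
Proof.
rewrite /avg size_allpairs natrM invfM -mulrA; congr (_ * _).
rewrite sum_allpairs mulr_sumr; apply: eq_bigr => z _; congr (_ * _).
by apply: eq_bigr => w _; rewrite gA.
Qed.

Lemma Lseq_comp i zs ws : Lseq i zs -> Lseq i ws -> Lseq i [seq (w * z)%g | z <- zs, w <- ws].
Proof.
move=> [z0 hz] [w0 hw]; split; first by rewrite size_allpairs muln_gt0 z0.
by move=> _ /allpairsP[[z w] /= [/hz ? /hw ? ->]]; exact: LM.
Qed.

Lemma avg_normB zs f F e : (0 < size zs)%N -> (forall a, `|f a - F a| <= e) ->
  forall a, `|avg zs f a - avg zs F a| <= e.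
Proof.
move=> z0 h a; rewrite /avg -mulrBr -sumrB normrM normfV normr_nat.
rewrite mulrC ler_pdivrMr ?ltr0n // (le_trans (ler_norm_sum _ _ _)) //.
apply: (@le_trans _ _ (\sum_(z <- zs) e)); first by apply: ler_sum => z _; exact: h.
by rewrite big_const_seq count_predT iter_addr_0 mulr_natr.
Qed.

Lemma avg_linv i zs f : Lseq i zs -> linv i f -> forall a, avg zs f a = f a.
Proof.
move=> [z0 hz] hf a; rewrite /avg (eq_big_seq (fun=> f a)); last by move=> z /hz; exact: hf.
by rewrite big_const_seq count_predT iter_addr_0 -[f a *+ _]mulr_natl mulKf // pnatr_eq0 -lt0n.
Qed.

Lemma avg_avgC i zs ws f a : Lseq i zs -> Lseq i ws -> linv i.+1 f ->
  avg zs (avg ws f) a = avg ws (avg zs f) a.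
Proof.
move=> [_ hz] [_ hw] hf; rewrite !avg_comp /avg !size_allpairs mulnC; congr (_ * _).
rewrite !sum_allpairs exchange_big /=.
apply: eq_big_seq => w ws_w; apply: eq_big_seq => z zs_z.
rewrite -!gA; apply: (linv_comm w a hf); exact: hz.
Qed.

(** Split [S] by the integer parts of f (z b) / e over the finitely many [b]: boundedness leaves
    finitely many cells, and one representative of each nonempty cell suffices. *)
Lemma finite_representatives f M (e : R) (s : seq G) (S : set G) : 0 < e -> (forall a, `|f a| <= M) ->
  exists zs : seq G, (forall z, z \in zs -> S z) /\
    forall z, S z -> exists2 w, w \in zs & forall b, b \in s -> `|f (z * b)%g - f (w * b)%g| <= e.
Proof.
move=> e0 hM; elim: s S => [|b s IH] S.
  have [[z Sz]|nS] := pselect (S !=set0).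
    by exists [:: z]; split=> [w|w _]; [rewrite inE => /eqP ->|exists z; rewrite ?inE].
  by exists [::]; split=> // z Sz; case: nS; exists z.
pose fl z := Num.floor (f (z * b)%g / e).
pose K := (`|Num.floor (M / e)| + `|Num.floor (- M / e)|)%N.
have flK z : (`|fl z| <= K)%N.
  have h1 : (fl z <= Num.floor (M / e))%R.
    by apply: le_floor; rewrite ler_pM2r ?invr_gt0 //; have := hM (z * b)%g; rewrite ler_norml => /andP[].
  have h2 : (Num.floor (- M / e) <= fl z)%R.
    by apply: le_floor; rewrite ler_pM2r ?invr_gt0 //; have := hM (z * b)%g; rewrite ler_norml => /andP[].
  by rewrite /K; lia.
have H (n : nat) : exists zs : seq G, (forall z, z \in zs -> S z) /\
    forall z, S z -> (`|fl z| < n)%N -> exists2 w, w \in zs & forall x, x \in b :: s ->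
      `|f (z * x)%g - f (w * x)%g| <= e.
  elim: n => [|n [zs [zsS hzs]]]; first by exists [::].
  have key (k : int) : exists ws : seq G, (forall z, z \in ws -> S z) /\
      forall z, S z -> fl z = k -> exists2 w, w \in ws & forall x, x \in b :: s ->
      `|f (z * x)%g - f (w * x)%g| <= e.
    have [ws [wsS hws]] := IH [set z | S z /\ fl z = k].
    exists ws; split=> [z /wsS[]|z Sz flz] //.
    have [w wws hw] := hws z (conj Sz flz); exists w => // x; rewrite inE => /orP[/eqP ->|/hw] //.
    have [_ flw] := wsS w wws.
    have := floor_itv (f (z * b)%g / e); have := floor_itv (f (w * b)%g / e).
    rewrite -/(fl z) -/(fl w) flz flw intrD.
    rewrite !ler_pdivlMr // !ltr_pdivrMr // => /andP[h1 h2] /andP[h3 h4].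
    by rewrite ler_norml; apply/andP; split; lra.
  have [w1 [w1S hw1]] := key n%:Z; have [w2 [w2S hw2]] := key (- n%:Z).
  exists (zs ++ w1 ++ w2); split.
    by move=> z; rewrite !mem_cat => /or3P[/zsS|/w1S|/w2S].
  move=> z Sz; rewrite ltnS leq_eqVlt => /orP[/eqP zn|zn]; last first.
    by have [w ww hw] := hzs z Sz zn; exists w => //; rewrite mem_cat ww.
  have [flz|flz] : fl z = n%:Z \/ fl z = - n%:Z by lia.
    by have [w ww hw] := hw1 z Sz flz; exists w => //; rewrite !mem_cat ww orbT.
  by have [w ww hw] := hw2 z Sz flz; exists w => //; rewrite !mem_cat ww !orbT.
have [zs [zsS hzs]] := H K.+1; exists zs; split=> // z Sz.
by have [w ww hw] := hzs z Sz (flK z); exists w.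
Qed.

(** Every point is u b c with [b] from a finite list, [u] near 1 and [c] in [Gamma]. Centrality
    turns f (z u b c) into f (u z b), which is close to f (z b), so the distance between two
    translates is decided at finitely many points. *)
Lemma totally_bounded i f (e : R) : 0 < e -> admissible f -> linv i.+1 f ->
  exists zs, Lseq i zs /\
    forall z, L i z -> exists2 w, w \in zs & forall a, `|f (z * a)%g - f (w * a)%g| <= e.
Proof.
move=> e0 [[M hM] hG hU] hf; have e3 : 0 < e / 3 by rewrite divr_gt0.
have [s hs] := cocompact (hU _ e3).
have [zs [zsS hzs]] := finite_representatives s (L i) e3 hM.
exists zs; split.
  split=> //; have [w ww _] := hzs 1%g (L1 i).
  by case: (zs) ww.
move=> z hz; have [w ww hw] := hzs z hz; exists w => // a.
have [b [bs [u [c [Uu Gc ->]]]]] := hs a.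
have E x : L i x -> f (x * (u * b * c))%g = f (u * (x * b))%g.
  by move=> hx; rewrite gA hG // (linv_comm u b hf hx).
rewrite (E _ hz) (E _ (zsS _ ww)).
have := Uu (z * b)%g; have := Uu (w * b)%g; have := hw b bs; rewrite !ler_norml.
by move=> /andP[h1 h2] /andP[h3 h4] /andP[h5 h6]; apply/andP; split; lra.
Qed.

Definition osc i f (D : R) := forall z a, L i z -> `|f (z * a)%g - f a| <= D.

(** Compare the averages at [z * a] and at [a] term by term: the term of [y * z] is paired with a
    representative [w] within [e], and the other q - 1 terms, paired arbitrarily, differ by at most
    [D]. *)
Lemma avg_osc i f (e D : R) zs : Lseq i zs -> linv i.+1 f ->
  (forall z, L i z -> exists2 w, w \in zs & forall a, `|f (z * a)%g - f (w * a)%g| <= e) ->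
  osc i f D ->
  osc i (avg zs f) ((((size zs)%:R - 1) * D + e) / (size zs)%:R).
Proof.
move=> [z0 hzs] hf hw hD z a hz.
case: zs z0 hzs hw => // y zs _ hzs hw; set q := (size (y :: zs))%:R.
have q0 : 0 < q :> R by rewrite ltr0n.
have qE : q - 1 = (size zs)%:R :> R by rewrite /q /= -natr1; ring.
rewrite /avg -/q -mulrBr normrM gtr0_norm ?invr_gt0 // mulrC ler_pM2r ?invr_gt0 //.
have D0 : 0 <= D by apply: le_trans (hD 1%g a (L1 i)).
have [w ww hwy] := hw (y * z)%g (LM (hzs y (mem_head _ _)) hz).
rewrite [X in _ - X](perm_big _ (perm_to_rem ww)) /= !big_cons.
have E : f (y * (z * a))%g + \sum_(j <- zs) f (j * (z * a))%g -
   (f (w * a)%g + \sum_(j <- rem w (y :: zs)) f (j * a)%g) =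
   (f (y * z * a)%g - f (w * a)%g) + (\sum_(j <- zs) f (j * (z * a))%g - \sum_(j <- rem w (y :: zs)) f (j * a)%g).
  by rewrite gA; ring.
rewrite E.
rewrite (le_trans (ler_normD _ _)) // addrC lerD //.
have szr : size (rem w (y :: zs)) = size zs by rewrite size_rem.
set r := rem w (y :: zs) in szr *.
have hr j : j \in r -> L i j by move=> /mem_rem; exact: hzs.
have hz' j : j \in zs -> L i j by move=> jz; apply: hzs; rewrite inE jz orbT.
rewrite qE; clearbody r; clear - hD szr hr hz' hz.
elim: zs r szr hr hz' => [|x zs IH] [|y r] //= szr hr hz'.
  by rewrite !big_nil subrr normr0 mul0r.
rewrite !big_cons opprD addrACA -natr1 mulrDl mul1r addrC (le_trans (ler_normD _ _)) // lerD //.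
  apply: IH => [|j jr|j jr]; first by case: szr.
    by apply: hr; rewrite inE jr orbT.
  by apply: hz'; rewrite inE jr orbT.
have := hD (x * z * y^-1)%g (y * a)%g; rewrite !gA gVK; apply.
apply: LM; last by apply: LV; apply: hr; rewrite mem_head.
by apply: LM => //; apply: hz'; rewrite mem_head.
Qed.

Lemma exp_small (rho K e : R) : 0 <= rho < 1 -> 0 <= K -> 0 < e -> exists n : nat, rho ^+ n * K <= e.
Proof.
move=> /andP[r0 r1] K0 e0; have K1 : 0 < K + 1 by lra.
have : rho ^+ n @[n --> \oo] --> (0 : R) by apply: cvg_expr; rewrite ger0_norm.
move=> /cvgrPdist_le/(_ (e / (K + 1))); rewrite divr_gt0 // => /(_ isT)[n _ hn].
exists n; have := hn n (leqnn n); rewrite /= sub0r normrN normrX (ger0_norm r0).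
rewrite ler_pdivlMr //; apply: le_trans; rewrite ler_wpM2l ?exprn_ge0 //; lra.
Qed.

(** Iterating D -> ((q - 1) D + e / 2) / q from 2 M converges geometrically to e / 2. The same list
    [zs0] serves at every round, since averaging over elements of [L i] preserves its approximation
    property. *)
Lemma small_osc i f (e : R) : 0 < e -> admissible f -> linv i.+1 f ->
  exists zs, Lseq i zs /\ osc i (avg zs f) e.
Proof.
move=> e0 af hf; have e2 : 0 < e / 2 by rewrite divr_gt0.
have [zs0 [L0 hzs0]] := totally_bounded e2 af hf.
have [[M hM] _ _] := af; have M0 : 0 <= M by exact: le_trans (hM 1%g).
set q := (size zs0)%:R : R; have q0 : 0 < q by rewrite ltr0n; case: L0.
have q1 : 1 <= q by rewrite ler1n; case: L0.
have [n hn] : exists n : nat, ((q - 1) / q) ^+ n * (2 * M) <= e / 2.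
  apply: exp_small => //; last by rewrite mulr_ge0.
  by rewrite divr_ge0 ?subr_ge0 ?(ltW q0) //= ltr_pdivrMr // mul1r; lra.
suff [zs [Lz oz]] : exists zs, Lseq i zs /\ osc i (avg zs f) (e / 2 + ((q - 1) / q) ^+ n * (2 * M)).
  exists zs; split => // z a hz; apply: le_trans (oz z a hz) _.
  by rewrite [leRHS](splitr e) lerD2l.
elim: n {hn} => [|n [zs [Lz oz]]].
  exists [:: 1%g]; split.
    by split=> // z; rewrite inE => /eqP ->; exact: L1.
  move=> z a _; rewrite /avg !big_seq1 !g1l expr0 mul1r -mulrBr invr1 mul1r.
  rewrite (le_trans (ler_normB _ _)) //; have := hM a; have := hM (z * a)%g; lra.
exists [seq (w * z)%g | z <- zs0, w <- zs]; split; first exact: Lseq_comp.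
move=> z a hz; rewrite -!avg_comp.
have h : forall z, L i z -> exists2 w, w \in zs0 & forall a, `|avg zs f (z * a)%g - avg zs f (w * a)%g| <= e / 2.
  move=> x hx; have [w ww hw] := hzs0 x hx; exists w => // b.
  have E y : L i y -> avg zs f (y * b)%g = avg zs (fun a => f (y * a)%g) b.
    by move=> hy; congr (_ * _); apply: eq_bigr => v _; exact: linv_comm hf hy.
  rewrite (E _ hx) (E _ (L0.2 _ ww)); apply: avg_normB; first by case: Lz.
  exact: hw.
have := @avg_osc i _ _ _ zs0 L0 (linv_avg zs hf) h oz z a hz.
set D := (X in _ <= X); suff -> : D = e / 2 + ((q - 1) / q) ^+ n.+1 * (2 * M) by [].
by rewrite /D -/q exprS; field; rewrite gt_eqF.
Qed.

(* Averaging over finite subsets of the [i]-th term contracts the oscillation along it, since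
   an [L i.+1]-invariant function sees its elements as central. *)
Lemma invariant_average i f : admissible f -> linv i.+1 f ->
  exists F, [/\ admissible F, linv i F &
    forall e, 0 < e -> exists zs, Lseq i zs /\ forall a, `|avg zs f a - F a| <= e].
Proof.
move=> af hf.
pose ok (f : G -> R) := admissible f /\ linv i.+1 f.
have /choice[W hW] (p : (G -> R) * nat) : exists zs, ok p.1 -> Lseq i zs /\ osc i (avg zs p.1) (2^-1 ^+ p.2).
  have [[h1 h2]|nok] := pselect (ok p.1); last by exists [::] => /nok.
  have [|zs hzs] := @small_osc i p.1 (2^-1 ^+ p.2) _ h1 h2; first by rewrite exprn_gt0 // invr_gt0.
  by exists zs.
(* [fs n.+1] oscillates by at most 2^-n along [L i], so averaging it again moves it by no more than
   that: the sequence converges uniformly to an invariant function. *)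
pose fs := fix fs n : G -> R := if n is m.+1 then avg (W (fs m, m)) (fs m) else f.
have okf n : ok (fs n).
  elim: n => [|n [h1 h2]] //=; split; first exact: adm_avg.
  exact: linv_avg.
have Ln n : exists zs, Lseq i zs /\ forall a, fs n a = avg zs f a.
  elim: n => [|n [zs [Lz hz]]].
    exists [:: 1%g]; split; first by split=> // z; rewrite inE => /eqP ->; exact: L1.
    by move=> a; rewrite /avg big_seq1 g1l invr1 mul1r.
  have [Lw _] := hW (fs n, n) (okf n).
  exists [seq (w * z)%g | z <- W (fs n, n), w <- zs]; split; first exact: Lseq_comp.
  move=> a; rewrite -avg_comp /=; congr (_ * _); apply: eq_bigr => w _; exact: hz.
have On n : osc i (fs n.+1) (2^-1 ^+ n) by have [_] := hW (fs n, n) (okf n).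
have step n a : `|fs n.+2 a - fs n.+1 a| <= 2^-1 ^+ n.
  have [[Lw hw] _] := hW (fs n.+1, n.+1) (okf n.+1).
  rewrite [fs n.+2]/= -/(fs n.+1) /avg.
  rewrite -[X in _ - X](@avg_linv i _ (fun=> fs n.+1 a) (conj Lw hw) (fun _ _ _ => erefl) a) /avg -mulrBr -sumrB.
  rewrite normrM normfV normr_nat mulrC ler_pdivrMr ?ltr0n // (le_trans (ler_norm_sum _ _ _)) //.
  rewrite [leRHS]mulrC -sum_seq_cst.
  by rewrite big_seq [leRHS]big_seq; apply: ler_sum => z zW; apply: On; exact: hw.
have cau n m : (n <= m)%N -> forall a, `|fs m.+1 a - fs n.+1 a| <= 2 * 2^-1 ^+ n - 2 * 2^-1 ^+ m.
  move=> nm a; rewrite -(subnK nm); elim: (m - n)%N => [|k IH].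
    by rewrite add0n !subrr normr0.
  rewrite addSn; have -> : fs (k + n).+2 a - fs n.+1 a = (fs (k + n).+2 a - fs (k + n).+1 a) + (fs (k + n).+1 a - fs n.+1 a) by ring.
  rewrite (le_trans (ler_normD _ _)) // (le_trans (lerD (step _ _) IH)) // [_ ^+ (k + n).+1]exprS.
  by lra.
have [F hF] : exists F : G -> R, forall n a, `|F a - fs n.+1 a| <= 2 * 2^-1 ^+ n.
  apply: uniform_sup_limit => n m nm a; apply: le_trans (cau n m nm a) _.
  by rewrite lerBlDr lerDl mulr_ge0 // exprn_ge0.
have close e : 0 < e -> exists2 n, 2 * 2^-1 ^+ n <= e & (2^-1 ^+ n : R) <= e.
  move=> e0; have h2 : 0 <= (2^-1 : R) < 1 by apply/andP; split; lra.
  have [n hn] := exp_small h2 (ler0n _ 2) e0.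
  exists n; first by rewrite mulrC.
  by apply: le_trans hn; rewrite ler_peMr ?exprn_ge0 //; lra.
exists F; split.
- apply: adm_lim => e e0; have [n hn _] := close _ e0.
  exists (fs n.+1); first by case: (okf n.+1).
  by move=> a; exact: le_trans (hF n a) hn.
- move=> z a hz; apply/eqP; rewrite -subr_eq0 -normr_le0; apply/ler_addgt0Pl => e e0.
  have e3 : 0 < e / 3 by rewrite divr_gt0.
  have [n hn hn'] := close _ e3; rewrite addr0.
  have := hF n a; have := hF n (z * a)%g; have := On n z a hz; rewrite !ler_norml.
  by move=> /andP[h1 h2] /andP[h3 h4] /andP[h5 h6]; apply/andP; split; lra.
- move=> e e0; have [n hn _] := close _ e0.
  have [zs [Lz hz]] := Ln n.+1; exists zs; split=> // a.
  by rewrite -hz distrC (le_trans (hF n a)).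
Qed.

(** Averages over [L i] commute on [L i.+1]-invariant functions and fix the limits [F h]; averaging
    further for the next function does not spoil the approximations already obtained. *)
Lemma common_average i (H : nat) (f F : nat -> G -> R) (e : R) : 0 < e ->
  (forall h, admissible (f h) /\ linv i.+1 (f h)) ->
  (forall h, linv i (F h) /\ forall e, 0 < e -> exists zs, Lseq i zs /\ forall a, `|avg zs (f h) a - F h a| <= e) ->
  exists zs, Lseq i zs /\ forall h, (h < H)%N -> forall a, `|avg zs (f h) a - F h a| <= e.
Proof.
move=> e0 hf hF; elim: H => [|H [zs [Lz hz]]].
  by exists [:: 1%g]; split=> //; split=> // z; rewrite inE => /eqP ->; exact: L1.
have [lF hFH] := hF H; have [ws [Lw hw]] := hFH e e0.
exists [seq (w * z)%g | z <- zs, w <- ws]; split; first exact: Lseq_comp.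
move=> h; rewrite ltnS leq_eqVlt => /orP[/eqP ->|hH] a; rewrite -avg_comp.
  rewrite -[X in _ - X](avg_linv Lz lF); apply: avg_normB hw _; by case: Lz.
rewrite (avg_avgC a Lz Lw (hf h).2) -[X in _ - X](avg_linv Lw (hF h).1).
by apply: avg_normB; [case: Lw|exact: hz].
Qed.

(* Van der Corput turns the sum over a function [f] into sums over [f (g^h x) * f x], which become
   [L i]-invariant after averaging, against phases of one degree less. *)
Lemma orbit_phase_sum_step i :
  (forall f c e, admissible f -> linv i f -> irr c -> 0 < e -> exists N0 : nat, forall N, (N0 <= N)%N ->
    forall u a, phase i.+1 c u -> `|\sum_(n < N) f (g ^+ n * a)%g * tc (u n)| <= e * N%:R) ->
  forall f c e, admissible f -> linv i.+1 f -> irr c -> 0 < e -> exists N0 : nat, forall N, (N0 <= N)%N ->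
    forall u a, phase i.+2 c u -> `|\sum_(n < N) f (g ^+ n * a)%g * tc (u n)| <= e * N%:R.
Proof.
move=> IH f c e af hf ic e0.
have [[M0 hM0] _ _] := af; pose M := M0 + 1.
have hM a : `|f a| <= M by rewrite (le_trans (hM0 a)) // lerDl.
have M1 : 0 < M by have := le_trans (normr_ge0 _) (hM0 1%g); rewrite /M; lra.
have e2 : 0 < e / 2 by rewrite divr_gt0.
have [zs0 [L0 hzs0]] := totally_bounded e2 af hf.
set q := (size zs0)%:R : R; have q0 : 0 < q by rewrite ltr0n; case: L0.
(* [q] is known before [H] and [Z] and may enter the precision: in the family [r] below, only one
   translate in q is sure to give a large sum. *)
pose e' := e ^+ 2 / (64 * q).
have e'0 : 0 < e' by rewrite divr_gt0 ?exprn_gt0 // mulr_gt0.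
pose H := (Num.truncn (M ^+ 2 / e')).+1.
have HM : M ^+ 2 / H%:R <= e'.
  rewrite ler_pdivrMr ?ltr0n // mulrC -ler_pdivrMr //.
  exact/ltW/truncnS_gt.
pose fh (h : nat) a := f (g ^+ h * a)%g * f a.
have fhP h : admissible (fh h) /\ linv i.+1 (fh h).
  split; first by apply: admM => //; exact: adm_trans.
  move=> z a hz; rewrite /fh; congr (_ * _); last exact: hf.
  exact: (@linv_trans i.+1 f (g ^+ h)%g hf z a hz).
have /choice[Fh FhP] h := invariant_average (fhP h).1 (fhP h).2.
have [Z [LZ hZ]] : exists zs, Lseq i zs /\ forall h, (h < H)%N -> forall a, `|avg zs (fh h) a - Fh h a| <= e'.
  by apply: common_average => // h; have [_ ? ?] := FhP h.
have /choice[N0 hN0] (h : nat) : exists N0 : nat, (0 < h)%N -> forall N, (N0 <= N)%N ->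
    forall u a, phase i.+1 (h%:R * c) u -> `|\sum_(n < N) Fh h (g ^+ n * a)%g * tc (u n)| <= e' * N%:R.
  have [->|h0] := posnP h; first by exists 0%N.
  have [aF lF _] := FhP h.
  by have [N1 hN1] := IH (Fh h) (h%:R * c) e' aF lF (irrM ic h0) e'0; exists N1.
pose N1 := (\max_(h < H) N0 h + (Num.truncn (H%:R * M / e * 32 * q)).+1 )%N.
exists N1 => N N1N u a hu.
have N1h h : (h < H)%N -> (N0 h <= N)%N.
  move=> hH; apply: leq_trans N1N; rewrite /N1.
  apply: leq_trans (leq_addr _ _); exact: (@leq_bigmax _ (fun h : 'I_H => N0 h) (Ordinal hH)).
have NK : H%:R * M / e * 32 * q < N%:R.
  by apply: lt_le_trans (truncnS_gt _) _; rewrite ler_nat (leq_trans _ N1N) // leq_addl.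
have N_gt0 : 0 < N%:R :> R by apply: le_lt_trans NK; rewrite !mulr_ge0 ?invr_ge0 // ltW.
(* Translates by [Z] alone may have lost the original sum. For each [z] in [Z] some [y] in [zs0]
   makes z y^-1 act on [f] as the identity up to e / 2, so the family contains nearly unchanged
   copies of that sum. *)
pose zi := [seq (z^-1)%g | z <- zs0].
have Lzi : Lseq i zi.
  by split=> [|_ /mapP[z /(L0.2 z) hz ->]]; [rewrite size_map; case: L0|exact: LV].
pose r := [seq (w * z)%g | z <- zi, w <- Z].
have Lr : Lseq i r by exact: Lseq_comp.
have szr : size r = (size zs0 * size Z)%N by rewrite size_allpairs size_map.
(* With both phases, the products of cosines add up to the cosine of u (n + s + h) - u (n + s), a
   phase of one degree less. *)
pose rb := [seq (w, b) | w <- r, b <- [:: 0; 4^-1 : R]].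
have szrb : size rb = (size r * 2)%N by rewrite size_allpairs.
pose v (p : G * R) (n : nat) := f (g ^+ n * (p.1 * a))%g * tc (u n - p.2).
have vM p n : `|v p n| <= M.
  by rewrite normrM -[M]mulr1 ler_pM // tc_max.
have rbE (F : G * R -> R) : \sum_(p <- rb) F p = \sum_(w <- r) (F (w, 0) + F (w, 4^-1)).
  rewrite /rb; elim: (r) => [|w s IHs]; rewrite ?big_nil //= !big_cons IHs.
  by rewrite /= addrA.
have corr s h : (s < H)%N -> (0 < h < H)%N ->
    \sum_(p <- rb) \sum_(n < N) v p (n + s + h)%N * v p (n + s)%N <= e' * N%:R * (size rb)%:R.
  move=> sH /andP[h0 hH]; rewrite rbE.
  pose u' n := u (n + s + h)%N - u (n + s)%N.
  have hu' : phase i.+1 (h%:R * c) u' by exact: phase_dif_shift.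
  have -> : \sum_(w <- r) (\sum_(n < N) v (w, 0) (n + s + h)%N * v (w, 0) (n + s)%N +
      \sum_(n < N) v (w, 4^-1) (n + s + h)%N * v (w, 4^-1) (n + s)%N) =
    \sum_(n < N) (size r)%:R * (avg r (fh h) (g ^+ n * (g ^+ s * a))%g * tc (u' n)).
    under eq_bigr do rewrite -big_split /=.
    rewrite exchange_big /=; apply: eq_bigr => n _.
    rewrite /avg -mulrA mulrA mulfV ?mul1r; last by rewrite pnatr_eq0 -lt0n; case: Lr.
    rewrite mulr_suml; apply: eq_big_seq => w wr; rewrite /v /u' /= !subr0.
    rewrite -(linv_comm (g ^+ n) (g ^+ s * a)%g (fhP h).2 (Lr.2 _ wr)) /fh.
    have E1 : f (g ^+ (n + s) * (w * a))%g = f (g ^+ n * (w * (g ^+ s * a)))%g.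
      rewrite expgnDr -gA (linv_comm (g ^+ n) (g ^+ s * a)%g hf (Lr.2 _ wr)).
      have := linv_comm (g ^+ n * g ^+ s)%g a hf (Lr.2 _ wr); rewrite -!gA; exact.
    have E2 : f (g ^+ (n + s + h) * (w * a))%g = f (g ^+ h * (g ^+ n * (w * (g ^+ s * a))))%g.
      have := linv_comm (g ^+ (n + s + h))%g a hf (Lr.2 _ wr) => ->.
      have := linv_comm (g ^+ h * g ^+ n)%g (g ^+ s * a)%g hf (Lr.2 _ wr); rewrite -!gA => ->.
      by rewrite addnC addnA !expgnDr -!gA.
    by rewrite E1 E2 (tcB (u (n + s + h)%N) (u (n + s)%N)); ring.
  rewrite -mulr_sumr.
  have h1 : `|\sum_(n < N) avg r (fh h) (g ^+ n * (g ^+ s * a))%g * tc (u' n) -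
      \sum_(n < N) Fh h (g ^+ n * (g ^+ s * a))%g * tc (u' n)| <= e' * N%:R.
    rewrite -sumrB (le_trans (ler_norm_sum _ _ _)) //.
    have -> : e' * N%:R = \sum_(n < N) e' by rewrite sumr_const card_ord mulr_natr.
    apply: ler_sum => n _; rewrite -mulrBl normrM -[e']mulr1 ler_pM ?tc_max //.
    have [_ lF _] := FhP h; rewrite -avg_comp -[X in _ - X](avg_linv Lzi lF).
    apply: avg_normB; first by case: Lzi.
    exact: hZ.
  have h2 := hN0 h h0 N (N1h h hH) u' (g ^+ s * a)%g hu'.
  rewrite szrb natrM.
  have -> : e' * N%:R * ((size r)%:R * 2%:R) = (size r)%:R * (2 * (e' * N%:R)) by ring.
  rewrite ler_wpM2l //; move: h1 h2; rewrite !ler_norml => /andP[h3 h4] /andP[h5 h6]; lra.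
have := van_der_corput (isT : (0 < H)%N) (ltW e'0) vM corr.
rewrite leNgt; set S := \sum_(n < N) f (g ^+ n * a)%g * tc (u n).
move=> vdc; rewrite leNgt; apply/negP => Se; move: vdc; rewrite -leNgt => vdc.
have good z : exists2 y, y \in zi & (z \in Z -> e ^+ 2 / 4 * N%:R ^+ 2 <= (\sum_(n < N) v ((z * y)%g, 0) n) ^+ 2).
  have [zZ|zZ] := boolP (z \in Z); last first.
    have [y yi] : exists y, y \in zi by case: (zi) Lzi.1 => // y s _; exists y; rewrite mem_head.
    by exists y.
  have [y yz hy] := hzs0 z (LZ.2 _ zZ); exists (y^-1)%g; first exact: map_f.
  move=> _; have d n : `|v ((z * y^-1)%g, 0) n - f (g ^+ n * a)%g * tc (u n)| <= e / 2.
    rewrite /v /= subr0 -mulrBl normrM -[e / 2]mulr1 ler_pM ?tc_max //.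
    have Lw : L i (z * y^-1)%g by apply: LM; [exact: LZ.2|apply: LV; exact: L0.2].
    rewrite (linv_comm (g ^+ n)%g a hf Lw).
    by have := hy (y^-1 * (g ^+ n * a))%g; rewrite gVKl (gA z).
  have dS : `|\sum_(n < N) v ((z * y^-1)%g, 0) n - S| <= e / 2 * N%:R.
    rewrite -sumrB (le_trans (ler_norm_sum _ _ _)) //.
    have -> : e / 2 * N%:R = \sum_(n < N) (e / 2) by rewrite sumr_const card_ord mulr_natr.
    by apply: ler_sum => n _; exact: d.
  have h : e / 2 * N%:R <= `|\sum_(n < N) v ((z * y^-1)%g, 0) n|.
    have := ler_normB S (S - \sum_(n < N) v ((z * y^-1)%g, 0) n).
    rewrite subKr distrC => h; have := ler_normD (\sum_(n < N) v ((z * y^-1)%g, 0) n) (S - \sum_(n < N) v ((z * y^-1)%g, 0) n).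
    rewrite addrC subrK (distrC S) => h'; lra.
  have -> : e ^+ 2 / 4 * N%:R ^+ 2 = (e / 2 * N%:R) ^+ 2 by field.
  by rewrite -[X in _ <= X]real_normK ?num_real // ler_sqr ?nnegrE // mulr_ge0 // ltW.
have low : (size Z)%:R * (e ^+ 2 / 4 * N%:R ^+ 2) <= \sum_(p <- rb) (\sum_(n < N) v p n) ^+ 2.
  rewrite rbE; apply: (@le_trans _ _ (\sum_(w <- r) (\sum_(n < N) v (w, 0) n) ^+ 2)); last first.
    by apply: ler_sum => w _; rewrite lerDl sqr_ge0.
  rewrite sum_allpairs exchange_big /= -sum_seq_cst.
  rewrite big_seq [leRHS]big_seq; apply: ler_sum => z zZ.
  have [y yi hy] := good z; apply: le_trans (hy zZ) _.
  by rewrite (big_rem y) //= lerDl sumr_ge0 // => x _; rewrite sqr_ge0.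
have := le_trans low vdc; rewrite szrb szr !natrM -/q.
have Z0 : 0 < (size Z)%:R :> R by rewrite ltr0n; case: LZ.
set sZ := (size Z)%:R in Z0 *.
have -> : q * sZ * 2%:R * (2 * N%:R ^+ 2 * (M ^+ 2 / H%:R + e') + 8 * H%:R ^+ 2 * M ^+ 2) =
  sZ * (2 * q * (2 * N%:R ^+ 2 * (M ^+ 2 / H%:R + e') + 8 * H%:R ^+ 2 * M ^+ 2)) by ring.
rewrite ler_pM2l //; apply/negP; rewrite -ltNge.
apply: (@vdc_bound _ _ _ _ _ _ _ e0 _ (ltW M1) HM) => //; first by rewrite ler1n; case: L0.
move: NK; have -> : H%:R * M / e * 32 * q = H%:R * M * 32 * q / e by ring.
by rewrite ltr_pdivrMr // [e * _]mulrC.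
Qed.

(** At [i = 0] invariance under all of G makes [f] constant, and the cosine of a linear phase has
    bounded sums. Nilpotency is encoded by [linv i f]. *)
Theorem orbit_phase_sum i f c e : admissible f -> linv i f -> irr c -> 0 < e ->
  exists N0 : nat, forall N, (N0 <= N)%N -> forall u a, phase i.+1 c u ->
    `|\sum_(n < N) f (g ^+ n * a)%g * tc (u n)| <= e * N%:R.
Proof.
elim: i f c e => [|i IH] f c e af hf ic e0; last exact: orbit_phase_sum_step.
have [C C0 hC] := tc_phase1 ic.
exists (Num.truncn (e^-1 * (`|f 1%g| * C))).+1 => N hN u a hu.
have fE x : f x = f 1%g by rewrite -[x]g1r hf.
under eq_bigr do rewrite fE; rewrite -mulr_sumr normrM.
have h1 : `|f 1%g| * `|\sum_(n < N) tc (u n)| <= `|f 1%g| * C by rewrite ler_wpM2l // hC.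
apply: (le_trans h1); rewrite -ler_pdivrMl //; apply/ltW; apply: lt_le_trans (truncnS_gt _) _.
by rewrite ler_nat.
Qed.

End nilpotent_equidistribution.

Section nilsystem_equidistribution.
Variable R : realType.

(** Weyl's theorem is the orbit estimate for the trivial group and the constant function 1, which is
    invariant at every level. *)
Lemma weyl_sum i (c e : R) : irr c -> 0 < e -> exists N0 : nat, forall N, (N0 <= N)%N ->
  forall u, phase i.+1 c u -> `|\sum_(n < N) tc (u n)| <= e * N%:R.
Proof.
move=> ic e0; pose G : groupType := {perm 'I_1}.
pose nb : set_system G := fun U => U 1%g.
have nbF : Filter nb by split=> // P Q PQ; exact: PQ.
have nbJ (x : G) U : nb U -> nb [set u | U (x * u * x^-1)%g].
  by rewrite /nb /= g1r gV.
have cc U : nb U -> exists s : seq G, forall a, exists b, b \in s /\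
    exists u c, [/\ U u, setT c & a = (u * b * c)%g].
  move=> U1; exists [:: 1%g] => a; exists 1%g; split; first exact: mem_head.
  by exists 1%g, a; split=> //; rewrite !g1l.
have ad : admissible setT nb (fun _ : G => 1 : R) by exact: adm_cst.
have [//|N0 hN0] := @orbit_phase_sum R G setT nb 1%g nbF nbJ cc i (fun=> 1) c e ad _ ic e0.
exists N0 => N hN u hu; have := hN0 N hN u 1%g hu.
by under eq_bigr do rewrite mul1r.
Qed.

(** The lift of [phi] to G is invariant under [L s] because that term is trivial. Openness of the
    quotient map [p] and compactness of [W] provide both the finite list of [cocompact] and uniform
    continuity. *)
Lemma nilsystem_phase_sum (W : system R) (s : nat) (phi : W -> R) (c e : R) :
  nilsystem s W -> continuous phi -> irr c -> 0 < e ->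
  exists N0 : nat, forall N, (N0 <= N)%N -> forall u w, phase s.+1 c u ->
    `|\sum_(n < N) phi (iter n (trans W) w) * tc (u n)| <= e * N%:R.
Proof.
move=> [d [G [Gam [g [p [[[_ _ mulc _ _] nil] [sg _] [psurj pfib popen] ptrans _]]]]]] phic ic e0.
pose G0 : groupType := G.
pose nb : set_system G0 := nbhs (1%g : G).
have mulcr (x : G) : continuous (fun u : G => (u * x)%g).
  move=> u; apply: (@continuous_comp _ _ _ (fun u : G => (u, x)%g) (fun xy : G * G => (xy.1 * xy.2)%g)).
    by apply: cvg_pair; [exact: cvg_id|exact: cvg_cst].
  exact: mulc.
have mulcl (x : G) : continuous (fun u : G => (x * u)%g).
  move=> u; apply: (@continuous_comp _ _ _ (fun u : G => (x, u)%g) (fun xy : G * G => (xy.1 * xy.2)%g)).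
    by apply: cvg_pair; [exact: cvg_cst|exact: cvg_id].
  exact: mulc.
have nbF : Filter nb by exact: nbhs_filter.
have nbJ (x : G0) U : nb U -> nb [set u | U (x * u * x^-1)%g].
  move=> hU; have c3 : {for (1%g : G), continuous (fun u : G => (x * u * x^-1)%g)}.
    apply: (@continuous_comp _ _ _ (fun u : G => (x * u)%g) (fun u : G => (u * x^-1)%g)).
      exact: mulcl.
    exact: mulcr.
  apply: c3; have -> : ((x : G) * 1 * x^-1)%g = 1%g by rewrite (g1r (x : G0)) (gV (x : G0)).
  exact: hU.
have pc : continuous p by apply/continuousP => U; rewrite -popen.
have pGam (a c0 : G0) : Gam c0 -> p (a * c0)%g = p a.
  by move=> hc; apply/esym/pfib; rewrite (gKl a c0).
have pO (O : set G) : open O -> open (p @` O).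
  move=> oO; apply/popen.
  have -> : p @^-1` (p @` O) = \bigcup_(c0 in Gam) [set a | O (a * c0)%g].
    apply/seteqP; split => [a [b Ob /esym/pfib hc]|a [c0 hc Oa]].
      by exists (a^-1 * b)%g => //=; rewrite (gVKl (a : G0)).
    by exists (a * c0)%g => //; exact: pGam.
  by apply: bigcup_open => c0 _; have /continuousP := mulcr c0; apply.
have cW := @space_compact R W.
have cc U : nb U -> exists s : seq G0, forall a, exists b, b \in s /\
    exists u c, [/\ U u, Gam c & a = (u * b * c)%g].
  move=> hU.
  have [|t ht] := @compact_finite_cover W (fun w => [set w' | exists2 a, p a = w & exists2 u, U u & w' = p (u * a)%g]) cW.
    move=> w; have [a <-] := psurj w.
    have : nbhs (p a) (p @` [set b | U (b * a^-1)%g]°).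
      apply: open_nbhs_nbhs; split; first exact/pO/open_interior.
      exists a => //; apply: (mulcr (a^-1)%g).
      by rewrite (gV (a : G0)).
    apply: filterS => _ [b /interior_subset /= hb <-]; exists a => //.
    by exists (b * a^-1)%g => //; rewrite (gVK (b : G0)).
  have /choice[sec hsec] (w : W) := psurj w.
  exists [seq sec w | w <- t] => a; have [w wt /= [b pb [u Uu pa]]] := ht (p a).
  exists (sec w); split; first exact: map_f.
  exists u, ((u * sec w)^-1 * a)%g; split=> //; last by rewrite (gVKl ((u : G0) * sec w)%g).
  apply/pfib; rewrite pa.
  have /pfib h : p b = p (sec w) by rewrite pb hsec.
  by rewrite -[sec w](gVKl (b : G0)) (gA (u : G0)); apply: pGam.
have [M hM] : exists M, forall w, `|phi w| <= M.
  have [t ht] := @compact_finite_cover W (fun w => [set w' | `|phi w - phi w'| < 1]) cW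
     (fun w => proj1 (cvgrPdist_lt _ _) (phic w) _ ltr01).
  exists (\sum_(w <- t) `|phi w| + 1) => w.
  have [x xt /= hx] := ht w.
  have : `|phi x| <= \sum_(w <- t) `|phi w| by rewrite (big_rem x) //= lerDl sumr_ge0.
  have : `|phi w| <= `|phi x| + `|phi x - phi w|.
    by rewrite -{1}(subKr (phi x) (phi w)) (le_trans (ler_normB _ _)).
  by move=> h1 h2; apply: (le_trans h1); rewrite lerD // ltW.
have adm : admissible Gam nb (phi \o p : G0 -> R).
  split=> [|a c0 hc|r r0]; first by exists M => a; exact: hM.
    by rewrite /= pGam.
  have r2 : 0 < r / 2 by rewrite divr_gt0.
  have loc (w : W) : exists P : set G * set G, [/\ nb P.1, open P.2, exists2 a, p a = w & P.2 a &
     forall u b, P.1 u -> P.2 b -> `|phi w - phi (p (u * b)%g)| < r / 2].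
    have [a pa] := psurj w.
    have : {for (1%g, a) : G * G, continuous (fun xy : G * G => phi (p (xy.1 * xy.2)%g))}.
      apply: (@continuous_comp _ _ _ (fun xy : G * G => (xy.1 * xy.2)%g) (phi \o p)); first exact: mulc.
      apply: continuous_comp; [exact: pc|exact: phic].
    move=> /cvgrPdist_lt/(_ _ r2)[[P Q] /= [hP hQ] hPQ].
    exists (P, Q°); split => //=; first exact: open_interior.
      by exists a => //; exact: hQ.
    move=> u b Pu /interior_subset Qb; have := hPQ (u, b) (conj Pu Qb) => /=.
    by rewrite (g1l (a : G0)) pa.
  have /choice[P hP] := loc.
  have [|t ht] := @compact_finite_cover W (fun w => p @` (P w).2) cW.
    move=> w; have [_ oP [a pa Pa] _] := hP w; apply: open_nbhs_nbhs; split; first exact: pO.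
    by exists a.
  have nbt : nb [set u | forall w, w \in t -> (P w).1 u].
    elim: (t) => [|w t' IH]; first by apply: filterS (@filterT _ nb _).
    have [hPw _ _ _] := hP w; apply: filterS2 hPw IH => u h1 h2 w'.
    by rewrite inE => /orP[/eqP ->|/h2].
  have nb1 U : nb U -> U 1%g by exact: nbhs_singleton.
  apply: filterS nbt => u /= hu a.
  have [w wt [b Pb pba]] := ht (p a).
  have [hPw _ _ hPw'] := hP w.
  have E : p (u * a)%g = p (u * b)%g.
    have /pfib hc : p b = p a by [].
    by rewrite -[a](gVKl (b : G0)) (gA (u : G0)); apply: pGam.
  have E1 : p a = p (1 * b)%g by rewrite (g1l (b : G0)).
  rewrite /= E E1.
  have h1 := hPw' u b (hu w wt) Pb; have h2 := hPw' 1%g b (nb1 _ hPw) Pb.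
  have -> : phi (p (u * b)%g) - phi (p (1 * b)%g) =
    (phi w - phi (p (1 * b)%g)) - (phi w - phi (p (u * b)%g)) by ring.
  by rewrite (le_trans (ler_normB _ _)) // (splitr r) lerD // ltW.
have lin : linv s (phi \o p : G0 -> R).
  by move=> z a; rewrite nil => ->; rewrite g1l.
have [N0 hN0] := @orbit_phase_sum R G0 Gam nb g nbF nbJ cc s _ c e adm lin ic e0.
exists N0 => N hN u w hu; have [a <-] := psurj w.
have iterE n : iter n (trans W) (p a) = p (g ^+ n * a)%g.
  elim: n => [|n IH]; first by rewrite /= (g1l (a : G0)).
  by rewrite iterS IH ptrans (expgS (g : G0)) -(gA (g : G0)).
by have := hN0 N hN u a hu; under eq_bigr do rewrite /= -iterE.
Qed.

End nilsystem_equidistribution.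

Definition lipschitz (R : realType) (d d' : nat) (f : torus R d -> torus R d') :=
  exists2 L : R, 0 <= L & forall x y, tdist (f x) (f y) <= L * tdist x y.

(** * Affine maps of the torus *)

Section lipschitz_maps.
Variables (R : realType).

Lemma lipschitz_continuous d d' (f : torus R d -> torus R d') : lipschitz f -> continuous f.
Proof.
move=> [L L0 hL]; apply/ball_continuousP => x e e0.
have L1 : 0 < L + 1 by lra.
exists (e / (L + 1)); first by rewrite divr_gt0.
move=> y; rewrite !torus_ballE /= ltr_pdivlMr // => h.
apply: le_lt_trans (hL x y) _; apply: le_lt_trans h.
by rewrite mulrC ler_wpM2l ?tdist_ge0 //; lra.
Qed.

Lemma lipschitz_comp d1 d2 d3 (f : torus R d2 -> torus R d3) (g : torus R d1 -> torus R d2) :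
  lipschitz f -> lipschitz g -> lipschitz (f \o g).
Proof.
move=> [L L0 hL] [M M0 hM]; exists (L * M); first exact: mulr_ge0.
by move=> x y; rewrite (le_trans (hL _ _)) // -mulrA ler_wpM2l.
Qed.

Lemma lipschitz_id d : lipschitz (@id (torus R d)).
Proof. by exists 1 => // x y; rewrite mul1r. Qed.

Lemma measurable_lipschitz d d' (f : torus R d -> torus R d') : lipschitz f ->
  measurable_fun setT (f : borel (torus R d) -> borel (torus R d')).
Proof.
move=> /lipschitz_continuous /continuousP fc.
apply: (@measurability _ _ (borel (torus R d)) (borel (torus R d')) setT _ (@open (torus R d'))) => //.
by move=> _ [B oB <-]; rewrite setTI; apply: borel_open; exact: fc.
Qed.

End lipschitz_maps.

Section translations.
Variables (R : realType) (d : nat).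
Implicit Types (x : torus R d) (v : 'rV[R]_d).

Definition tshift v x : torus R d := tproj (tval x + v).

Lemma tshift_proj u v : tshift v (tproj u) = tproj (u + v).
Proof.
apply/tprojP; have /intvP h := tval_proj u; apply/intvP => i.
by have := h i; rewrite !mxE => h'; rewrite opprD addrACA subrr addr0.
Qed.

Lemma tshift0 x : tshift 0 x = x. Proof. by rewrite /tshift addr0 tproj_val. Qed.

Lemma tshift_lipschitz v : lipschitz (tshift v).
Proof.
exists 1 => // x y; rewrite mul1r /tshift tdist_projE opprD addrACA subrr addr0.
by rewrite -tdist_projE !tproj_val.
Qed.

Lemma tdist_shift v w x : tdist (tshift v x) (tshift w x) <= `|v - w|.
Proof.
apply: le_trans (tdist_proj_le _ _) _.
by rewrite opprD addrACA subrr add0r.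
Qed.

Lemma tchar_shift m c v x : tchar m c (tshift v x) = tchar m (dotp m v + c) x.
Proof. by rewrite tchar_proj dotpD -addrA. Qed.

Lemma haar_shift v A : borel_set A -> haar R d (tshift v @^-1` A) = haar R d A.
Proof.
apply: haar_preserved; first (apply: measurable_lipschitz; exact: tshift_lipschitz).
move=> m c m0; rewrite (_ : _ \o _ = tchar m (dotp m v + c)) ?haar_char //.
by apply/funext => x; exact: tchar_shift.
Qed.

Lemma expect_shift v (f : torus R d -> R) : bmeas (f : borel (torus R d) -> R) ->
  expect (haar R d) (f \o tshift v) = expect (haar R d) f.
Proof.
move=> bf; apply: expect_haar_preserved => //; last exact: haar_shift.
by apply: measurable_lipschitz; exact: tshift_lipschitz.
Qed.

Lemma expect_antisym v (f : torus R d -> R) : bmeas (f : borel (torus R d) -> R) ->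
  (forall x, f (tshift v x) = - f x) -> expect (haar R d) f = 0.
Proof.
move=> bf hf; have := expect_shift v bf.
rewrite (_ : f \o _ = fun x => - f x); last by apply/funext.
by rewrite expectN // => h; lra.
Qed.

End translations.

Section affine_maps.
Variables (R : realType) (d : nat).
Implicit Types (A B : 'M[int]_d) (al : 'rV[R]_d) (x : torus R d).

Definition rmx A : 'M[R]_d := map_mx (fun z : int => z%:~R) A.

Lemma rmxM A B : rmx (A *m B) = rmx A *m rmx B. Proof. exact: map_mxM. Qed.
Lemma rmxD A B : rmx (A + B) = rmx A + rmx B. Proof. exact: map_mxD. Qed.
Lemma rmx1 : rmx 1%:M = 1%:M. Proof. exact: map_mx1. Qed.

Lemma intv_mul A (u : 'rV[R]_d) : intv u -> intv (u *m rmx A).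
Proof.
move=> /intvP h; apply/intvP => j; rewrite mxE; apply: rpred_sum => i _.
by rewrite rpredM // mxE intr_int.
Qed.

Lemma dotp_mul A m (u : 'rV[R]_d) : dotp m (u *m rmx A) = dotp (m *m A^T) u.
Proof.
rewrite /dotp; under eq_bigr do rewrite mxE mulr_sumr.
rewrite exchange_big /=; apply: eq_bigr => i _.
rewrite mxE raddf_sum /= mulr_suml; apply: eq_bigr => j _.
by rewrite !mxE intrM mulrA mulrAC.
Qed.

Definition aff A al x : torus R d := tproj (tval x *m rmx A + al).

Lemma aff_proj A al u : aff A al (tproj u) = tproj (u *m rmx A + al).
Proof.
apply/tprojP; rewrite opprD addrACA subrr addr0 -mulmxBl.
exact/intv_mul/tval_proj.
Qed.

Lemma aff_shift A al v x : aff A al (tshift v x) = tshift (v *m rmx A) (aff A al x).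
Proof. by rewrite {1}/tshift aff_proj /aff tshift_proj mulmxDl addrAC. Qed.

Lemma aff_comp A B al be x : aff B be (aff A al x) = aff (A *m B) (al *m rmx B + be) x.
Proof. by rewrite [aff A al x]/aff aff_proj mulmxDl -mulmxA -rmxM -addrA. Qed.

Lemma aff1 x : aff 1%:M 0 x = x.
Proof. by rewrite /aff rmx1 mulmx1 addr0 tproj_val. Qed.

Lemma aff_lipschitz A al : lipschitz (aff A al).
Proof.
exists (mx_bound (rmx A)); first exact: mx_bound_ge0.
move=> x y; have [v -> <-] := torus_lift x y.
rewrite -/(tshift v x) aff_shift -{1}[aff A al x]tshift0.
apply: le_trans (tdist_shift _ _ _) _.
by rewrite sub0r normrN mulmx_norm.
Qed.

Lemma tchar_aff A al m c x : tchar m c (aff A al x) = tchar (m *m A^T) (dotp m al + c) x.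
Proof. by rewrite tchar_proj dotpD dotp_mul -addrA. Qed.

Lemma haar_aff A B al C : A *m B = 1%:M -> borel_set C -> haar R d (aff A al @^-1` C) = haar R d C.
Proof.
move=> AB; apply: haar_preserved; first (apply: measurable_lipschitz; exact: aff_lipschitz).
move=> m c m0; rewrite (_ : _ \o _ = tchar (m *m A^T) (dotp m al + c)); last first.
  by apply/funext => x; exact: tchar_aff.
apply: haar_char; apply: contra m0 => /eqP h.
have /mulmx1C BA := AB.
by rewrite -[m]mulmx1 -trmx1 -BA trmx_mul mulmxA h mul0mx.
Qed.

End affine_maps.

Lemma bmeas_trig (R : realType) d (g : torus R d -> R) : trig g -> bmeas (g : borel (torus R d) -> R).
Proof.
elim=> [m c|g1 g2 _ h1 _ h2|a {}g _ h]; [exact: bmeas_tchar|exact: bmeasD|exact: bmeasZ].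
Qed.

Lemma bmeas_torus (R : realType) d (f : torus R d -> R) :
  continuous f -> bmeas (f : borel (torus R d) -> R).
Proof.
move=> fc; have [g tg hg] := trig_dense fc ltr01.
have [_ [M hM]] := bmeas_trig tg.
apply: (@bmeas_continuous _ _ f (1 + M) fc) => x.
by rewrite -(subrK (g x) (f x)) (le_trans (ler_normD _ _)) // lerD.
Qed.

(** Trigonometric polynomials are uniformly dense. [S] is arbitrary because the same passage is made
    for the affine map and for the limit homeomorphism. *)
Lemma average_of_chars (R : realType) (d : nat) (S : torus R d -> torus R d) :
  (forall (m : 'rV[int]_d) c (e : R), m != 0 -> 0 < e -> exists N0 : nat, forall n, (N0 <= n)%N ->
    forall y, `|\sum_(i < n) tchar m c (iter i S y)| <= e * n%:R) ->
  forall (f : torus R d -> R) (e : R), continuous f -> 0 < e ->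
  exists N0 : nat, forall n, (N0 <= n)%N ->
  forall y, `|\sum_(i < n) f (iter i S y) - n%:R * expect (haar R d) f| <= e * n%:R.
Proof.
move=> avS f e; have bt := @bmeas_trig R d.
have T g : trig g -> forall e : R, 0 < e -> exists N0 : nat, forall n, (N0 <= n)%N ->
    forall y, `|\sum_(i < n) g (iter i S y) - n%:R * expect (haar R d) g| <= e * n%:R.
  elim=> [m c|g1 g2 t1 h1 t2 h2|a {}g t h] {}e e0.
  - have [->|m0] := eqVneq m 0.
      have E : tchar 0 c = (fun=> tc c : R) :> (torus R d -> R).
        by apply/funext => x; rewrite /tchar dotp0l add0r.
      exists 0%N => n _ y; rewrite E.
      rewrite expect_cst sumr_const card_ord mulr_natl subrr normr0 mulr_ge0 // ltW //.
    rewrite haar_char //; have [N0 hN0] := avS m c _ m0 e0.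
    by exists N0 => n hn y; rewrite mulr0 subr0; exact: hN0.
  - have e2 : 0 < e / 2 by rewrite divr_gt0.
    have [N1 hN1] := h1 _ e2; have [N2 hN2] := h2 _ e2.
    exists (maxn N1 N2) => n; rewrite geq_max => /andP[n1 n2] y.
    rewrite big_split /= expectD; [|exact: bt|exact: bt].
    rewrite mulrDr opprD addrACA (splitr e) mulrDl.
    by rewrite (le_trans (ler_normD _ _)) // lerD // ?hN1 ?hN2.
  - have e2 : 0 < e / (1 + `|a|) by rewrite divr_gt0 // ltr_pwDl.
    have [N1 hN1] := h _ e2; exists N1 => n hn y.
    rewrite -mulr_sumr expectZ; last exact: bt.
    rewrite mulrCA -mulrBr normrM.
    apply: (@le_trans _ _ (`|a| * (e / (1 + `|a|) * n%:R))); first by rewrite ler_wpM2l // hN1.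
    rewrite mulrA ler_wpM2r // mulrA ler_pdivrMr ?ltr_pwDl // mulrC ler_wpM2l ?ltW //.
    by rewrite ltr_pwDl.
move=> fc e0; have e3 : 0 < e / 3 by rewrite divr_gt0.
have [g tg hg] := trig_dense fc e3.
have [N0 hN0] := T g tg _ e3; exists N0 => n hn y.
have h1 := hN0 n hn y.
have bf := bmeas_torus fc.
have h2 : `|expect (haar R d) f - expect (haar R d) g| <= e / 3.
  rewrite -expectB //; last exact: bt.
  apply: expect_norm => //; under eq_fun do rewrite -mulN1r.
  by apply: bmeasD => //; apply: bmeasZ; exact: bt.
have h3 : `|\sum_(i < n) f (iter i S y) - \sum_(i < n) g (iter i S y)| <= e / 3 * n%:R.
  rewrite -sumrB (le_trans (ler_norm_sum _ _ _)) //.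
  have -> : e / 3 * n%:R = \sum_(i < n) (e / 3) by rewrite sumr_const card_ord mulr_natr.
  by apply: ler_sum => i _; exact: hg.
have h4 : `|n%:R * expect (haar R d) f - n%:R * expect (haar R d) g| <= e / 3 * n%:R.
  by rewrite -mulrBr normrM normr_nat mulrC ler_wpM2r.
move: h1 h3 h4; set x1 := \sum_(i < n) f _; set x2 := \sum_(i < n) g _.
set x3 := n%:R * expect (haar R d) f; set x4 := n%:R * expect (haar R d) g; rewrite !ler_norml.
move=> /andP[a1 a2] /andP[a3 a4] /andP[a5 a6]; apply/andP; split; lra.
Qed.

Section unipotent.
Variables (R : realType) (d : nat) (N : 'M[int]_d) (al : 'rV[R]_d).
Let A := 1%:M + N.

Fixpoint mpow (j : nat) (m : 'rV[int]_d) : 'rV[int]_d :=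
  if j is j'.+1 then mpow j' m *m N^T else m.

Fixpoint lift_orbit (u : 'rV[R]_d) (n : nat) : 'rV[R]_d :=
  if n is n'.+1 then lift_orbit u n' *m rmx R A + al else u.

Lemma iter_aff u n : iter n (aff A al) (tproj u) = tproj (lift_orbit u n).
Proof. by elim: n => // n IH; rewrite iterS IH aff_proj. Qed.

(** One difference along u -> u (1 + N) + al replaces the frequency [m] by [m *m N^T], up to a
    constant. When the next iterate vanishes, only the constant [dotp (mpow j m) al] remains. *)
Lemma phase_lift_orbit m c u j : mpow j.+1 m = 0 ->
  phase j.+1 (dotp (mpow j m) al) (fun n => dotp m (lift_orbit u n) + c).
Proof.
have E i (b : R) n : exists b' : R, iter i (@dif R) (fun n => dotp m (lift_orbit u n) + b) n =
    dotp (mpow i m) (lift_orbit u n) + b' /\ forall n,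
    iter i (@dif R) (fun n => dotp m (lift_orbit u n) + b) n =
    dotp (mpow i m) (lift_orbit u n) + b'.
  elim: i n => [|i IH] n; first by exists b.
  have [b' [_ hb']] := IH 0%N.
  have h n' : iter i.+1 (@dif R) (fun n => dotp m (lift_orbit u n) + b) n' =
      dotp (mpow i.+1 m) (lift_orbit u n') + dotp (mpow i m) al.
    rewrite iterS /dif !hb' /= -dotp_mul rmxD rmx1 mulmxDr mulmx1 !dotpD; ring.
  by exists (dotp (mpow i m) al).
move=> mj n; have [b' [_ hb']] := E j c 0%N.
rewrite iterS /dif !hb' /= rmxD rmx1 mulmxDr mulmx1 !dotpD dotp_mul.
by rewrite (_ : mpow j m *m N^T = 0) ?dotp0l //; ring.
Qed.

Hypothesis Nnil : exists k, forall m : 'rV[int]_d, mpow k m = 0.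
Hypothesis al_irr : forall m : 'rV[int]_d, m != 0 -> m *m N^T = 0 -> irr (dotp m al).

Lemma mpow_last m : m != 0 -> exists j, mpow j.+1 m = 0 /\ mpow j m != 0.
Proof.
move=> m0; have [k hk] := Nnil; have ex : exists j, mpow j m == 0 by exists k; rewrite hk.
case: (ex_minnP ex) => -[|j] /eqP h1 h2.
  by move: m0; rewrite -[m]/(mpow 0 m) h1 eqxx.
exists j; split => //; apply/negP => h; have := h2 _ h; by rewrite ltnn.
Qed.

Lemma tchar_uniform_average m c (e : R) : m != 0 -> 0 < e -> exists N0 : nat, forall n, (N0 <= n)%N ->
  forall y, `|\sum_(i < n) tchar m c (iter i (aff A al) y)| <= e * n%:R.
Proof.
move=> m0 e0; have [j [mj1 mj]] := mpow_last m0.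
have [N0 hN0] := weyl_sum j (al_irr mj mj1) e0.
exists N0 => n hn y; have := hN0 n hn _ (phase_lift_orbit c (tval y) mj1).
by under eq_bigr do rewrite -tchar_proj -iter_aff tproj_val.
Qed.

Lemma uniform_average (f : torus R d -> R) (e : R) : continuous f -> 0 < e ->
  exists N0 : nat, forall n, (N0 <= n)%N ->
  forall y, `|\sum_(i < n) f (iter i (aff A al) y) - n%:R * expect (haar R d) f| <= e * n%:R.
Proof. exact: (average_of_chars tchar_uniform_average). Qed.

End unipotent.

(** * Almost commuting shears *)

Section steering.
Variables (R : realType) (d : nat) (i0 : 'I_d).
Implicit Types (N : 'M[R]_d) (v : 'rV[R]_d).

(** A trajectory of 1 + N driven by the constant control [e]. *)
Fixpoint pushed N v e (n : nat) : 'rV[R]_d :=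
  if n is n'.+1 then pushed N v e n' *m (1%:M + N) + e else v.

Lemma pushed_bound N (K c : R) n : 0 <= K -> 0 <= c -> exists2 B, 0 <= B &
  forall v e, `|v| <= K -> `|e| <= c -> forall j, (j <= n)%N -> `|pushed N v e j| <= B.
Proof.
move=> K0 c0; elim: n => [|n [B B0 hB]].
  by exists K => // v e hv he j; rewrite leqn0 => /eqP ->.
have b0 : 0 <= mx_bound (1%:M + N) by exact: mx_bound_ge0.
exists (B + (mx_bound (1%:M + N) * B + c)).
  by rewrite addr_ge0 // addr_ge0 // mulr_ge0.
move=> v e hv he j; rewrite leq_eqVlt => /orP[/eqP ->|jn]; last first.
  rewrite (le_trans (hB v e hv he j jn)) // lerDl addr_ge0 //; exact: mulr_ge0.
rewrite /= (le_trans (ler_normD _ _)) // (le_trans (lerD (mulmx_norm _ _) he)) //.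
have := ler_wpM2l b0 (hB v e hv he n (leqnn n)); lra.
Qed.

(* A constant push [-v/M] brings [v] from the kernel of [N^(s+1)] into that of [N^s] in [M] steps. *)
Lemma steer N s (K e : R) : 0 < e -> 0 <= K -> (forall j, N j i0 = 0) ->
  exists M P, 0 <= P /\ forall v, `|v| <= K -> iter s (mulmx^~ N) v = 0 -> v 0 i0 = 0 ->
  exists p : nat -> 'rV[R]_d, [/\ p 0%N = v, forall j, (M <= j)%N -> p j = 0,
    forall j, `|p j| <= P, forall j, p j 0 i0 = 0 &
    forall j, `|p j.+1 - p j *m (1%:M + N)| <= e].
Proof.
move=> e0 K0 Ni0; elim: s K K0 => [|s IH] K K0.
  exists 0%N, 0; split=> // v _ /= -> _; exists (fun=> 0); split => // j; rewrite ?normr0 ?mxE //.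
  by rewrite mul0mx subr0 normr0 ltW.
pose M1 := (Num.truncn (K / e)).+1.
have M1e : K <= e * M1%:R.
  by rewrite mulrC -ler_pdivrMr // ltW // truncnS_gt.
have [B B0 hB] := pushed_bound N M1 K0 (ltW e0).
have [M2 [P [P0 h2]]] := IH B B0.
exists (M1 + M2)%N, (B + P); split; first exact: addr_ge0.
move=> v vK vN vi0; pose c := - (M1%:R^-1 *: v).
have ce : `|c| <= e.
  rewrite normrN normrZ ger0_norm ?invr_ge0 // mulrC ler_pdivrMr ?ltr0n //.
  exact: le_trans M1e.
have itD n (u w : 'rV[R]_d) : iter n (mulmx^~ N) (u + w) = iter n (mulmx^~ N) u + iter n (mulmx^~ N) w.
  by elim: n => // n IHn; rewrite !iterS IHn mulmxDl.
have itZ n a (u : 'rV[R]_d) : iter n (mulmx^~ N) (a *: u) = a *: iter n (mulmx^~ N) u.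
  by elim: n => // n IHn; rewrite !iterS IHn scalemxAl.
have cE n : iter n (mulmx^~ N) c = - (M1%:R^-1 *: iter n (mulmx^~ N) v).
  by rewrite /c -scaleNr itZ scaleNr.
have pN n : iter s.+1 (mulmx^~ N) (pushed N v c n) = 0.
  elim: n => // n IHn; rewrite [pushed _ _ _ _]/= mulmxDr mulmx1 !itD cE vN scaler0 oppr0 addr0.
  by rewrite IHn add0r -iterSr iterS IHn mul0mx.
(* The part of the vector seen by N^s decreases linearly and is gone at time [M1]. The bound [B] on
   the trajectory does not depend on [v], so the next stage is prepared for all [v] at once. *)
have pN' n : iter s (mulmx^~ N) (pushed N v c n) = (1 - n%:R / M1%:R) *: iter s (mulmx^~ N) v.
  elim: n => [|n IHn]; first by rewrite mul0r subr0 scale1r.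
  rewrite [pushed _ _ _ _]/= mulmxDr mulmx1 !itD cE -[iter s _ (_ *m N)]iterSr pN addr0 IHn.
  rewrite -scalerBl; congr (_ *: _); rewrite -[n.+1%:R]natr1 mulrDl mul1r; ring.
have pi n : pushed N v c n 0 i0 = 0.
  elim: n => //= n IHn; rewrite mulmxDr mulmx1 !mxE IHn vi0 mulr0 oppr0 addr0 add0r.
  by rewrite big1 // => j _; rewrite Ni0 mulr0.
have pM : iter s (mulmx^~ N) (pushed N v c M1) = 0.
  by rewrite pN' divff ?subrr ?scale0r // pnatr_eq0.
have [p [p0 pz pP pi0 pe]] := h2 _ (hB v c vK ce M1 (leqnn _)) pM (pi M1).
exists (fun j => if (j < M1)%N then pushed N v c j else p (j - M1)%N); split => //.
- move=> j hj; have -> : (j < M1)%N = false by lia.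
  by apply: pz; lia.
- move=> j; case: ifPn => [hj|_].
    by rewrite (le_trans (hB v c vK ce j (ltnW hj))) // lerDl.
  by rewrite (le_trans (pP _)) // lerDr.
- by move=> j; case: ifP.
- move=> j; case: (ltnP j M1) => hj.
    have -> : (if (j.+1 < M1)%N then pushed N v c j.+1 else p (j.+1 - M1)%N) = pushed N v c j.+1.
      case: ifPn => // h; have -> : j.+1 = M1 by lia.
      by rewrite subnn p0.
    by rewrite /= addrAC subrr add0r.
  have -> : (j.+1 < M1)%N = false by lia.
  by rewrite subSn.
Qed.

(** The way out is a steering path for the inverse matrix 1 + N', run backwards; reversal multiplies
    its errors by the norm of 1 + N, hence the finer accuracy asked of it. The way back is [steer]
    for 1 + N itself. *)
Lemma round_trip N N' s (K e : R) : 0 < e -> 0 <= K ->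
  (1%:M + N') *m (1%:M + N) = 1%:M ->
  (forall j, N j i0 = 0) -> (forall j, N' j i0 = 0) ->
  (forall v, iter s (mulmx^~ N) v = 0) -> (forall v, iter s (mulmx^~ N') v = 0) ->
  exists M P, 0 <= P /\ forall v, `|v| <= K -> v 0 i0 = 0 ->
  exists p : nat -> 'rV[R]_d, [/\ p 0%N = 0 /\ p M = v, forall j, (M.*2 <= j)%N -> p j = 0,
    forall j, `|p j| <= P, forall j, p j 0 i0 = 0 &
    forall j, `|p j.+1 - p j *m (1%:M + N)| <= e].
Proof.
move=> e0 K0 NN Ni Ni' Ns Ns'.
have b0 : 0 <= mx_bound (1%:M + N) by exact: mx_bound_ge0.
have e1 : 0 < e / (mx_bound (1%:M + N) + 1) by rewrite divr_gt0 //; lra.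
have [M1 [P1 [P10 h1]]] := steer s e0 K0 Ni.
have [M2 [P2 [P20 h2]]] := steer s e1 K0 Ni'.
exists (M1 + M2)%N, (P1 + P2); split; first exact: addr_ge0.
move=> v vK vi; have [p [p0 pz pP pi pe]] := h1 v vK (Ns v) vi.
have [q [q0 qz qP qi qe]] := h2 v vK (Ns' v) vi.
set M := (M1 + M2)%N.
exists (fun j => if (j <= M)%N then q (M - j)%N else p (j - M)%N); split.
- by rewrite leqnn subnn; split=> //; rewrite /= qz //; lia.
- move=> j hj; case: ifPn => h; last by apply: pz; lia.
  by apply: qz; lia.
- move=> j; case: ifPn => _; first by rewrite (le_trans (qP _)) // lerDr.
  by rewrite (le_trans (pP _)) // lerDl.
- by move=> j; case: ifP.
- move=> j; case: (ltnP j M) => hj.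
    rewrite (ltnW hj) -(subnSK hj); set i := (M - j.+1)%N.
    have -> : q i - q i.+1 *m (1%:M + N) = - ((q i.+1 - q i *m (1%:M + N')) *m (1%:M + N)).
      by rewrite mulmxBl -mulmxA NN mulmx1 opprB.
    rewrite normrN (le_trans (mulmx_norm _ _)) //.
    rewrite (le_trans (ler_wpM2l b0 (qe i))) // mulrCA ger_pMr //.
    by rewrite ler_pdivrMr; lra.
  have -> : (if (j <= M)%N then q (M - j)%N else p (j - M)%N) = p (j - M)%N.
    case: ifPn => // h; have -> : j = M by lia.
    by rewrite subnn p0.
  by rewrite subSn.
Qed.

End steering.

(** * Bump profiles on the circle *)

Section tent_profile.
Variable R : realType.
Implicit Types s t : R.

Definition tent (r t : R) : R := Num.max 0 (1 - dZ t / r).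

Lemma tent_0 r m : tent r m%:~R = 1.
Proof. by rewrite /tent dZ_int mul0r subr0 max_r. Qed.

Lemma tent_01 r t : 0 < r -> 0 <= tent r t <= 1.
Proof.
move=> r0; rewrite /tent le_max lexx /= ge_max ler01 /= gerBl.
by rewrite divr_ge0 ?dZ_ge0 // ltW.
Qed.

Lemma tent_far r t : 0 < r -> r <= dZ t -> tent r t = 0.
Proof. by move=> r0 h; rewrite /tent max_l // subr_le0 ler_pdivlMr // mul1r. Qed.

Lemma tent_lip r s t : 0 < r -> `|tent r s - tent r t| <= dZ (s - t) / r.
Proof.
move=> r0; apply: (@le_trans _ _ `|(dZ s - dZ t) / r|); last first.
  have r1 : 0 <= r^-1 by rewrite invr_ge0 ltW.
  by rewrite normrM [`|r^-1|]ger0_norm // ler_wpM2r // dZB.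
rewrite mulrBl /tent; set a := dZ s / r; set b := dZ t / r.
rewrite /Num.max; do 2 case: ltP => ?; rewrite ler_norml; apply/andP; split;
  have := ler_norm (a - b); have := ler_norm (b - a); rewrite [`|b - a|]distrC; lra.
Qed.

Lemma fin_lower (I : finType) (f : I -> R) : (forall i, 0 < f i) ->
  exists2 c, 0 < c & forall i, c <= f i.
Proof.
move=> h; pose S := \sum_i (f i)^-1 + 1.
have S0 : 0 < S by rewrite ltr_wpDl // sumr_ge0 // => i _; rewrite invr_ge0 ltW.
exists S^-1; first by rewrite invr_gt0.
move=> i; rewrite -[f i]invrK lef_pV2 ?posrE ?invr_gt0 //.
rewrite /S (bigD1 i) //= -addrA lerDl addr_ge0 // sumr_ge0 // => j _.
by rewrite invr_ge0 ltW.
Qed.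

Variables (d : nat) (I : finType) (pos : I -> R) (r : R).
Hypotheses (r0 : 0 < r) (sep : forall i j, i != j -> 2 * r <= dZ (pos i - pos j)).

(** Separation of the positions by [2 * r] makes the tents disjoint, so at each [t] at most one
    vector contributes. *)
Definition bumps (p : I -> 'rV[R]_d) (t : R) : 'rV[R]_d := \sum_i tent r (t - pos i) *: p i.

Lemma bumps_single t i j : i != j -> tent r (t - pos i) != 0 -> tent r (t - pos j) = 0.
Proof.
move=> ij h; apply: tent_far => //; rewrite leNgt; apply: contra h => h; apply/eqP.
apply: tent_far => //; have := sep ij; have := dZD (pos i - t) (t - pos j).
rewrite subrKA -(opprB t (pos i)) dZN; lra.
Qed.

Lemma bumps_norm p (e : R) t : 0 <= e -> (forall i, `|p i| <= e) -> `|bumps p t| <= e.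
Proof.
move=> e0 hp; have [[i hi]|hn] := pselect (exists i, tent r (t - pos i) != 0).
  rewrite /bumps (bigD1 i) //= big1 => [|j ji].
    have /andP[b0 b1] := tent_01 (t - pos i) r0.
    rewrite addr0 normrZ ger0_norm // (le_trans _ (hp i)) // ler_piMl //.
  by rewrite (@bumps_single t i j) ?scale0r // eq_sym.
rewrite /bumps big1 ?normr0 // => i _; case: (eqVneq (tent r (t - pos i)) 0) => [->|h].
  by rewrite scale0r.
by case: hn; exists i.
Qed.

Lemma bumps_pos p i : bumps p (pos i) = p i.
Proof.
have b1 : tent r (pos i - pos i) = 1 by rewrite subrr -(mulr0z 1) tent_0.
rewrite /bumps (bigD1 i) //= big1 => [|j ji]; first by rewrite b1 scale1r addr0.
by rewrite (@bumps_single _ i j) ?scale0r ?b1 ?oner_eq0 // eq_sym.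
Qed.

Lemma bumps_far p t : (forall i, r <= dZ (t - pos i)) -> bumps p t = 0.
Proof.
by move=> h; rewrite /bumps big1 // => i _; rewrite tent_far ?scale0r.
Qed.

Lemma bumps_lip p (P : R) : (forall i, `|p i| <= P) -> forall s t,
  `|bumps p s - bumps p t| <= (#|I|%:R * P / r) * dZ (s - t).
Proof.
move=> hp s t; rewrite -sumrB (le_trans (ler_norm_sum _ _ _)) //.
apply: (@le_trans _ _ (\sum_(i in I) (P / r * dZ (s - t)))); last first.
  by rewrite sumr_const -[X in X <= _]mulr_natl !mulrA.
apply: ler_sum => i _; rewrite -scalerBl normrZ.
have := tent_lip (s - pos i) (t - pos i) r0.
rewrite opprB addrA subrK => h; rewrite mulrC.
apply: (le_trans (ler_pM (normr_ge0 _) (normr_ge0 _) (hp i) h)).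
by rewrite mulrA mulrAC.
Qed.

End tent_profile.

Lemma bmeas_lipschitz (R : realType) d d' (f : torus R d -> torus R d') (g : torus R d' -> R) :
  lipschitz f -> bmeas (g : borel (torus R d') -> R) -> bmeas (g \o f : borel (torus R d) -> R).
Proof.
move=> lf bg.
exact: (@bmeas_comp _ _ (borel (torus R d)) (borel (torus R d')) R f g (measurable_lipschitz lf) bg).
Qed.

Section shears.
Variables (R : realType) (d : nat) (i0 : 'I_d).
Implicit Types (y : torus R d) (W : R -> 'rV[R]_d).

Definition haar_iso (h h' : torus R d -> torus R d) : Prop :=
  [/\ lipschitz h, lipschitz h', cancel h h', cancel h' h &
      forall A, borel_set A -> haar R d (h @^-1` A) = haar R d A].

Lemma tdist_shift2 v w x y : tdist (tshift v x) (tshift w y) <= `|v - w| + tdist x y.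
Proof.
apply: le_trans (tdist_triangle (tshift w x) _ _) _.
apply: lerD; first exact: tdist_shift.
rewrite /tshift tdist_projE opprD addrACA subrr addr0.
by rewrite -tdist_projE !tproj_val.
Qed.

Definition shear W y := tshift (W (tval y 0 i0)) y.

(** The Lipschitz bound in the distance modulo 1 makes [W] periodic; the vanishing entry makes the
    shear keep its base coordinate, so that - W undoes it. *)
Definition profile (L : R) W : Prop :=
  (forall s t, `|W s - W t| <= L * dZ (s - t)) /\ (forall t, W t 0 i0 = 0).

Lemma profile_mod L W s t : profile L W -> s - t \is a Num.int -> W s = W t.
Proof.
move=> [hL _]; rewrite -dZ_eq0 => /eqP h; have := hL s t.
by rewrite h mulr0 normr_le0 subr_eq0 => /eqP.
Qed.

Lemma profileN L W : profile L W -> profile L (fun t => - W t).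
Proof.
move=> [h1 h2]; split => [s t|t]; last by rewrite mxE h2 oppr0.
by rewrite -opprD normrN.
Qed.

Lemma shear_proj L W u : profile L W -> shear W (tproj u) = tproj (u + W (u 0 i0)).
Proof.
move=> hW; rewrite /shear tshift_proj; congr (tproj (_ + _)).
apply: (profile_mod hW); have /intvP h := tval_proj u.
by have := h i0; rewrite !mxE.
Qed.

Lemma shear_lipschitz L W : 0 <= L -> profile L W -> forall x y,
  tdist (shear W x) (shear W y) <= (1 + L) * tdist x y.
Proof.
move=> L0 [hL _] x y; apply: le_trans (tdist_shift2 _ _ _ _) _.
rewrite mulrDl mul1r addrC lerD2l (le_trans (hL _ _)) // ler_wpM2l //.
exact: tdist_entry.
Qed.

Lemma shearK L W : profile L W -> cancel (shear W) (shear (fun t => - W t)).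
Proof.
move=> hW y; rewrite -[y in shear W y]tproj_val (shear_proj _ hW) (shear_proj _ (profileN hW)).
by rewrite !mxE hW.2 addr0 addrK tproj_val.
Qed.

(** If the character involves a coordinate [j] other than [i0], a translation of that coordinate by
    half a period changes its sign and commutes with the shear; otherwise the character depends on
    the base coordinate alone and the shear does not change it. *)
Lemma shear_haar L W A : 0 <= L -> profile L W -> borel_set A ->
  haar R d (shear W @^-1` A) = haar R d A.
Proof.
move=> L0 hW; have lS : lipschitz (shear W).
  by exists (1 + L); [rewrite addr_ge0|exact: shear_lipschitz].
apply: haar_preserved; first exact: measurable_lipschitz.
move=> m c m0.
have E x : (tchar m c \o shear W) x = tchar m (dotp m (W (tval x 0 i0)) + c) x.
  by rewrite /= tchar_shift.
have [[j jm]|hm] := pselect (exists j, (j != i0) && (m 0 j != 0)); last first.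
  rewrite (_ : _ \o _ = tchar m c) ?haar_char //; apply/funext => x; rewrite E.
  rewrite (_ : dotp m _ = 0) ?add0r // /dotp big1 // => j _.
  have [->|ji] := eqVneq j i0; first by rewrite hW.2 mulr0.
  have [->|mj] := eqVneq (m 0 j) 0; first by rewrite mul0r.
  by case: hm; exists j; rewrite ji.
move: jm => /andP[ji mj].
have mj' : (m 0 j)%:~R != 0 :> R by rewrite intr_eq0.
pose v : 'rV[R]_d := (2 * (m 0 j)%:~R)^-1 *: delta_mx 0 j.
have vi : v 0 i0 = 0 by rewrite !mxE eqxx /= [i0 == j]eq_sym (negbTE ji) mulr0.
have mv : dotp m v = 2^-1.
  rewrite /dotp (bigD1 j) //= big1 => [|i ij]; last first.
    by rewrite !mxE eqxx /= (negbTE ij) !mulr0.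
  by rewrite !mxE !eqxx /= mulr1 addr0 invfM mulrCA mulfV // mulr1.
apply: (@expect_antisym _ _ v).
  by apply: bmeas_lipschitz => //; exact: bmeas_tchar.
move=> x; rewrite -[x]tproj_val tshift_proj /=.
rewrite !(shear_proj _ hW) !tchar_proj [(_ + v) 0 i0]mxE vi addr0.
by rewrite -tc_half; congr tc; rewrite !dotpD mv; ring.
Qed.

Lemma shear_iso L W : 0 <= L -> profile L W -> haar_iso (shear W) (shear (fun t => - W t)).
Proof.
move=> L0 hW; split.
- by exists (1 + L); [rewrite addr_ge0|exact: shear_lipschitz].
- by exists (1 + L); [rewrite addr_ge0|exact: shear_lipschitz (profileN hW)].
- exact: shearK hW.
- have := shearK (profileN hW); rewrite (_ : (fun t => - - W t) = W) //.
  by apply/funext => t; rewrite opprK.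
- by move=> A bA; exact: (shear_haar L0 hW).
Qed.

(* The base coordinate [i0] evolves autonomously, as a rotation by [al 0 i0]. *)
Lemma shear_aff (N : 'M[int]_d) (al : 'rV[R]_d) L W (e : R) : (forall j, N j i0 = 0) -> profile L W ->
  (forall t, `|W (t + al 0 i0) - W t *m rmx R (1%:M + N)| <= e) -> forall y,
  tdist (shear W (aff (1%:M + N) al y)) (aff (1%:M + N) al (shear W y)) <= e.
Proof.
move=> Ni hW he y; rewrite -[y]tproj_val aff_proj (shear_proj _ hW).
rewrite (shear_proj _ hW) aff_proj mulmxDl.
set u := tval y.
have -> : (u *m rmx R (1%:M + N) + al) 0 i0 = u 0 i0 + al 0 i0.
  rewrite rmxD rmx1 mulmxDr mulmx1 !mxE big1 ?addr0 // => j _.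
  by rewrite mxE Ni mulr0.
apply: le_trans (tdist_proj_le _ _) _.
rewrite (_ : _ - _ = W (u 0 i0 + al 0 i0) - W (u 0 i0) *m rmx R (1%:M + N)); first exact: he.
by rewrite [_ + W (u 0 i0) *m _ + al]addrAC opprD addrACA subrr add0r.
Qed.

Definition slab (r s : R) : set (torus R d) := [set y | dZ (tval y 0 i0 - s) < r].

Lemma slab_open r s : open (slab r s).
Proof.
pose f (y : torus R d) : R := dZ (tval y 0 i0 - s).
have fc : continuous f.
  apply/ball_continuousP => x e e0; exists e => // y; rewrite torus_ballE /ball /= => h.
  apply: le_lt_trans (dZB _ _) _; rewrite opprB addrA subrK.
  exact: le_lt_trans (tdist_entry _ _ _) h.
by move/continuousP: fc => /(_ [set z | z < r]); apply; exact: open_lt.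
Qed.

(* A slab of width less than [1/q] has [q] disjoint translates. *)
Lemma slab_small (e : R) : 0 < e -> exists2 r0 : R, 0 < r0 & forall r s, r <= r0 ->
  (haar R d (slab r s) <= e%:E)%E.
Proof.
move=> e0; pose q := (Num.truncn e^-1).+1.
have q0 : 0 < q%:R :> R by rewrite ltr0n.
have qe : q%:R^-1 <= e.
  by rewrite -[e]invrK lef_pV2 ?posrE ?invr_gt0 // ltW // truncnS_gt.
exists (2 * q%:R)^-1; first by rewrite invr_gt0 mulr_gt0.
move=> r s hr; set E := slab r s.
have bE : borel_set E by apply: borel_open; exact: slab_open.
pose g : torus R d -> R := \1_E.
have bg : bmeas (g : borel (torus R d) -> R) by exact: bmeas_indic.
pose v (j : nat) : 'rV[R]_d := (j%:R / q%:R) *: delta_mx 0 i0.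
have bgv j : bmeas (g \o tshift (v j) : borel (torus R d) -> R).
  by apply: bmeas_lipschitz => //; exact: tshift_lipschitz.
have S1 : expect (haar R d) (fun y => \sum_(j < q) (g \o tshift (v j)) y) <= 1.
  rewrite -(expect_cst (haar R d) 1) -subr_ge0 -expectB; [|exact: bmeas_cst|exact: bmeas_sum].
  apply: expect_ge0 => y; rewrite subr_ge0.
  have [[j hj]|hn] := pselect (exists j : 'I_q, E (tshift (v j) y)); last first.
    rewrite big1 ?ler01 // => j _; rewrite /= /g indicE memNset // => h.
    by apply: hn; exists j.
  rewrite (bigD1 j) //= big1 ?addr0 => [|i ij].
    by rewrite /g indicE lern1 leq_b1.
  rewrite /g indicE memNset // => hi.
  have F k : E (tshift (v k) y) -> dZ (tval y 0 i0 + k%:R / q%:R - s) < r.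
    rewrite /E /slab /=; congr (_ < _).
    have /intvP/(_ i0) := tval_proj (tval y + v k); rewrite !mxE !eqxx mulr1 => /intrP[z hz].
    rewrite -[RHS](dZDz _ z) -hz; congr dZ; rewrite /tshift; ring.
  have := dZD (tval y 0 i0 + i%:R / q%:R - s) (- (tval y 0 i0 + j%:R / q%:R - s)).
  rewrite dZN opprB addrA subrK; have hi' := F i hi; have hj' := F j hj.
  rewrite opprD addrACA subrr add0r -mulrBl => h.
  have [z hz] := dZ_ex ((i%:R - j%:R) / q%:R : R).
  have : 1 / q%:R <= dZ ((i%:R - j%:R) / q%:R : R).
    rewrite hz ler_pdivrMr // -[X in _ * X]ger0_norm // -normrM mulrBl divfK ?gt_eqF //.
    rewrite -[i%:R]/((i : int)%:~R) -[j%:R]/((j : int)%:~R) -[q%:R]/((q : int)%:~R).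
    rewrite -intrM -!intrB -intr_norm (ler_int _ 1) -gtz0_ge1 normr_gt0.
    apply: contra ij => /eqP h0; apply/eqP/val_inj.
    have iq := ltn_ord i; have jq := ltn_ord j; clear -h0 iq jq => /=.
    have [z1|[z1|z1]] : (z <= -1)%R \/ z = 0 \/ (1 <= z)%R by lia.
    - have : z * (q : int) <= - 1 * (q : int) by rewrite ler_wpM2r.
      lia.
    - move: h0; rewrite z1 mul0r; lia.
    - have : 1 * (q : int) <= z * (q : int) by rewrite ler_wpM2r.
      lia.
  have : 1 / q%:R = (2 * q%:R)^-1 + (2 * q%:R)^-1 :> R by rewrite invfM; lra.
  lra.
have S2 : q%:R * fine (haar R d E) <= 1.
  move: S1; rewrite expect_sum //.
  under eq_bigr do rewrite expect_shift //.
  by rewrite sumr_const card_ord expect_indic // -[X in X <= _]mulr_natl.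
have fE : haar R d E = (fine (haar R d E))%:E by rewrite fineK // fin_num_measure.
by rewrite fE lee_fin (le_trans _ qe) // -[_^-1]mul1r ler_pdivlMr // mulrC.
Qed.

End shears.

Lemma haar_iso_comp (R : realType) d (h1 h1' h2 h2' : torus R d -> torus R d) :
  haar_iso h1 h1' -> haar_iso h2 h2' -> haar_iso (h1 \o h2) (h2' \o h1').
Proof.
move=> [l1 l1' c1 c1' p1] [l2 l2' c2 c2' p2]; split.
- exact: lipschitz_comp.
- exact: lipschitz_comp.
- exact: can_comp.
- exact: can_comp.
- move=> A bA; rewrite comp_preimage p2 ?p1 //.
  rewrite -[_ @^-1` _]setTI; exact: (measurable_lipschitz l1).
Qed.

Section profiles.
Variables (R : realType) (d : nat) (i0 : 'I_d) (N N' : 'M[int]_d) (g : R).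
Let A := 1%:M + N.
Hypotheses (AV : (1%:M + N') *m A = 1%:M) (Ni : forall j, N j i0 = 0) (Ni' : forall j, N' j i0 = 0).
Hypothesis Nnil : exists s, (forall v : 'rV[R]_d, iter s (mulmx^~ (rmx R N)) v = 0) /\
  (forall v : 'rV[R]_d, iter s (mulmx^~ (rmx R N')) v = 0).
Hypothesis irr_g : irr g.

Lemma irr_int (z : int) : z != 0 -> z%:~R * g \isn't a Num.int.
Proof.
case: z => [[|n]|n] // _; first exact: irr_g.
by rewrite NegzE mulrNz mulNr rpredN; exact: irr_g.
Qed.

Lemma measure_bigcup_seq (I : eqType) (s : seq I) (U : I -> set (torus R d)) (e : R) :
  (forall i, borel_set (U i)) -> (forall i, (haar R d (U i) <= e%:E)%E) ->
  borel_set [set y | exists2 i, i \in s & U i y] /\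
  (haar R d [set y | exists2 i, i \in s & U i y] <= ((size s)%:R * e)%:E)%E.
Proof.
move=> bU hU; elim: s => [|i s [b1 h1]].
  rewrite (_ : [set _ | _] = set0); last by apply/seteqP; split => // y [].
  by rewrite measure0 mul0r; split => //; exact: measurable0.
rewrite (_ : [set _ | _] = U i `|` [set y | exists2 i, i \in s & U i y]).
  split; first exact: (@measurableU _ (borel (torus R d)) _ _ (bU i) b1).
  apply: le_trans (measureU2 _ (bU i) b1) _.
  rewrite /= -[X in (X * e)%:E]natr1 mulrDl mul1r addrC EFinD.
  by apply: leeD => //; exact: hU.
apply/seteqP; split => y /=.
  by move=> [j]; rewrite inE => /orP[/eqP ->|js] Uj; [left|right; exists j].
by move=> [Ui|[j js Uj]]; [exists i; rewrite ?mem_head|exists j; rewrite ?inE ?js ?orbT].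
Qed.

(** Tents along the orbit t + (j - M) g carry the [round_trip] vectors p_j. Rotation by g passes
    from one tent to the next, so almost commutation is the increment bound on p; irrationality
    keeps the positions distinct modulo 1. [M] depends on [e] alone and [L] not on [v], which lets
    the perturbation lemma fix the travel time and the displacements later. *)
Lemma profile_exists (e : R) : 0 < e -> exists M : nat, forall t s : bool -> R,
  (forall z : int, t true - t false + z%:~R * g \isn't a Num.int) ->
  (forall l l' (z : int), `|z| <= (M : int) -> t l + z%:~R * g - s l' \isn't a Num.int) ->
  exists2 L, 0 <= L & forall v : bool -> 'rV[R]_d,
  (forall l, `|v l| <= 1) -> (forall l, v l 0 i0 = 0) ->
  exists W, [/\ profile i0 L W, forall u, `|W (u + g) - W u *m rmx R A| <= e,
    forall l, W (t l) = v l, forall l, W (s l) = 0 &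
    exists U, [/\ borel_set U, (haar R d U <= e%:E)%E &
      forall y : torus R d, ~ U y -> W (tval y 0 i0) = 0]].
Proof.
move=> e0; have [sn [Ns Ns']] := Nnil.
have rA (B : 'M[int]_d) : rmx R (1%:M + B) = 1%:M + rmx R B by rewrite rmxD rmx1.
have [|||M [P [P0 hP]]] := @round_trip R d i0 (rmx R N) (rmx R N') sn 1 e e0 ler01 _ _ _ Ns Ns'.
- by rewrite -!rA -rmxM AV rmx1.
- by move=> j; rewrite mxE Ni.
- by move=> j; rewrite mxE Ni'.
exists M => t s ht hs.
pose I := (bool * 'I_(M.*2).+1)%type.
pose pos (i : I) : R := t i.1 + ((i.2 : nat) : int)%:~R * g - (M : int)%:~R * g.
have posB (i j : I) : pos i - pos j = (t i.1 - t j.1) + (((i.2 : nat) : int) - ((j.2 : nat) : int))%:~R * g.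
  by rewrite /pos intrB; ring.
have sep0 (i j : I) : i != j -> 0 < dZ (pos i - pos j).
  move=> ij; rewrite dZ_gt0 posB; case: i j ij => [[] i] [[] j] ij /=.
  - rewrite subrr add0r; apply: irr_int; apply: contra ij => /eqP h.
    by rewrite xpair_eqE eqxx /=; apply/eqP/val_inj => /=; lia.
  - exact: ht.
  - have := ht (((j : nat) : int) - ((i : nat) : int)).
    by rewrite -rpredN opprD opprB -mulNr -mulrNz opprB.
  - rewrite subrr add0r; apply: irr_int; apply: contra ij => /eqP h.
    by rewrite xpair_eqE eqxx /=; apply/eqP/val_inj => /=; lia.
have [r1 r10 hr1] : exists2 r1 : R, 0 < r1 & forall i j, i != j -> 2 * r1 <= dZ (pos i - pos j).
  have [|r1 r10 hr1] := @fin_lower R (I * I)%type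
    (fun ij => if ij.1 == ij.2 then 1 else dZ (pos ij.1 - pos ij.2) / 2).
    by move=> [a b] /=; case: eqVneq => // ab; rewrite divr_gt0 // sep0.
  exists r1 => // a b ab; have := hr1 (a, b).
  by rewrite /= (negbTE ab) ler_pdivlMr // mulrC.
have [|r2 r20 hr2] := @fin_lower R (I * bool)%type (fun il => dZ (s il.2 - pos il.1)).
  move=> [[l j] l'] /=; rewrite -dZN opprB dZ_gt0.
  have := hs l l' (((j : nat) : int) - (M : int)); rewrite /pos intrB mulrBl addrA; apply.
  have := ltn_ord j; lia.
have I0 : 0 < #|{: I}|%:R :> R.
  by rewrite ltr0n; apply/card_gt0P; exists (true, ord0).
have eI : 0 < e / #|{: I}|%:R by rewrite divr_gt0.
have [r3 r30 hr3] := @slab_small R d i0 _ eI.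
(* In turn: tents disjoint, tents away from the points [s], slabs of total measure at most [e]. *)
pose r := Num.min r1 (Num.min r2 r3).
have r0 : 0 < r by rewrite !lt_min r10 r20 r30.
have rr1 : r <= r1 by rewrite ge_min lexx.
have rr2 : r <= r2 by rewrite !ge_min lexx orbT.
have rr3 : r <= r3 by rewrite !ge_min lexx !orbT.
have sep (i j : I) : i != j -> 2 * r <= dZ (pos i - pos j).
  by move=> /hr1; apply: le_trans; rewrite ler_wpM2l.
exists (#|{: I}|%:R * P / r); first by rewrite divr_ge0 ?mulr_ge0 // ltW.
move=> v v1 vi.
have /choice[p hp] := fun l => hP (v l) (v1 l) (vi l).
pose q (i : I) := p i.1 i.2.
have qP i : `|q i| <= P by rewrite /q; have [_ _ h _ _] := hp i.1.
exists (bumps pos r q); split.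
- split; first exact: bumps_lip.
  move=> u; rewrite /bumps summxE big1 // => i _; rewrite mxE /q.
  by have [_ _ _ h _] := hp i.1; rewrite h mulr0.
- move=> u.
  (* The rotation shifts the index by one; the terms lost at the two ends vanish because the path is
     0 at times 0 and 2 M + 1. *)
  have -> : bumps pos r q (u + g) = bumps pos r (fun i => p i.1 (i.2 : nat).+1) u.
    have pB (F : I -> 'rV[R]_d) : \sum_i F i = \sum_l \sum_(j < (M.*2).+1) F (l, j).
      by rewrite pair_big /=; apply: eq_bigr => -[].
    rewrite /bumps !pB.
    apply: eq_bigr => l _; have [[p0 _] pz _ _ _] := hp l.
    rewrite big_ord_recl /q /= p0 scaler0 add0r [RHS]big_ord_recr /= pz ?scaler0 ?addr0 //.
    apply: eq_bigr => j _; congr (tent r _ *: _).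
    by rewrite /pos /= /bump /= -[((1 + j)%N : int)]/((1 : int) + (j : int)) intrD; ring.
  have -> : bumps pos r q u *m rmx R A = bumps pos r (fun i => q i *m rmx R A) u.
    by rewrite /bumps mulmx_suml; apply: eq_bigr => i _; rewrite scalemxAl.
  rewrite /bumps -sumrB; under eq_bigr do rewrite -scalerBr.
  apply: (bumps_norm r0 sep) => [|i]; first exact: ltW.
  by rewrite /q; have [_ _ _ _ h] := hp i.1; rewrite rA; exact: h.
- move=> l; have hM : (M < (M.*2).+1)%N by rewrite ltnS -addnn leq_addr.
  have -> : t l = pos (l, Ordinal hM) by rewrite /pos /= addrK.
  by rewrite (bumps_pos r0 sep); have [[_ h] _ _ _ _] := hp l.
- by move=> l; apply: (bumps_far r0) => i; rewrite (le_trans rr2) // (hr2 (i, l)).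
have bs i : borel_set (slab i0 r (pos i)) by apply: borel_open; exact: slab_open.
have [b1 h1] := @measure_bigcup_seq I (enum {: I}) (fun i => slab i0 r (pos i)) _ bs (fun i => hr3 r (pos i) rr3).
exists [set y | exists2 i, i \in enum {: I} & slab i0 r (pos i) y]; split => //.
  by rewrite (le_trans h1) // lee_fin -cardE mulrC divfK // gt_eqF.
move=> y hy; apply: (bumps_far r0) => i; rewrite leNgt; apply/negP => h.
by apply: hy; exists i => //; rewrite mem_enum.
Qed.

End profiles.

(** * The skew tower and the perturbation lemma *)

Section tower.
Variable R : realType.

(* The coordinate of index [0] is the top fibre x_(d-1); x_1 has index [d - 2] and z index [d - 1]. *)
Definition tower_mx d : 'M[int]_d := \matrix_(i, j) ((i == j.+1 :> nat) && (i.+1 < d)%N)%:R.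

Definition tower_al (a b : R) d : 'rV[R]_d :=
  \row_i (if i.+1 == d then b else if i.+2 == d then a else 0).

Lemma tower_mx_col d (i j : 'I_d) : (d <= j.+2)%N -> tower_mx d i j = 0.
Proof. by move=> h; rewrite mxE; case: eqP => //= ->; rewrite ltnNge h. Qed.

Lemma tower_nil (K : nzRingType) d (v : 'rV[K]_d) :
  iter d (mulmx^~ (map_mx (fun z : int => z%:~R) (tower_mx d))) v = 0.
Proof.
set N := map_mx _ _.
have NE (u : 'rV[K]_d) j : (u *m N) 0 j =
    \sum_(i < d | (i == j.+1 :> nat) && (i.+1 < d)%N) u 0 i.
  rewrite mxE [RHS]big_mkcond; apply: eq_bigr => i _; rewrite !mxE.
  by case: ifP => _; rewrite ?mulr1 ?mulr0.
have H s (j : 'I_d) : (d <= j + s)%N -> iter s (mulmx^~ N) v 0 j = 0.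
  elim: s j => [|s IH] j h; first by have := ltn_ord j; rewrite ltnNge -{1}[nat_of_ord j]addn0 h.
  rewrite iterS NE big1 // => i /andP[/eqP ij _]; apply: IH.
  by rewrite ij addSnnS.
by apply/rowP => j; rewrite H ?leq_addl // mxE.
Qed.

Lemma tower_mulT d (m : 'rV[int]_d) i :
  (m *m (tower_mx d)^T) 0 i = \sum_(j < d | (i == j.+1 :> nat) && (i.+1 < d)%N) m 0 j.
Proof.
rewrite mxE [RHS]big_mkcond; apply: eq_bigr => j _; rewrite !mxE.
by case: ifP => _; rewrite ?mulr1 ?mulr0.
Qed.

Lemma mpow_entry d (m : 'rV[int]_d) s (i : 'I_d) : (i < s)%N -> mpow (tower_mx d) s m 0 i = 0.
Proof.
elim: s i => // s IH i h; rewrite tower_mulT big1 // => j /andP[/eqP ij _].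
by apply: IH; rewrite -ltnS -ij.
Qed.

Lemma mpow_nil d (m : 'rV[int]_d) : mpow (tower_mx d) d m = 0.
Proof. by apply/rowP => i; rewrite mpow_entry ?ltn_ord // mxE. Qed.

Lemma iter_mulmx (K : nzRingType) d s (M : 'M[K]_d) (v : 'rV[K]_d) :
  iter s (mulmx^~ M) v = v *m (M ^+ s).
Proof.
elim: s v => [|s IH] v; first by rewrite expr0 mulmx1.
by rewrite iterS IH exprSr -mulmxA.
Qed.

Lemma rmxX d s (M : 'M[int]_d) : rmx R (M ^+ s) = rmx R M ^+ s.
Proof.
elim: s => [|s IH]; first by rewrite !expr0 rmx1.
by rewrite !exprS -IH; exact: rmxM.
Qed.

(** 1 + N' is the Neumann series inverse to 1 + N. From N' = - (1 + N') N it inherits the vanishing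
    columns of N and, since the factors commute, nilpotency. *)
Lemma tower_inv d : exists N', [/\ (1%:M + N') *m (1%:M + tower_mx d) = 1%:M,
  forall i j : 'I_d, (d <= j.+2)%N -> N' i j = 0 &
  exists s, (forall v : 'rV[R]_d, iter s (mulmx^~ (rmx R (tower_mx d))) v = 0) /\
    (forall v : 'rV[R]_d, iter s (mulmx^~ (rmx R N')) v = 0)].
Proof.
set N := tower_mx d.
have N0 : N ^+ d = 0.
  apply/row_matrixP => i; rewrite rowE -iter_mulmx row0.
  rewrite -[RHS](tower_nil (delta_mx 0 i)) (_ : map_mx _ _ = N) //.
  by apply/matrixP => a c; rewrite mxE intz.
pose B : 'M[int]_d := \sum_(i < d) (- N) ^+ i.
have AB : (1%:M + N) *m B = 1%:M.
  have := subrX1 (- N) d; rewrite exprNn N0 mulr0 sub0r -opprD mulNr => /oppr_inj h.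
  have -> : 1%:M + N = N + 1 by rewrite addrC.
  exact: esym h.
have BA := mulmx1C AB.
have BN : B - 1%:M = - (B *m N).
  by move: BA; rewrite mulmxDr mulmx1 => <-; rewrite opprD addrA subrr add0r.
have cBN : GRing.comm B N.
  have h : B *m (1%:M + N) = (1%:M + N) *m B by rewrite BA AB.
  by move: h; rewrite mulmxDr mulmxDl mulmx1 mul1mx => /addrI.
exists (B - 1%:M); rewrite addrC subrK; split => //.
  move=> i j h; rewrite BN !mxE big1 ?oppr0 // => l _.
  by rewrite tower_mx_col ?mulr0.
exists d; split=> v; first exact: tower_nil.
rewrite iter_mulmx -rmxX BN [(- _) ^+ d](_ : _ = (-1) ^+ d * (B ^+ d * N ^+ d)).
  by rewrite N0 !mulr0 /rmx map_mx0 mulmx0.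
by rewrite -exprMn_comm // -exprNn.
Qed.

(** The kernel of the dual map consists of frequencies in x_1 and z only, where [tower_al] has the
    entries a and b. *)
Lemma tower_al_irr d a b : (forall v w : int, (v != 0) || (w != 0) -> irr (v%:~R * a + w%:~R * b)) ->
  forall m : 'rV[int]_d, m != 0 -> m *m (tower_mx d)^T = 0 -> irr (dotp m (tower_al a b d)).
Proof.
move=> ab m m0 mN.
have mz (j : 'I_d) : (j.+2 < d)%N -> m 0 j = 0.
  move=> jd; have jd1 : (j.+1 < d)%N by rewrite ltnW.
  have := congr1 (fun u : 'rV_d => u 0 (Ordinal jd1)) mN.
  rewrite tower_mulT mxE (bigD1 j) /=; last by rewrite eqxx jd.
  rewrite big1 ?addr0 // => i /andP[/andP[/eqP[ij] _]].
  by rewrite (_ : i = j) ?eqxx //; apply: val_inj.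
case: d m m0 mN mz => [|[|d]] m m0 mN mz.
- by case/negP: m0; apply/eqP/rowP => -[].
- rewrite (_ : dotp _ _ = 0%:~R * a + (m 0 0)%:~R * b).
    apply: ab; rewrite eqxx /=; apply: contra m0 => /eqP h; apply/eqP/rowP => i.
    by rewrite (ord1 i) h mxE.
  by rewrite /dotp big_ord_recl big_ord0 addr0 !mxE /= mul0r add0r.
have E : dotp m (tower_al a b d.+2) = (m 0 (inord d))%:~R * a + (m 0 ord_max)%:~R * b.
  rewrite /dotp !big_ord_recr /= big1 => [|i _].
    rewrite add0r !mxE /= !eqxx ltn_eqF //.
    by congr ((m 0 _)%:~R * _ + _); apply: val_inj; rewrite /= inordK.
  by rewrite mz ?mul0r //= !ltnS.
rewrite E; apply: ab; apply: contraR m0; rewrite negb_or !negbK => /andP[/eqP h1 /eqP h2].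
apply/eqP/rowP => i; rewrite [RHS]mxE.
have [hi|] := ltnP i.+2 d.+2; first exact: mz.
rewrite !ltnS leq_eqVlt => /orP[/eqP h|h].
  by rewrite -h1; congr (m 0 _); apply: val_inj; rewrite /= inordK.
by rewrite -h2; congr (m 0 _); apply: val_inj => /=; have := ltn_ord i; lia.
Qed.

Lemma avoid_countable (C : set R) : countable C -> exists x, ~ C x.
Proof.
move=> cC; apply: contrapT => hn.
have CT : (`[0%R, 1%R] : set R) `<=` C.
  by move=> x _; apply: contrapT => hx; apply: hn; exists x.
have := countable_lebesgue_measure0 (sub_countable (subset_card_le CT) cC).
by rewrite lebesgue_measure_itv /= lte_fin ltr01 oppr0 adde0 => /eqP; rewrite eqe oner_eq0.
Qed.

Lemma irr_rat (c : R) : ~ range (@ratr R) c -> irr c.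
Proof.
move=> hc h h0; apply/negP => /intrP[z hz]; apply: hc.
exists (z%:~R / h%:R) => //; rewrite fmorph_div /= ratr_int ratr_nat -hz mulrC mulKf //.
by rewrite pnatr_eq0 -lt0n.
Qed.

(** Take a irrational and b outside the countable set Q a + Q. *)
Lemma independent_pair : exists a b : R,
  forall v w : int, (v != 0) || (w != 0) -> irr (v%:~R * a + w%:~R * b).
Proof.
have [a ha] : exists a, ~ range (@ratr R) a.
  by apply: avoid_countable; apply: (sub_countable (card_image_le _ _)); exact: countableP.
have [b hb] : exists b, ~ range (fun rs : rat * rat => ratr rs.1 * a + ratr rs.2) b.
  by apply: avoid_countable; apply: (sub_countable (card_image_le _ _)); exact: countableP.
exists a, b => v w vw; apply: irr_rat => -[q _ hq].
have [w0|w0] := eqVneq w 0.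
  move: vw hq; rewrite w0 eqxx orbF mul0r addr0 => v0 hq; apply: ha.
  exists (q / v%:~R) => //; rewrite fmorph_div /= ratr_int hq mulrC mulKf // intr_eq0 //.
apply: hb; exists (- (v%:~R / w%:~R), q / w%:~R) => //=.
have w0' : w%:~R != 0 :> R by rewrite intr_eq0.
rewrite rmorphN !fmorph_div /= !ratr_int hq; field.
by [].
Qed.

End tower.

Section generic_points.
Variable R : realType.

(* Distinct reals of this form, with [0 < c < 5] distinct, stay distinct mod 1 under any irrational rotation. *)
Definition gpt (n c : nat) (t : R) : R := ((Num.floor (n%:R * t))%:~R + c%:R / 5) / n%:R.

Lemma gpt_near n c t : (0 < n)%N -> (c <= 5)%N -> `|gpt n c t - t| <= n%:R^-1.
Proof.
move=> n0 c5; have n0' : 0 < n%:R :> R by rewrite ltr0n.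
have c5' : c%:R <= 5 :> R by rewrite (ler_nat _ c 5).
have c0 : 0 <= c%:R :> R by rewrite ler0n.
have /andP[f1 f2] := floor_itv (n%:R * t).
rewrite (_ : _ - t = ((Num.floor (n%:R * t))%:~R + c%:R / 5 - n%:R * t) / n%:R); last first.
  by rewrite /gpt; field; rewrite gt_eqF.
rewrite normrM [`|n%:R^-1|]ger0_norm ?invr_ge0 ?ler0n // ler_piMl ?invr_ge0 ?ler0n //.
move: f1 f2; rewrite intrD; set f := _%:~R; set x := n%:R * t => f1 f2.
clear -f1 f2 c5' c0; rewrite ler_norml; apply/andP; split; lra.
Qed.

Lemma gpt_generic n c c' t t' (g : R) (z : int) : (0 < n)%N ->
  (c < 5)%N -> (c' < 5)%N -> c != c' -> irr g ->
  gpt n c t - gpt n c' t' + z%:~R * g \isn't a Num.int.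
Proof.
move=> n0 c5 c5' cc ig; apply/negP => /intrP[w hw].
have n0' : n%:R != 0 :> R by rewrite pnatr_eq0 -lt0n.
set m := Num.floor (n%:R * t); set m' := Num.floor (n%:R * t').
have E : (5 * (n : int) * z)%:~R * g = (5 * (n : int) * w - 5 * (m - m') - ((c : int) - (c' : int)))%:~R.
  rewrite !(intrB, intrM, intrD) -hw /gpt -/m -/m' -![(Posz _)%:~R]/(_%:R).
  by field.
have [z0|z0] := eqVneq z 0.
  move: E; rewrite z0 mulr0 mul0r => /esym/eqP; rewrite intr_eq0 => /eqP.
  by move/eqP: cc; clear -c5 c5' => cc; lia.
have := @irr_int R g ig (5 * (n : int) * z); rewrite E intr_int => /(_ _)/negP; apply => //.
by rewrite !mulf_neq0 //; lia.
Qed.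

End generic_points.

Section key_lemma.
Variables (R : realType) (k : nat) (a b : R).
Hypothesis ab : forall v w : int, (v != 0) || (w != 0) -> irr (v%:~R * a + w%:~R * b).
Let d := k.+2.
Let N := tower_mx d.
Let al := tower_al a b d.
Let S := aff (1%:M + N) al : torus R d -> torus R d.
Let i1 : 'I_d := inord k.
Let i2 : 'I_d := ord_max.

(* Over z, the first shear moves the x-coordinates of [S^n p] to those of its target; over x_1,
   the second then moves z. The Lipschitz constant of the second does not depend on [n], so it
   can be fixed before the accuracy of the first. *)
Lemma key_lemma (e : R) (x y : bool -> torus R d) : 0 < e -> exists h h', [/\ haar_iso h h',
  forall w, tdist (h (S w)) (S (h w)) <= e,
  exists U, [/\ borel_set U, (haar R d U <= e%:E)%E & forall w, ~ U w -> h w = w] &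
  exists n, forall l, exists p, [/\ tdist p (x l) < e, h p = p & tdist (h (iter n S p)) (y l) < e]].
Proof.
move=> e0.
have i1v : i1 = k :> nat by rewrite inordK.
have i12 : i1 != i2 by apply/eqP => /(congr1 val) /=; rewrite i1v; lia.
have [N' [AV Ni' Nnil]] := tower_inv R d.
have Ni1 j : N j i1 = 0 by apply: tower_mx_col; rewrite i1v.
have Ni2 j : N j i2 = 0 by apply: tower_mx_col; rewrite /=; lia.
have Ni1' j : N' j i1 = 0 by apply: Ni'; rewrite i1v.
have Ni2' j : N' j i2 = 0 by apply: Ni'; rewrite /=; lia.
have ia : irr a by have := @ab 1 0 isT; rewrite mul1r mul0r addr0.
have ib : irr b by have := @ab 0 1 isT; rewrite mul1r mul0r add0r.
have al1 : al 0 i1 = a by rewrite mxE i1v ltn_eqF //= eqxx.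
have al2 : al 0 i2 = b by rewrite mxE /= eqxx.
have e20 : 0 < e / 2 by rewrite divr_gt0.
pose n0 := (Num.truncn e^-1).+1.
have n0e : n0%:R^-1 < e.
  by rewrite -[e]invrK ltf_pV2 ?posrE ?invr_gt0 ?ltr0n // truncnS_gt.
(* Classes 1 to 4 separate the two starting points and the two targets: coordinates from different
   classes never differ by a multiple of the rotation modulo 1. *)
pose ua l : 'rV[R]_d := \row_i gpt n0 (if l then 1 else 2) (tval (x l) 0 i).
pose uq l : 'rV[R]_d := \row_i gpt n0 (if l then 3 else 4) (tval (y l) 0 i).
have near (u : 'rV[R]_d) (v : torus R d) : (forall i, `|u 0 i - tval v 0 i| <= n0%:R^-1) -> tdist (tproj u) v < e.
  move=> h; apply: le_lt_trans n0e; rewrite -[v]tproj_val.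
  apply: le_trans (tdist_proj_le _ _) _; apply: rV_norm_le; first by rewrite invr_ge0.
  by move=> i; rewrite !mxE.
have [M1 H1] := profile_exists AV Ni1 Ni1' Nnil ia e20.
(* The second shear acts once the first has put x_1 at its target value, so its bumps sit at
   coordinates of [uq], known before the travel time [n]. *)
have [| |L1 L10 {}H1] := H1 (fun l => uq l 0 i1) (fun l => ua l 0 i1).
- by move=> z; rewrite !mxE; apply: gpt_generic.
- by move=> l l' z _; rewrite addrAC !mxE; apply: gpt_generic => //; case: l l' => [] [].
(* The second shear expands the errors of the first by at most 1 + L1. *)
have e00 : 0 < e / 2 / (1 + L1) by rewrite divr_gt0 // ltr_pwDl.
have [M0 H0] := profile_exists AV Ni2 Ni2' Nnil ib e00.
(* Longer than the reach [M0] of the bumps over z, so the starting points stay outside their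
   support. *)
pose n := M0.+1.
pose ub l := lift_orbit N al (ua l) n.
have ub2 l : ub l 0 i2 = ua l 0 i2 + n%:R * b.
  rewrite /ub; elim: (n) => [|m IH]; first by rewrite mul0r addr0.
  rewrite /= mxE al2 rmxD rmx1 mulmxDr mulmx1 mxE IH [X in _ + X + b]mxE big1 ?addr0.
    by rewrite -[m.+1%:R]natr1; ring.
  by move=> j _; rewrite mxE Ni2 mulr0.
have [| |L0 L00 {}H0] := H0 (fun l => ub l 0 i2) (fun l => ua l 0 i2).
- move=> z; rewrite !ub2 opprD addrACA subrr addr0 !mxE; exact: gpt_generic.
- move=> l l' z zM; rewrite ub2.
  rewrite (_ : _ - _ = ua l 0 i2 - ua l' 0 i2 + (z + (n : int))%:~R * b); last first.
    by rewrite intrD -[(n : int)%:~R]/(n%:R); ring.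
  have [<-|ll] := eqVneq l l'.
    by rewrite subrr add0r; apply: (irr_int ib); rewrite /n; clear -zM; lia.
  by rewrite !mxE; apply: gpt_generic => //; case: l l' ll => [] [].
pose p l := tproj (ua l); pose q l := tproj (uq l); pose B l := tproj (ub l).
have pB l : iter n S (p l) = B l by rewrite /p iter_aff.
have box (w : torus R d) i : 0 <= tval w 0 i < 1 by have /forallP/(_ i) := tval_in w.
have diff1 (w w' : torus R d) i : `|tval w 0 i - tval w' 0 i| <= 1.
  have /andP[c1 c2] := box w i; have /andP[c3 c4] := box w' i.
  by move: c1 c2 c3 c4; clear; move=> *; rewrite ler_norml; apply/andP; split; lra.
pose v0 l : 'rV[R]_d := \row_i (if i == i2 then 0 else tval (q l) 0 i - tval (B l) 0 i).
pose v1 l : 'rV[R]_d := \row_i (if i == i2 then tval (q l) 0 i - tval (B l) 0 i else 0).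
have [||W0 [P0 C0 T0 Z0 [U0 [bU0 mU0 hU0]]]] := H0 v0.
- move=> l; apply: rV_norm_le => // i; rewrite mxE; case: ifP => _; rewrite ?normr0 ?ler01 //.
- by move=> l; rewrite mxE eqxx.
have [||W1 [P1 C1 T1 Z1 [U1 [bU1 mU1 hU1]]]] := H1 v1.
- move=> l; apply: rV_norm_le => // i; rewrite mxE; case: ifP => _; rewrite ?normr0 ?ler01 //.
- by move=> l; rewrite mxE (negbTE i12).
have I0 := shear_iso L00 P0; have I1 := shear_iso L10 P1.
have id0 w : ~ U0 w -> shear i2 W0 w = w by move=> /hU0 h; rewrite /shear h tshift0.
have id1 w : ~ U1 w -> shear i1 W1 w = w by move=> /hU1 h; rewrite /shear h tshift0.
exists (shear i1 W1 \o shear i2 W0), (shear i2 (fun t => - W0 t) \o shear i1 (fun t => - W1 t)).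
split.
- exact: haar_iso_comp.
- move=> w /=; apply: le_trans (tdist_triangle (shear i1 W1 (S (shear i2 W0 w))) _ _) _.
  rewrite (splitr e); apply: lerD; last first.
    by apply: (shear_aff Ni1 P1) => t; rewrite al1.
  apply: le_trans (shear_lipschitz L10 P1 _ _) _.
  rewrite mulrC -ler_pdivlMr ?ltr_pwDl //.
  by apply: (shear_aff Ni2 P0) => t; rewrite al2.
- exists (U0 `|` shear i2 W0 @^-1` U1).
  have b1 : borel_set (shear i2 W0 @^-1` U1).
    by rewrite -[_ @^-1` _]setTI; have [l0 _ _ _ _] := I0; exact: (measurable_lipschitz l0).
  split; first exact: (@measurableU _ (borel (torus R d)) _ _ bU0 b1).
    apply: le_trans (measureU2 _ bU0 b1) _; rewrite (splitr e) EFinD; apply: leeD.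
      apply: le_trans mU0 _; rewrite lee_fin ler_pdivrMr ?ltr_pwDl //.
      by rewrite ler_peMr ?(ltW e20) // lerDl.
    have [_ _ _ _ hp] := I0; apply: le_trans mU1.
    by rewrite le_eqVlt; apply/orP; left; apply/eqP; exact: hp.
  by move=> w /not_orP[h0 h1] /=; rewrite id1 // id0.
- exists n => l; exists (p l); split.
  + by apply: near => i; rewrite mxE; apply: gpt_near => //; case: l.
  + by rewrite /= /p (shear_proj _ P0) Z0 addr0 (shear_proj _ P1) Z1 addr0.
  + rewrite pB /=; suff -> : shear i1 W1 (shear i2 W0 (B l)) = q l.
      by apply: near => i; rewrite mxE; apply: gpt_near => //; case: l.
    have E0 : W0 (tval (B l) 0 i2) = v0 l.
      rewrite -T0; apply: (profile_mod P0).
      by have /intvP/(_ i2) := tval_proj (ub l); rewrite !mxE.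
    rewrite [shear i2 W0 _]/shear E0 /tshift (shear_proj _ P1).
    have -> : (tval (B l) + v0 l) 0 i1 = tval (q l) 0 i1.
      by rewrite !mxE (negbTE i12) addrC subrK.
    have -> : W1 (tval (q l) 0 i1) = v1 l.
      rewrite -T1; apply: (profile_mod P1).
      by have /intvP/(_ i1) := tval_proj (uq l); rewrite !mxE.
    rewrite -[RHS]tproj_val; congr tproj; apply/rowP => i.
    rewrite mxE [X in X + _]mxE [v0 l 0 i]mxE [v1 l 0 i]mxE.
    by case: ifP => _; rewrite addr0 addrC subrK.
Qed.

End key_lemma.

(** * Limits of conjugates *)

Section character_lipschitz.
Variable R : realType.

Lemma cos_lipschitz (s t : R) : `|cos s - cos t| <= `|s - t|.
Proof.
wlog st : s t / s <= t => [h|].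
  by have [/h//|/ltW/h] := leP s t; rewrite distrC [`|t - s|]distrC.
have [|c _ hc] := @MVT_segment R cos (fun x => - sin x) s t st (fun x _ => is_derive_cos x).
  by apply: continuous_subspaceT => x; exact: continuous_cos.
rewrite distrC hc normrM normrN [`|s - t|]distrC ler_piMl //; exact: sin_max.
Qed.

Lemma tchar_lipschitz d (m : 'rV[int]_d) : exists2 K, 0 <= K & forall c (x y : torus R d),
  `|tchar m c x - tchar m c y| <= K * tdist x y.
Proof.
exists (`|pi *+ 2| * \sum_i `|(m 0 i)%:~R|); first by rewrite mulr_ge0 // sumr_ge0.
move=> c x y; have [v -> <-] := torus_lift x y.
rewrite -[x in `|tchar m c x - _|]tproj_val !tchar_proj /tc.
apply: le_trans (cos_lipschitz _ _) _.
rewrite -mulrBr normrM -mulrA ler_wpM2l // dotpD.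
rewrite (_ : _ - _ = - dotp m v) ?normrN ?dotp_bound //; ring.
Qed.

End character_lipschitz.

(** * Limits almost everywhere *)

Section eventually_constant.
Variables (R : realType) (d : nat).
Let X := torus R d.
Variables (f : nat -> X -> X) (U : nat -> set X).
Hypotheses (mf : forall n, measurable_fun setT (f n : borel X -> borel X))
  (pf : forall n A, borel_set A -> haar R d (f n @^-1` A) = haar R d A)
  (bU : forall n, borel_set (U n)) (mU : forall n, (haar R d (U n) <= (1 / (2 ^ n.+1)%:R)%:E)%E)
  (fU : forall n x, ~ U n x -> f n.+1 x = f n x).

(** By Borel-Cantelli the sequence is eventually constant outside the null set lim sup U_n; on that
    set the limit takes the values of [f 0], which keeps it measurable. Approximation by [f n] off a
    tail of the U_k gives one inequality between measures, and complements give the other. *)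
Lemma eventual_limit : exists g : X -> X, exists B : set X,
  [/\ measurable_fun setT (g : borel X -> borel X),
      forall A, borel_set A -> haar R d (g @^-1` A) = haar R d A,
      borel_set B /\ haar R d B = 0%E &
      forall x, ~ B x -> exists n0, forall n, (n0 <= n)%N -> f n x = g x].
Proof.
pose V n := \bigcup_(k in [set k | (n <= k)%N]) U k.
pose B := lim_sup_set U.
have bV n : borel_set (V n) by apply: (@bigcup_measurable _ (borel X)) => k _; exact: bU.
have S2 : (\sum_(0 <= n <oo) haar R d (U n) < +oo)%E.
  apply: le_lt_trans (ltry 1); apply: le_trans (epsilon_trick0 predT (@ler01 R)).
  by apply: lee_nneseries => // n _; exact: mU.
have bB : borel_set B by apply: (@bigcapT_measurable _ (borel X)); exact: bV.
have mB : haar R d B = 0%E by exact: (@lim_sup_set_cvg0 _ (borel X)).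
have VB x : ~ B x -> exists n, ~ V n x.
  by move=> h; apply: contrapT => hn; apply: h => n _; apply: contrapT => hV; apply: hn; exists n.
have fV n x : ~ V n x -> forall m, (n <= m)%N -> f m x = f n x.
  move=> h; elim=> [|m IH]; first by rewrite leqn0 => /eqP ->.
  rewrite leq_eqVlt => /orP[/eqP <- //|nm]; rewrite fU ?IH //.
  by move=> hU; apply: h; exists m.
have /choice[g hg] : forall x, exists y, (B x -> y = f 0%N x) /\
    (~ B x -> exists n0, forall n, (n0 <= n)%N -> f n x = y).
  move=> x; have [Bx|Bx] := pselect (B x); first by exists (f 0%N x).
  have [n hn] := VB x Bx; exists (f n x); split => // _; exists n; exact: fV.
have gV n x : ~ V n x -> g x = f n x.
  move=> h; have Bx : ~ B x by move=> /(_ n I).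
  have [_ /(_ Bx)[n0 hn0]] := hg x.
  by rewrite -(hn0 (maxn n0 n)) ?leq_maxl // (fV n) // leq_maxr.
have gA A : g @^-1` A = (\bigcup_n (f n @^-1` A `\` V n)) `|` (B `&` f 0%N @^-1` A).
  apply/seteqP; split => x /=.
    have [Bx|Bx] := pselect (B x); first by rewrite (hg x).1 //; right.
    by have [n hn] := VB x Bx; rewrite (gV n) // => h; left; exists n.
  move=> [[n _ [h1 h2]]|[h1 h2]]; first by rewrite (gV n).
  by rewrite (hg x).1.
have bfA n A : borel_set A -> borel_set (f n @^-1` A).
  by move=> bA; rewrite -[_ @^-1` _]setTI; exact: mf.
have bgA A : borel_set A -> borel_set (g @^-1` A).
  move=> bA; rewrite gA; apply: (@measurableU _ (borel X)).
    apply: (@bigcup_measurable _ (borel X)) => n _.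
    exact: (@measurableD _ (borel X) _ _ (bfA n A bA) (bV n)).
  exact: (@measurableI _ (borel X) _ _ bB (bfA 0%N A bA)).
have Vcvg : (fun n => haar R d (V n)) @ \oo --> haar R d B.
  apply: (@lim_sup_set_cvg _ (borel X)) => //.
  by apply: le_lt_trans (probability_le1 _ (bV 0%N)) _; rewrite ltry.
have half A : borel_set A -> (haar R d (g @^-1` A) <= haar R d A)%E.
  move=> bA; have hn n : (haar R d (g @^-1` A) <= haar R d A + haar R d (V n))%E.
    rewrite -(pf n bA); apply: le_trans (measureU2 _ (bfA n A bA) (bV n)).
    apply: le_measure; rewrite ?inE; [exact: bgA| |].
      exact: (@measurableU _ (borel X) _ _ (bfA n A bA) (bV n)).
    by move=> x /= h; have [Vx|Vx] := pselect (V n x); [right|left; rewrite -gV].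
  have h : (fun n => haar R d A + haar R d (V n))%E @ \oo --> (haar R d A + haar R d B)%E.
    by apply: cvgeD => //; [rewrite mB fin_num_adde_defl|exact: cvg_cst].
  rewrite -[leRHS]adde0 -mB -(cvg_lim _ h) //; apply: lime_ge; last exact: nearW.
  by apply/cvg_ex; eexists; exact: h.
exists g, B; split => //.
- by move=> _ A bA; rewrite setTI; exact: bgA.
- move=> A bA; apply/eqP; rewrite eq_le half //=.
  have := half _ (@measurableC _ (borel X) _ bA).
  rewrite preimage_setC !probability_setC //; last exact: bgA.
  have fE C : borel_set C -> haar R d C = (fine (haar R d C))%:E.
    by move=> bC; rewrite fineK // fin_num_measure.
  by rewrite (fE A bA) (fE _ (bgA A bA)) -!EFinB !lee_fin lerD2l lerN2.
- by move=> x Bx; have [_ /(_ Bx)] := hg x.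
Qed.

End eventually_constant.

(** * Uniform limits of homeomorphisms *)

Section nested_limit.
Variables (R : realType) (d : nat).
Let X := torus R d.

(** Halving makes e_n - e_(n+j) a bound for the distance from u_(n+j) to u_n; a cluster point, which
    exists by compactness, inherits the bound e_n. *)
Lemma nested_limit (u : nat -> X) (e : nat -> R) :
  (forall n, tdist (u n.+1) (u n) <= e n / 2) -> (forall n, e n.+1 <= e n / 2) ->
  exists x, forall n, tdist x (u n) <= e n.
Proof.
move=> hu he.
have e0 n : 0 <= e n.
  by have := le_trans (tdist_ge0 _ _) (hu n); rewrite pmulr_lge0 // invr_gt0.
have near n j : tdist (u (n + j)%N) (u n) <= e n - e (n + j)%N.
  elim: j => [|j IH]; first by rewrite addn0 tdistxx subrr.
  rewrite addnS; apply: le_trans (tdist_triangle (u (n + j)%N) _ _) _.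
  by have := hu (n + j)%N; have := he (n + j)%N; move: IH; clear; lra.
have [x [_ cx]] : setT `&` cluster (u @ \oo) !=set0.
  by apply: (@torus_compact R d); exact: filterT.
exists x => n; apply/ler_addgt0Pr => r r0.
have [| |y [/= h1 h2]] := cx [set y | tdist y (u n) <= e n] (ball x r).
- exists n => // m /= nm; rewrite -(subnKC nm).
  apply: le_trans (near _ _) _; by rewrite gerBl.
- by apply: (@nbhsx_ballx R (torus R d)).
rewrite torus_ballE /= in h2.
by apply: le_trans (tdist_triangle y _ _) _; rewrite addrC lerD // ltW.
Qed.

Lemma halving_small (e : nat -> R) : (forall n, 0 <= e n) -> (forall n, e n.+1 <= e n / 2) ->
  forall r n0, 0 < r -> exists2 n, (n0 <= n)%N & e n < r.
Proof.
move=> e0 he r n0 r0; have h2 : 0 <= (2^-1 : R) < 1 by apply/andP; split; lra.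
have [n hn] := exp_small h2 (e0 n0) (divr_gt0 r0 (ltr0Sn _ 1)).
exists (n0 + n)%N; first exact: leq_addr.
apply: (@le_lt_trans _ _ (e n0 * 2^-1 ^+ n)); last by move: hn; lra.
elim: n {hn} => [|n IH]; first by rewrite mulr1 addn0.
by rewrite addnS exprS mulrCA; have := he (n0 + n)%N; move: IH; clear; lra.
Qed.

Lemma homeo_limit (T T' : nat -> X -> X) (e : nat -> R) :
  (forall n, lipschitz (T n)) -> (forall n, lipschitz (T' n)) ->
  (forall n, cancel (T n) (T' n)) -> (forall n, cancel (T' n) (T n)) ->
  (forall n x, tdist (T n.+1 x) (T n x) <= e n / 2) ->
  (forall n x, tdist (T' n.+1 x) (T' n x) <= e n / 2) ->
  (forall n, e n.+1 <= e n / 2) ->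
  exists F F' : X -> X, [/\ continuous F, continuous F', cancel F F', cancel F' F &
    forall n x, tdist (F x) (T n x) <= e n].
Proof.
move=> lT lT' c1 c2 hT hT' he.
have e0 n : 0 <= e n.
  by have := le_trans (tdist_ge0 _ _) (hT n point); rewrite pmulr_lge0 // invr_gt0.
have small (r : R) : 0 < r -> exists n, e n < r.
  by move=> r0; have [n _ hn] := halving_small e0 he 0 r0; exists n.
have /choice[F hF] := fun x => nested_limit (hT ^~ x) he.
have /choice[F' hF'] := fun x => nested_limit (hT' ^~ x) he.
have cont (G : X -> X) (S : nat -> X -> X) : (forall n, lipschitz (S n)) ->
    (forall x n, tdist (G x) (S n x) <= e n) -> continuous G.
  move=> lS hG; apply/ball_continuousP => x r r0.
  have r3 : 0 < r / 3 by rewrite divr_gt0.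
  have [n hn] := small _ r3.
  have /ball_continuousP/(_ x _ r3)[s s0 hs] := lipschitz_continuous (lS n).
  exists s => // y hy; have := hs y hy; rewrite !torus_ballE /= => h.
  apply: le_lt_trans (tdist_triangle (S n x) _ _) _.
  have := tdist_triangle (S n y) (S n x) (G y); have := hG x n; have := hG y n.
  by rewrite [tdist (G y) _]tdistC; move: h hn; clear; lra.
have inv (G G' : X -> X) (S S' : nat -> X -> X) : continuous G' ->
    (forall n, cancel (S n) (S' n)) -> (forall x n, tdist (G x) (S n x) <= e n) ->
    (forall x n, tdist (G' x) (S' n x) <= e n) -> cancel G G'.
  move=> cG' cS hG hG' x; apply: tdist_eq0; apply/eqP.
  rewrite eq_le tdist_ge0 andbT; apply/ler_addgt0Pr => r r0; rewrite add0r.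
  have r2 : 0 < r / 2 by rewrite divr_gt0.
  have /ball_continuousP/(_ (G x) _ r2)[s s0 hs] := cG'.
  have [|n hn] := small (Num.min s (r / 2)); first by rewrite lt_min s0.
  have := hs (S n x); rewrite !torus_ballE /=.
  move: hn; rewrite lt_min => /andP[h1 h2].
  move=> /(_ (le_lt_trans (hG x n) h1)) h.
  apply: le_trans (tdist_triangle (G' (S n x)) _ _) _.
  have := hG' (S n x) n; rewrite cS.
  by move: h h2; clear; lra.
have cF := cont F T lT hF; have cF' := cont F' T' lT' hF'.
exists F, F'; split => //.
- exact: (inv F F' T T').
- exact: (inv F' F T' T).
Qed.

Lemma iter_close (T : X -> X) m : lipschitz T -> exists2 C, 0 <= C &
  forall (G : X -> X) (e : R), 0 <= e -> (forall x, tdist (G x) (T x) <= e) ->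
  forall j, (j <= m)%N -> forall x, tdist (iter j G x) (iter j T x) <= C * e.
Proof.
move=> [L L0 hL]; elim: m => [|m [C C0 IH]].
  by exists 0 => // G e e0 _ j; rewrite leqn0 => /eqP -> x; rewrite mul0r tdistxx.
exists (C + (1 + L * C)); first by rewrite addr_ge0 // addr_ge0 // mulr_ge0.
move=> G e e0 hG j; rewrite leq_eqVlt => /orP[/eqP ->|jm] x; last first.
  by apply: le_trans (IH G e e0 hG j jm x) _; rewrite ler_wpM2r // lerDl addr_ge0 // mulr_ge0.
rewrite !iterS; apply: le_trans (tdist_triangle (T (iter m G x)) _ _) _.
have h1 := hG (iter m G x); have h2 := hL (iter m G x) (iter m T x).
have := ler_wpM2l L0 (IH G e e0 hG m (leqnn m) x); have : 0 <= C * e by rewrite mulr_ge0.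
by rewrite !mulrDl mul1r -mulrA; move: h1 h2; clear; lra.
Qed.

End nested_limit.

(** * Inductive construction of the limit homeomorphism *)

Section construction.
Variables (R : realType) (d : nat).
Let X := torus R d.
Variables (S S' : X -> X).
Hypotheses (lS : lipschitz S) (lS' : lipschitz S') (SK : cancel S S') (SK' : cancel S' S).
Hypothesis pS : forall A, borel_set A -> haar R d (S @^-1` A) = haar R d A.
Hypothesis avS : forall (f : X -> R) (e : R), continuous f -> 0 < e ->
  exists N0 : nat, forall n, (N0 <= n)%N ->
  forall y, `|\sum_(i < n) f (iter i S y) - n%:R * expect (haar R d) f| <= e * n%:R.
Hypothesis key : forall (e : R) (x y : bool -> X), 0 < e -> exists h h', [/\ haar_iso h h',
  forall w, tdist (h (S w)) (S (h w)) <= e,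
  exists U, [/\ borel_set U, (haar R d U <= e%:E)%E & forall w, ~ U w -> h w = w] &
  exists n, forall l, exists p, [/\ tdist p (x l) < e, h p = p & tdist (h (iter n S p)) (y l) < e]].

(* Four rational points, a character and a precision: a requirement met at one step of the
   construction. *)
Definition code := ({ffun bool * bool * 'I_d -> rat} * 'rV[int]_d * nat)%type.
Definition code_pt (c : code) (t l : bool) : X := tproj (\row_i ratr (c.1.1 (t, l, i))).
Definition code_rad (c : code) : R := c.2.+1%:R^-1.

Definition mixes (c : code) (F : X -> X) : Prop := exists m, forall l, exists p,
  tdist p (code_pt c false l) < code_rad c /\ tdist (iter m F p) (code_pt c true l) < code_rad c.

(* The two phases give the cosine and the sine, hence every phase. *)
Definition averages (c : code) (F : X -> X) : Prop := c.1.2 != 0 -> exists2 N : nat, (0 < N)%N &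
  forall (q : bool) y, `|\sum_(i < N) tchar c.1.2 (if q then 0 else - 4^-1) (iter i F y)| <=
    code_rad c * N%:R.

Lemma small_mul (C e : R) : 0 <= C -> 0 < e -> exists2 t, 0 < t & forall s, s <= t -> C * s < e.
Proof.
move=> C0 e0; exists (e / (C + 1)); first by rewrite divr_gt0 //; lra.
move=> s hs; apply: le_lt_trans (ler_wpM2l C0 hs) _.
by rewrite mulrCA gtr_pMr // ltr_pdivrMr; lra.
Qed.

Lemma iter_conj (H H' : X -> X) m x : cancel H H' ->
  iter m (H \o S \o H') (H x) = H (iter m S x).
Proof. by move=> HK; elim: m => // m IH; rewrite !iterS IH /= HK. Qed.

Lemma code_rad_gt0 c : 0 < code_rad c. Proof. by rewrite invr_gt0. Qed.

Lemma mixes_open c (T : X -> X) : lipschitz T -> mixes c T ->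
  exists2 t, 0 < t & forall F, (forall x, tdist (F x) (T x) <= t) -> mixes c F.
Proof.
move=> lT [m hm]; have [C C0 hC] := iter_close m lT.
have /choice[p hp] := hm.
pose g l := code_rad c - tdist (iter m T (p l)) (code_pt c true l).
have g0 l : 0 < g l by rewrite subr_gt0; have [] := hp l.
have [t1 t10 ht1] := small_mul C0 (g0 true); have [t2 t20 ht2] := small_mul C0 (g0 false).
exists (Num.min t1 t2); first by rewrite lt_min t10.
move=> F hF; exists m => l; exists (p l); split; first by have [] := hp l.
have t0 : 0 <= Num.min t1 t2 by rewrite ltW // lt_min t10.
have := hC F _ t0 hF m (leqnn m) (p l).
have : C * Num.min t1 t2 < g l.
  by case: l; [apply: ht1|apply: ht2]; rewrite ge_min lexx ?orbT.
have := tdist_triangle (iter m T (p l)) (iter m F (p l)) (code_pt c true l).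
rewrite /g; clear; lra.
Qed.

Lemma averages_open c (T : X -> X) : lipschitz T ->
  (c.1.2 != 0 -> exists2 N : nat, (0 < N)%N &
    forall (q : bool) y, `|\sum_(i < N) tchar c.1.2 (if q then 0 else - 4^-1) (iter i T y)| <=
    code_rad c / 2 * N%:R) ->
  exists2 t, 0 < t & forall F, (forall x, tdist (F x) (T x) <= t) -> averages c F.
Proof.
move=> lT hav; have [m0|m0] := eqVneq c.1.2 0; first by exists 1 => // F _; rewrite /averages m0 eqxx.
have [N N0 hN] := hav m0; have [C C0 hC] := iter_close N lT.
have [K K0 hK] := tchar_lipschitz R c.1.2.
have r2 : 0 < code_rad c / 2 by rewrite divr_gt0 // code_rad_gt0.
have [t t0 ht] := small_mul (mulr_ge0 K0 C0) r2.
exists t => // F hF _; exists N => // q y.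
have h1 := hN q y; set c0 := (if q then _ else _) in h1 *.
have h2 : `|\sum_(i < N) tchar c.1.2 c0 (iter i F y) - \sum_(i < N) tchar c.1.2 c0 (iter i T y)| <=
    code_rad c / 2 * N%:R.
  rewrite -sumrB (le_trans (ler_norm_sum _ _ _)) //.
  have -> : code_rad c / 2 * N%:R = \sum_(i < N) (code_rad c / 2) by rewrite sumr_const card_ord mulr_natr.
  apply: ler_sum => i _; apply: le_trans (hK _ _ _) _.
  apply: le_trans (ltW (ht t (lexx t))); rewrite -mulrA ler_wpM2l //.
  exact: (hC F t (ltW t0) hF i (ltnW (ltn_ord i))).
move: h1 h2; set A := \sum_(i < N) _; set B := \sum_(i < N) _; rewrite !ler_norml.
by move=> /andP[a1 a2] /andP[a3 a4]; clear -a1 a2 a3 a4; apply/andP; split; lra.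
Qed.

(** Conjugation by [H] multiplies errors by its Lipschitz constant, so the precision [t] given to
    [key] is chosen after [H], and the orbit segments are prescribed between the [H']-images of the
    coded points. [e1] is so small that the requirement survives all later changes. *)
Lemma construction_step (c : code) (n : nat) (H H' : X -> X) (e : R) : 0 < e -> haar_iso H H' ->
  exists H1 H1' e1, [/\ haar_iso H1 H1' /\ 0 < e1, e1 <= e / 2,
    (forall x, tdist (H1 (S (H1' x))) (H (S (H' x))) <= e / 2) /\
    (forall x, tdist (H1 (S' (H1' x))) (H (S' (H' x))) <= e / 2),
    exists U, [/\ borel_set U, (haar R d U <= (1 / (2 ^ n.+1)%:R)%:E)%E & forall y, ~ U y -> H1 y = H y] &
    forall F, (forall x, tdist (F x) (H1 (S (H1' x))) <= e1) -> mixes c F /\ averages c F].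
Proof.
move=> e0 iH; have [[L L0 hL] lH' HK HK' pH] := iH; have [L' L'0 hL'] := lS'.
have e20 : 0 < e / 2 by rewrite divr_gt0.
have [t1 t10 ht1] := small_mul L0 (code_rad_gt0 c).
have [t2 t20 ht2] := small_mul L0 e20.
have [t3 t30 ht3] := small_mul (mulr_ge0 L0 L'0) e20.
have t40 : 0 < 1 / (2 ^ n.+1)%:R :> R by rewrite divr_gt0 // ltr0n expn_gt0.
pose t := Num.min (Num.min t1 t2) (Num.min t3 (1 / (2 ^ n.+1)%:R)).
have t0 : 0 < t by rewrite !lt_min t10 t20 t30 t40.
have tt1 : t <= t1 by rewrite !ge_min lexx.
have tt2 : t <= t2 by rewrite !ge_min lexx !orbT.
have tt3 : t <= t3 by rewrite !ge_min lexx !orbT.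
have tt4 : t <= 1 / (2 ^ n.+1)%:R by rewrite !ge_min lexx !orbT.
have [h [h' [ih hcom [U [bU mU hU]] [m hm]]]] :=
  key (fun l => H' (code_pt c false l)) (fun l => H' (code_pt c true l)) t0.
have [_ _ hK hK' _] := ih.
have iH1 := haar_iso_comp iH ih; have [lH1 lH1' HK1 HK1' pH1] := iH1.
pose T := (H \o h) \o S \o (h' \o H').
have lT : lipschitz T by apply: lipschitz_comp => //; apply: lipschitz_comp.
have mixT : mixes c T.
  exists m => l; have [p [p1 p2 p3]] := hm l; exists (H p); split.
    rewrite -[code_pt c false l]HK'; apply: le_lt_trans (hL _ _) _.
    apply: le_lt_trans (ht1 t tt1); rewrite ler_wpM2l // ltW //.
  (* As h p = p, the point H p is also the image of [p] under [H \o h], which carries orbits of [S]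
     to orbits of [T]. *)
  rewrite -[in H p]p2 (iter_conj m p HK1) /= -[code_pt c true l]HK'.
  apply: le_lt_trans (hL _ _) _; apply: le_lt_trans (ht1 t tt1).
  by rewrite ler_wpM2l // ltW.
have avT : c.1.2 != 0 -> exists2 N : nat, (0 < N)%N &
    forall (q : bool) y, `|\sum_(i < N) tchar c.1.2 (if q then 0 else - 4^-1) (iter i T y)| <=
    code_rad c / 2 * N%:R.
  move=> m0; have r2 : 0 < code_rad c / 2 by rewrite divr_gt0 // code_rad_gt0.
  have av1 c0 : exists N0, forall N, (N0 <= N)%N -> forall y,
      `|\sum_(i < N) tchar c.1.2 c0 (iter i T y)| <= code_rad c / 2 * N%:R.
    have fc : continuous (tchar c.1.2 c0 \o (H \o h) : X -> R).
      move=> x; apply: continuous_comp; first exact: lipschitz_continuous.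
      exact: tchar_continuous.
    have [N0 hN0] := avS fc r2; exists N0 => N hN y; have := hN0 N hN (h' (H' y)).
    rewrite expect_haar_preserved ?haar_char ?mulr0 ?subr0 //.
    - by under eq_bigr do rewrite /= -[H (h _)]/((H \o h) _) -(iter_conj _ _ HK1) /= hK' HK'.
    - exact: measurable_lipschitz.
    - exact: bmeas_tchar.
  have [N1 hN1] := av1 0; have [N2 hN2] := av1 (- 4^-1).
  exists (maxn (maxn N1 N2) 1); first by rewrite !leq_max orbT.
  by case=> y; [apply: hN1|apply: hN2]; rewrite !leq_max leqnn ?orbT.
have [s1 s10 hs1] := mixes_open lT mixT; have [s2 s20 hs2] := averages_open lT avT.
exists (H \o h), (h' \o H'), (Num.min (e / 2) (Num.min s1 s2)); split.
- by split => //; rewrite !lt_min e20 s10 s20.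
- by rewrite ge_min lexx.
- split => x /=.
    rewrite -[X in tdist _ (H (S X))]hK'; apply: le_trans (hL _ _) _.
    by apply: le_trans (ltW (ht2 t tt2)); rewrite ler_wpM2l.
  rewrite -[X in tdist _ (H (S' X))]hK'; apply: le_trans (hL _ _) _.
  apply: le_trans (ltW (ht3 t tt3)); rewrite -mulrA ler_wpM2l //.
  (* The estimate for the inverse follows by applying [S'] to the almost commutation at the point S'
     w. *)
  move: (h' (H' x)) => w; have := hL' (S (h (S' w))) (h w).
  rewrite SK => hw; apply: le_trans hw _; rewrite ler_wpM2l // tdistC.
  by have := hcom (S' w); rewrite SK'.
- exists U; split => //; last by move=> y /hU /= ->.
  by apply: le_trans mU _; rewrite lee_fin.
- move=> F hF; split; [apply: hs1|apply: hs2] => x; apply: le_trans (hF x) _;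
    by rewrite !ge_min lexx !orbT.
Qed.

Lemma ae_null (B : set X) (P : X -> Prop) : borel_set B /\ haar R d B = 0%E ->
  (forall x, ~ B x -> P x) -> {ae haar R d, forall x, P x}.
Proof.
move=> [bB mB] h; exists B; split => // x /= nP; apply: contrapT => Bx; apply: nP; exact: h.
Qed.

Lemma null_preimage (f : X -> X) (B : set X) :
  measurable_fun setT (f : borel X -> borel X) ->
  (forall A, borel_set A -> haar R d (f @^-1` A) = haar R d A) ->
  borel_set B /\ haar R d B = 0%E -> borel_set (f @^-1` B) /\ haar R d (f @^-1` B) = 0%E.
Proof.
move=> mf pf [bB mB]; split; last by rewrite -mB; exact: pf.
by rewrite -[_ @^-1` _]setTI; exact: mf.
Qed.

Lemma null_setU (A B : set X) : borel_set A /\ haar R d A = 0%E ->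
  borel_set B /\ haar R d B = 0%E -> borel_set (A `|` B) /\ haar R d (A `|` B) = 0%E.
Proof.
move=> [bA mA] [bB mB]; split; first exact: (@measurableU _ (borel X) _ _ bA bB).
by rewrite -mA; exact: measureU0.
Qed.

(** The code of number n in the enumeration of the countable type [code] is treated at step n. The
    limit stays within e_n of each stage, so it meets every requirement; [j] and [p] are the limits
    almost everywhere of the H_n and of their inverses. *)
Theorem limit_system : exists F F' j p : X -> X,
  [/\ [/\ continuous F, continuous F', cancel F F', cancel F' F &
         forall A, borel_set A -> haar R d (F @^-1` A) = haar R d A],
      [/\ measurable_fun setT (j : borel X -> borel X), measurable_fun setT (p : borel X -> borel X),
          forall A, borel_set A -> haar R d (j @^-1` A) = haar R d A &
          forall A, borel_set A -> haar R d (p @^-1` A) = haar R d A],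
      [/\ {ae haar R d, forall y, p (j y) = y}, {ae haar R d, forall x, j (p x) = x},
          {ae haar R d, forall x, S (p x) = p (F x)} & {ae haar R d, forall y, j (S y) = F (j y)}] &
      forall c, mixes c F /\ averages c F].
Proof.
pose st := {s : (X -> X) * (X -> X) * R | haar_iso s.1.1 s.1.2 /\ 0 < s.2}.
pose c0 : code := ([ffun=> 0], 0, 0%N).
pose cn n := odflt c0 (unpickle n).
pose T (s : st) x := (sval s).1.1 (S ((sval s).1.2 x)).
pose T' (s : st) x := (sval s).1.1 (S' ((sval s).1.2 x)).
have /choice[nxt hnxt] : forall ns : nat * st, exists s1 : st,
    [/\ (sval s1).2 <= (sval ns.2).2 / 2,
      (forall x, tdist (T s1 x) (T ns.2 x) <= (sval ns.2).2 / 2) /\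
      (forall x, tdist (T' s1 x) (T' ns.2 x) <= (sval ns.2).2 / 2),
      exists U, [/\ borel_set U, (haar R d U <= (1 / (2 ^ ns.1.+1)%:R)%:E)%E &
        forall y, ~ U y -> (sval s1).1.1 y = (sval ns.2).1.1 y] &
      forall F, (forall x, tdist (F x) (T s1 x) <= (sval s1).2) ->
        mixes (cn ns.1) F /\ averages (cn ns.1) F].
  move=> [n [[[H H'] e] /= [iH e0]]].
  have [H1 [H1' [e1 [[iH1 e10] h1 h2 h3 h4]]]] := construction_step (cn n) n e0 iH.
  by exists (exist _ (H1, H1', e1) (conj iH1 e10)).
have iid : haar_iso (@id X) id by split => //; exact: lipschitz_id.
pose s0 : st := exist _ (id, id, 1) (conj iid ltr01).
pose sq := fix sq n : st := if n is n'.+1 then nxt (n', sq n') else s0.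
pose e n := (sval (sq n)).2; pose H n := (sval (sq n)).1.1; pose H' n := (sval (sq n)).1.2.
have iH n : haar_iso (H n) (H' n) by rewrite /H /H'; case: (sq n) => s [].
have lTn n : lipschitz (T (sq n)).
  have [l1 l2 _ _ _] := iH n.
  exact: (lipschitz_comp l1 (lipschitz_comp lS l2)).
have lTn' n : lipschitz (T' (sq n)).
  have [l1 l2 _ _ _] := iH n.
  exact: (lipschitz_comp l1 (lipschitz_comp lS' l2)).
have TK n : cancel (T (sq n)) (T' (sq n)).
  have [_ _ k1 k2 _] := iH n; move=> x.
  by rewrite /T /T' -/(H n) -/(H' n) k1 SK k2.
have TK' n : cancel (T' (sq n)) (T (sq n)).
  have [_ _ k1 k2 _] := iH n; move=> x.
  by rewrite /T /T' -/(H n) -/(H' n) k1 SK' k2.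
have step n := hnxt (n, sq n).
have [F [F' [cF cF' FK FK' hF]]] : exists F F' : X -> X,
    [/\ continuous F, continuous F', cancel F F', cancel F' F &
    forall n x, tdist (F x) (T (sq n) x) <= e n].
  apply: (@homeo_limit R d (fun n => T (sq n)) (fun n => T' (sq n)) e) => //.
  - by move=> n x; have [_ [h _] _ _] := step n; exact: h.
  - by move=> n x; have [_ [_ h] _ _] := step n; exact: h.
  - by move=> n; have [h _ _ _] := step n.
have /choice[U hU] : forall n, exists U, [/\ borel_set U,
    (haar R d U <= (1 / (2 ^ n.+1)%:R)%:E)%E & forall y, ~ U y -> H n.+1 y = H n y].
  by move=> n; have [_ _ h _] := step n.
have mH n : measurable_fun setT (H n : borel X -> borel X).
  by have [l _ _ _ _] := iH n; exact: measurable_lipschitz.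
have mH' n : measurable_fun setT (H' n : borel X -> borel X).
  by have [_ l _ _ _] := iH n; exact: measurable_lipschitz.
have pH n A : borel_set A -> haar R d (H n @^-1` A) = haar R d A.
  by move=> bA; have [_ _ _ _ h] := iH n; exact: h.
have pH' n A : borel_set A -> haar R d (H' n @^-1` A) = haar R d A.
  move=> bA; have [_ _ k _ h] := iH n; rewrite -h; last by rewrite -[_ @^-1` _]setTI; exact: mH'.
  by congr (haar R d _); apply/seteqP; split => x /=; rewrite k.
have [j [Bj [mj pj' nj hj]]] := eventual_limit mH pH (fun n => let: And3 h _ _ := hU n in h)
  (fun n => let: And3 _ h _ := hU n in h) (fun n => let: And3 _ _ h := hU n in h).
have [p [Bp [mp pp np hp]]] : exists g : X -> X, exists B : set X,
  [/\ measurable_fun setT (g : borel X -> borel X),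
      forall A, borel_set A -> haar R d (g @^-1` A) = haar R d A,
      borel_set B /\ haar R d B = 0%E &
      forall x, ~ B x -> exists n0, forall n, (n0 <= n)%N -> H' n x = g x].
  (* If H'_(n+1) x avoids U_n, then H_n and H_(n+1) agree at that point and both send it to x, so
     H'_n x is the same point. *)
  apply: (@eventual_limit R d H' (fun n => H' n.+1 @^-1` U n)) => //.
  - move=> n; have [bU _ _] := hU n.
    by rewrite -[_ @^-1` _]setTI; exact: mH'.
  - move=> n; have [bU h _] := hU n; apply: le_trans h.
    by rewrite le_eqVlt; apply/orP; left; apply/eqP; exact: pH'.
  - move=> n x hx; have [_ _ h] := hU n.
    have [_ _ k1 _ _] := iH n; have [_ _ _ k2 _] := iH n.+1.
    by rewrite -[in RHS](k2 x) h // k1.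
have he n : e n.+1 <= e n / 2 by have [h _ _ _] := step n.
have e0 n : 0 <= e n by rewrite /e; case: (sq n) => s [? h]; exact: ltW.
have small := halving_small e0 he.
have pTn n A : borel_set A -> haar R d (T (sq n) @^-1` A) = haar R d A.
  move=> bA; have bHA : borel_set (H n @^-1` A) by rewrite -[_ @^-1` _]setTI; exact: mH.
  have bSA : borel_set (S @^-1` (H n @^-1` A)).
    by rewrite -[_ @^-1` _]setTI; exact: measurable_lipschitz.
  rewrite -[_ @^-1` A]/(H' n @^-1` (S @^-1` (H n @^-1` A))).
  by rewrite (pH' n _ bSA) (pS bHA) (pH n _ bA).
(* Characters are Lipschitz, so their integrals pass to the uniform limit of the measure-preserving
   conjugates. *)
have pF A : borel_set A -> haar R d (F @^-1` A) = haar R d A.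
  have mF : measurable_fun setT (F : borel X -> borel X) by exact: (@continuous_measurable R X X F cF).
  apply: haar_preserved => // m c m0; apply/eqP; rewrite -normr_le0.
  apply/ler_addgt0Pr => r r0; rewrite add0r.
  have [K K0 hK] := tchar_lipschitz R m; have [t t0 ht] := small_mul K0 r0.
  have [n _ hn] := small t 0%N t0.
  have b1 : bmeas (tchar m c \o F : borel X -> R).
    exact: (bmeas_comp mF (bmeas_tchar m c)).
  have b2 : bmeas (tchar m c \o T (sq n) : borel X -> R) by apply: bmeas_lipschitz => //; exact: bmeas_tchar.
  have h0 : expect (haar R d) (tchar m c \o T (sq n)) = 0.
    rewrite expect_haar_preserved ?haar_char //; [exact: measurable_lipschitz|exact: pTn|exact: bmeas_tchar].
  rewrite -[X in `|X|]subr0 -h0 -expectB //; apply: expect_norm.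
    under eq_fun do rewrite -mulN1r; apply: bmeasD => //; exact: bmeasZ.
  move=> x /=; apply: le_trans (hK _ _ _) _; apply: ltW; apply: le_lt_trans (ht (e n) (ltW hn)).
  by rewrite ler_wpM2l.
(* For large n, j y = H_n y and j (S y) = H_n (S y), so [T (sq n)] maps j y exactly to j (S y) while
   being within e_n of [F]. *)
have jF y : ~ Bj y -> ~ Bj (S y) -> j (S y) = F (j y).
  move=> h1 h2; have [n1 hn1] := hj _ h1; have [n2 hn2] := hj _ h2.
  apply: tdist_eq0; apply/eqP; rewrite eq_le tdist_ge0 andbT; apply/ler_addgt0Pr => r r0.
  rewrite add0r; have [n] := small r (maxn n1 n2) r0.
  rewrite geq_max => /andP[/hn1 a1 /hn2 a2] hn.
  have E : T (sq n) (j y) = j (S y).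
    by rewrite /T -/(H n) -/(H' n) -a1; have [_ _ k _ _] := iH n; rewrite k a2.
  by rewrite tdistC -E; exact: le_trans (hF n (j y)) (ltW hn).
have jp x : ~ Bp x -> ~ Bj (p x) -> j (p x) = x.
  move=> h1 h2; have [n1 hn1] := hp _ h1; have [n2 hn2] := hj _ h2.
  rewrite -(hn2 (maxn n1 n2)) ?leq_maxr // -(hn1 (maxn n1 n2)) ?leq_maxl //.
  by have [_ _ _ k _] := iH (maxn n1 n2); rewrite k.
have pj y : ~ Bj y -> ~ Bp (j y) -> p (j y) = y.
  move=> h1 h2; have [n1 hn1] := hj _ h1; have [n2 hn2] := hp _ h2.
  rewrite -(hn2 (maxn n1 n2)) ?leq_maxr // -(hn1 (maxn n1 n2)) ?leq_maxl //.
  by have [_ _ k _ _] := iH (maxn n1 n2); rewrite k.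
have mS := measurable_lipschitz lS.
have nS := null_preimage mS pS nj.
exists F, F', j, p; split => //; last first.
  move=> c; have [_ _ _ h] := step (pickle c); have := h F (hF (pickle c).+1).
  by rewrite /cn /= pickleK.
split.
- apply: (ae_null (null_setU nj (null_preimage mj pj' np))) => y /not_orP[]; exact: pj.
- apply: (ae_null (null_setU np (null_preimage mp pp nj))) => y /not_orP[]; exact: jp.
- have n3 := null_preimage mj pj' np.
  have n4 := null_preimage mp pp (null_preimage mS pS n3).
  have n5 := null_preimage mp pp nS.
  apply: (ae_null (null_setU (null_setU np (null_preimage mp pp nj)) (null_setU n5 n4))).
  move=> x /not_orP[/not_orP[x1 x2] /not_orP[x3 x4]].
  by rewrite -[in F x](jp x x1 x2) -jF // pj.
- by apply: (ae_null (null_setU nj nS)) => y /not_orP[]; exact: jF.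
Qed.

End construction.

(** * Strict ergodicity and weak mixing of the limit *)

Section dynamics.
Variables (R : realType) (d : nat).
Let X := torus R d.
Variables (F : X -> X).
Hypotheses (cF : continuous F) (avF : forall c : code d, averages c F)
  (mixF : forall c : code d, mixes c F).

(** Cut the orbit into blocks of length [N]; an incomplete block costs at most [N]. *)
Lemma block_average (f : X -> R) (N : nat) (r : R) : (0 < N)%N -> 0 <= r -> (forall x, `|f x| <= 1) ->
  (forall y, `|\sum_(i < N) f (iter i F y)| <= r * N%:R) ->
  forall n y, `|\sum_(i < n) f (iter i F y)| <= r * n%:R + N%:R.
Proof.
move=> N0 r0 f1 hN n; elim/ltn_ind: n => n IH y.
have [nN|Nn] := ltnP n N.
  apply: le_trans (ler_norm_sum _ _ _) _.
  apply: (@le_trans _ _ n%:R); last by rewrite -[X in X <= _]add0r lerD ?mulr_ge0 // ler_nat ltnW.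
  rewrite -[n in n%:R]card_ord -sumr_const; apply: ler_sum => i _; exact: f1.
have := IH (n - N)%N _ (iter N F y); rewrite ltn_subrL N0 (leq_trans N0 Nn) => /(_ isT) h.
have -> : \sum_(i < n) f (iter i F y) = \sum_(i < N) f (iter i F y) +
    \sum_(i < n - N) f (iter i F (iter N F y)).
  rewrite -!(big_mkord predT (fun i => f (iter i F _))) (@big_cat_nat _ _ _ N) //=; congr (_ + _).
  rewrite -{1}[N]add0n big_addn; apply: eq_bigr => i _.
  by rewrite addnC addnC iterD.
have := ler_normD (\sum_(i < N) f (iter i F y)) (\sum_(i < n - N) f (iter i F (iter N F y))).
have := hN y; move: h; rewrite natrB // mulrBr; clear; lra.
Qed.

(** Every phase is a combination of the phases 0 and -1/4 with coefficients at most 1 in size, so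
    precision e / 4 for both gives e / 2; the incomplete block uses the other half. *)
Lemma averages_tchar (m : 'rV[int]_d) c (e : R) : m != 0 -> 0 < e -> exists N0 : nat,
  forall n, (N0 <= n)%N -> forall y, `|\sum_(i < n) tchar m c (iter i F y)| <= e * n%:R.
Proof.
move=> m0 e0; pose q := Num.truncn (4 / e).
have e4 : 0 < 4 / e by rewrite divr_gt0.
have rq : (q.+1%:R^-1 : R) <= e / 4.
  by rewrite -[e / 4]invrK invf_div lef_pV2 ?posrE ?ltr0n // ltW // truncnS_gt.
have [N N0 hN] := avF (c := ([ffun=> 0], m, q)) m0.
rewrite /code_rad /= in hN.
have r0 : 0 <= e / 2 by rewrite divr_ge0 // ltW.
have h y : `|\sum_(i < N) tchar m c (iter i F y)| <= e / 2 * N%:R.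
  have -> : \sum_(i < N) tchar m c (iter i F y) =
      tc (- c) * \sum_(i < N) tchar m 0 (iter i F y) +
      tc (- c - 4^-1) * \sum_(i < N) tchar m (- 4^-1) (iter i F y).
    rewrite !mulr_sumr -big_split; apply: eq_bigr => i _ /=.
    rewrite /tchar -[in LHS](opprK c) tcB addr0; ring.
  have h1 := hN true y; have h2 := hN false y.
  apply: le_trans (ler_normD _ _) _; rewrite !normrM.
  have k1 := ler_pM (normr_ge0 _) (normr_ge0 _) (tc_max (- c)) h1.
  have k2 := ler_pM (normr_ge0 _) (normr_ge0 _) (tc_max (- c - 4^-1)) h2.
  have := ler_wpM2r (ler0n R N) rq; move: k1 k2; rewrite !mul1r; set t := q.+1%:R^-1 * _; clearbody t; clear; lra.
have B := block_average N0 r0 (tchar_max m c) h.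
exists (Num.truncn (N%:R / (e / 2))).+1 => n hn y; apply: le_trans (B n y) _.
have : N%:R <= e / 2 * n%:R.
  rewrite mulrC -ler_pdivrMr ?divr_gt0 //.
  by apply: le_trans (ltW (truncnS_gt _)) _; rewrite ler_nat.
by move=> h'; rewrite [X in _ <= X * n%:R]splitr mulrDl lerD2l.
Qed.

(** Integrating the uniform averages of a nontrivial character against an invariant measure shows
    that its integral is 0, and this determines Haar measure. *)
Lemma F_uniquely_ergodic (P : probability (borel X) R) :
  (forall A, borel_set A -> P (F @^-1` A) = P A) ->
  forall A, borel_set A -> P A = haar R d A.
Proof.
move=> pF; have mF : measurable_fun setT (F : borel X -> borel X).
  exact: (@continuous_measurable R X X F cF).
have eF (g : X -> R) i : bmeas (g : borel X -> R) ->
    bmeas (g \o iter i F : borel X -> R) /\ expect P (g \o iter i F) = expect P g.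
  move=> bg; elim: i => [|i [b IH]]; first by split.
  have -> : g \o iter i.+1 F = (g \o iter i F) \o F by apply/funext => x /=; rewrite -iterS iterSr.
  split; first exact: (bmeas_comp mF b).
  rewrite -IH -(expect_push P mF b); congr fine.
  by apply: eq_measure_integral => A mA _; exact: pF.
apply: haar_unique => m c m0; apply/eqP; rewrite -normr_le0.
apply/ler_addgt0Pr => e e0; rewrite add0r.
have [N hN] := averages_tchar c m0 e0.
have bt i : bmeas (tchar m c \o iter i F : borel X -> R).
  by have [] := eF _ i (bmeas_tchar m c).
have bs : bmeas ((fun y => \sum_(i < N.+1) tchar m c (iter i F y)) : borel X -> R).
  by apply: (@bmeas_sum _ (borel X) R 'I_N.+1 _ (fun i => tchar m c \o iter i F)).
have hE : expect P (fun y => \sum_(i < N.+1) tchar m c (iter i F y)) = N.+1%:R * expect P (tchar m c).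
  rewrite (@expect_sum _ (borel X) R P 'I_N.+1 _ (fun i => tchar m c \o iter i F)) //.
  rewrite (eq_bigr (fun=> expect P (tchar m c))); last first.
    by move=> i _; have [_] := eF _ i (bmeas_tchar m c).
  by rewrite sumr_const card_ord mulr_natl.
have := expect_norm P bs (hN _ (leqnSn N)).
by rewrite hE normrM normr_nat mulrC ler_pM2r ?ltr0n.
Qed.

(** By compactness finitely many translates of [f] have a sum of at least f x / 2 everywhere, yet
    each of them has integral 0. *)
Lemma haar_full_support (f : X -> R) : continuous f -> (forall x, 0 <= f x) ->
  expect (haar R d) f = 0 -> forall x, f x = 0.
Proof.
move=> fc f0 Ef x; apply/eqP; rewrite eq_le f0 andbT leNgt; apply/negP => fx.
pose v y := tval x - tval y.
have vy y : tshift (v y) y = x by rewrite /tshift /v addrC subrK tproj_val.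
have fv y : continuous (f \o tshift (v y)).
  move=> w; apply: continuous_comp; last exact: fc.
  by apply: lipschitz_continuous; exact: tshift_lipschitz.
have [|s hs] := @compact_finite_cover X (fun y => [set w | f x / 2 < f (tshift (v y) w)]) (@torus_compact R d).
  move=> y; apply: open_nbhs_nbhs; split; last by rewrite /= vy ltr_pdivrMr // ltr_pMr // ltrDl.
  have /continuousP/(_ [set t | f x / 2 < t]) := fv y; apply; exact: open_gt.
have bv y : bmeas (f \o tshift (v y) : borel X -> R) by apply: bmeas_torus.
have : expect (haar R d) (fun w => \sum_(y <- s) (f \o tshift (v y)) w - f x / 2) >= 0.
  apply: expect_ge0 => w; rewrite subr_ge0; have [y ys hy] := hs w.
  apply: le_trans (ltW hy) _; rewrite (big_rem y) //= lerDl sumr_ge0 //.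
rewrite expectB; [|exact: bmeas_sum|exact: bmeas_cst].
rewrite expect_cst expect_sum // big1 => [|y _]; first by rewrite sub0r oppr_ge0 leNgt divr_gt0.
by rewrite expect_shift //; exact: bmeas_torus.
Qed.

(** The distance to [A] vanishes along an orbit inside [A], so its mean is 0, and full support of
    Haar measure makes it vanish everywhere. *)
Lemma F_minimal (A : set X) : closed A -> A !=set0 -> F @` A `<=` A -> A = setT.
Proof.
move=> cA A0 FA; have [f [fc f0 fA]] := dist_to_closed cA A0.
apply/seteqP; split => // x _; apply/fA; apply: haar_full_support => //.
have [y Ay] := A0; apply/eqP; rewrite -normr_le0; apply/ler_addgt0Pr => e e0; rewrite add0r.
have [N hN] := average_of_chars averages_tchar fc e0.
have := hN N.+1 (leqnSn N) y; rewrite big1 => [|i _].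
  by rewrite sub0r normrN normrM normr_nat mulrC ler_pM2r ?ltr0n.
apply/fA; elim: (i : nat) => // n IH; rewrite iterS; apply: FA; by exists (iter n F y).
Qed.

(** The index [l] runs over the two factors of the product: [mixes] moves both coordinates in the
    same number of iterates. Half of the radius is spent on rational approximation, half on the
    precision of the code. *)
Lemma F_weak_mixing :
  @topologically_transitive (X * X)%type (fun xy => (F xy.1, F xy.2)).
Proof.
move=> U V oU oV [[x1 x2] Ux] [[y1 y2] Vy].
have box (W : set (X * X)) z1 z2 : open W -> W (z1, z2) -> exists2 r : R, 0 < r &
    forall w1 w2, tdist z1 w1 < r -> tdist z2 w2 < r -> W (w1, w2).
  move=> oW Wz; have [[A B] [/= /nbhs_ballP[r1 /= r10 h1] /nbhs_ballP[r2 /= r20 h2]] hAB] := open_nbhs_nbhs (conj oW Wz).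
  exists (Num.min r1 r2); first by rewrite lt_min r10.
  move=> w1 w2; rewrite !lt_min => /andP[a1 _] /andP[_ a2].
  by apply: hAB; split; [apply: h1|apply: h2]; rewrite torus_ballE.
have [r1 r10 hU] := box U x1 x2 oU Ux; have [r2 r20 hV] := box V y1 y2 oV Vy.
pose r := Num.min r1 r2; have r0 : 0 < r by rewrite lt_min r10.
pose z (t l : bool) : X := if t then (if l then y1 else y2) else (if l then x1 else x2).
have /choice[g hg] : forall tli : bool * bool * 'I_d, exists q : rat,
    `|ratr q - tval (z tli.1.1 tli.1.2) 0 tli.2| <= r / 2.
  move=> [[t l] i] /=; set a := tval _ 0 i.
  have [|q] := @rat_in_itvoo R (a - r / 2) (a + r / 2); first by move: r0; clear; lra.
  rewrite in_itv /= => /andP[h1 h2]; exists q.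
  by rewrite ler_norml; apply/andP; split; move: h1 h2; clear; lra.
pose q := Num.truncn (2 / r).
have rq : (q.+1%:R^-1 : R) <= r / 2.
  by rewrite -[r / 2]invrK invf_div lef_pV2 ?posrE ?ltr0n ?divr_gt0 // ltW // truncnS_gt.
pose c : code d := ([ffun tli => g tli], 0, q).
have cpt t l : tdist (z t l) (code_pt R c t l) <= r / 2.
  rewrite tdistC -[z t l]tproj_val; apply: le_trans (tdist_proj_le _ _) _.
  apply: rV_norm_le; first by rewrite divr_ge0 // ltW.
  by move=> i; rewrite !mxE ffunE; exact: (hg (t, l, i)).
have [n hn] := mixF c; have /choice[p hp] := hn.
have near t l w : tdist w (code_pt R c t l) < code_rad R c -> tdist (z t l) w < r.
  move=> h; apply: le_lt_trans (tdist_triangle (code_pt R c t l) _ _) _.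
  have := cpt t l; move: h; rewrite /code_rad /= tdistC => h1 h2.
  by rewrite (splitr r); exact: ler_ltD h2 (lt_le_trans h1 rq).
have rr1 : r <= r1 by rewrite ge_min lexx.
have rr2 : r <= r2 by rewrite ge_min lexx orbT.
have iterE (w1 w2 : X) : iter n (fun xy : X * X => (F xy.1, F xy.2)) (w1, w2) = (iter n F w1, iter n F w2).
  by elim: (n) => // m IH; rewrite !iterS IH.
exists n, (iter n F (p true), iter n F (p false)); split.
  exists (p true, p false); last exact: iterE.
  apply: hU; apply: lt_le_trans rr1.
    by apply: (near false true); have [] := hp true.
  by apply: (near false false); have [] := hp false.
apply: hV; apply: lt_le_trans rr2.
  by apply: (near true true); have [] := hp true.
by apply: (near true false); have [] := hp false.
Qed.

End dynamics.

(** * Affine unipotent systems are nilsystems *)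

Section affine_smooth.
Variables (R : realType) (V W : normedModType R).

(** [L] is the linear part: the derivative along [v] is the constant [L v], which is again affine,
    with linear part 0. *)
Lemma affine_smooth (U : set V) (f : V -> W) : continuous f ->
  (exists L : V -> W, forall x v (h : R), f (h *: v + x) = h *: L v + f x) -> smooth_on U f.
Proof.
move=> cf hf r; elim: r f cf hf => [|r IH] f cf [L hL].
  by split => // x _; exact: cf.
split=> [x _|v]; first exact: cf.
have D x : h^-1 *: ((f \o shift x) (h *: v) - f x) @[h --> 0^'] --> L v.
  apply: cvg_near_cst; near=> h.
  rewrite /= hL addrK scalerA mulVf ?scale1r //.
  near: h; exact: nbhs_dnbhs_neq.
split; first by move=> x _; apply/cvg_ex; exists (L v); exact: D.
rewrite (_ : (fun x => 'D_v f x) = fun=> L v); last first.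
  by apply/funext => x; apply: cvg_lim => //; exact: D.
apply: IH; first by move=> x; exact: cvg_cst.
by exists (fun=> 0) => x w h; rewrite scaler0 add0r.
Unshelve. all: by end_near.
Qed.

End affine_smooth.

Lemma mulmx_continuous (R : realType) d (M : 'M[R]_d) : continuous (fun u : 'rV[R]_d => u *m M).
Proof.
apply/ball_continuousP => u e e0; pose b := mx_bound M + 1.
have b0 : 0 < b by rewrite ltr_wpDl // mx_bound_ge0.
exists (e / b); first by rewrite divr_gt0.
move=> v; rewrite -!ball_normE /= => h; rewrite -mulmxBl.
apply: le_lt_trans (mulmx_norm _ _) _.
apply: (@le_lt_trans _ _ (b * `|u - v|)); first by rewrite ler_wpM2r // lerDl.
by rewrite mulrC -ltr_pdivlMr.
Qed.

(* [(n, v)] acts on row vectors by [u |-> u A^n + v]. *)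
Definition affG (R : realType) (d : nat) (A : 'M[int]_d.+1) (AU : A \is a GRing.unit) : Type :=
  (int * 'rV[R]_d.+1)%type.

Section affine_group.
Variables (R : realType) (d : nat) (A : 'M[int]_d.+1) (AU : A \is a GRing.unit).
Local Notation G := (affG R AU).

HB.instance Definition _ := Choice.copy G (int * 'rV[R]_d.+1)%type.
HB.instance Definition _ := isPointed.Build G (0, 0).

Definition gpow (n : int) : 'M[R]_d.+1 := rmx R (A ^ n).

Lemma gpowD m n : gpow (m + n) = gpow m *m gpow n.
Proof. by rewrite /gpow exprzDr // -rmxM. Qed.

Lemma gpow0 : gpow 0 = 1%:M. Proof. by rewrite /gpow expr0z -rmx1. Qed.

Lemma gpowNK n : gpow (- n) *m gpow n = 1%:M.
Proof. by rewrite -gpowD addNr gpow0. Qed.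

Definition affG_one : G := (0, 0).
Definition affG_inv (x : G) : G := (- x.1, - (x.2 *m gpow (- x.1))).
(** Composition of the affine maps, the right factor acting first. *)
Definition affG_mul (x y : G) : G := (x.1 + y.1, y.2 *m gpow x.1 + x.2).

Lemma affG_mulA : associative affG_mul.
Proof.
move=> x y z; congr pair; rewrite /= ?addrA //.
by rewrite mulmxDl -mulmxA -gpowD [y.1 + x.1]addrC.
Qed.

Lemma affG_mul1 : left_id affG_one affG_mul.
Proof. by case=> n v; rewrite /affG_mul /= add0r gpow0 mulmx1 addr0. Qed.

Lemma affG_mulr1 : right_id affG_one affG_mul.
Proof. by case=> n v; rewrite /affG_mul /= addr0 mul0mx add0r. Qed.

Lemma affG_mulV : left_inverse affG_one affG_inv affG_mul.
Proof. by case=> n v; rewrite /affG_mul /affG_inv /= addNr subrr. Qed.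

Lemma affG_mulrV : right_inverse affG_one affG_inv affG_mul.
Proof.
by case=> n v; rewrite /affG_mul /affG_inv /= addrN mulNmx -mulmxA gpowNK mulmx1 addNr.
Qed.

HB.instance Definition _ := isGroup.Build G affG_mulA affG_mul1 affG_mulr1 affG_mulV affG_mulrV.

(** The integer coordinate is discrete: it is constant below distance 1, and each of its levels will
    be the domain of a chart. *)
Definition affG_dist (x y : G) : R := `|(x.1 - y.1)%:~R| + `|x.2 - y.2|.

Lemma affG_distxx x : affG_dist x x = 0.
Proof. by rewrite /affG_dist !subrr !normr0 addr0. Qed.

Lemma affG_dist_eq0 x y : affG_dist x y = 0 -> x = y.
Proof.
move=> /eqP; rewrite paddr_eq0 // !normr_eq0 intr_eq0 !subr_eq0 => /andP[/eqP h1 /eqP h2].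
by case: x y h1 h2 => [a b] [a' b'] /= -> ->.
Qed.

Lemma affG_distC x y : affG_dist x y = affG_dist y x.
Proof. by rewrite /affG_dist [X in X + _](_ : _ = `|(y.1 - x.1)%:~R|) ?[`|y.2 - _|]distrC // -normrN -intrN opprB. Qed.

Lemma affG_dist_triangle y x z : affG_dist x z <= affG_dist x y + affG_dist y z.
Proof.
rewrite /affG_dist addrACA lerD //; last exact: ler_distD.
by rewrite !intrB; exact: ler_distD.
Qed.

HB.instance Definition _ := @isMetric.Build R G affG_dist affG_distxx affG_dist_eq0 affG_distC affG_dist_triangle.

Lemma affG_ballE (x y : G) (r : R) : ball x r y = (affG_dist x y < r) :> Prop.
Proof. by rewrite ballEmdist. Qed.

Lemma affG_ballP (x y : G) (r : R) : r <= 1 -> ball x r y <-> x.1 = y.1 /\ `|x.2 - y.2| < r.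
Proof.
move=> r1; rewrite affG_ballE /affG_dist; split.
  move=> h; have h1 : x.1 = y.1.
    apply/eqP; rewrite -subr_eq0 -normr_eq0 eq_le normr_ge0 andbT -ltzD1 add0r.
    rewrite -(ltr_int R) intr_norm; apply: lt_le_trans r1; apply: le_lt_trans h.
    by rewrite lerDl.
  by move: h; rewrite h1 subrr normr0 add0r.
by move=> [-> h]; rewrite subrr normr0 add0r.
Qed.

Lemma affG_openP (S : set G) :
  (forall x, S x -> exists2 r : R, 0 < r & forall y : G, x.1 = y.1 -> `|x.2 - y.2| < r -> S y) ->
  open S.
Proof.
move=> h; rewrite openE => x /h[r r0 hr]; apply/nbhs_ballP; exists (Num.min 1 r) => /=.
  by rewrite lt_min ltr01.
move=> y /affG_ballP; rewrite ge_min lexx => /(_ isT)[h1]; rewrite lt_min => /andP[_ h2].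
exact: hr.
Qed.

Lemma affG_mul_continuous : continuous (fun xy : G * G => (xy.1 * xy.2)%g).
Proof.
apply/ball_continuousP => -[x y] e e0; pose b := mx_bound (gpow x.1) + 1.
have b0 : 0 < b by rewrite ltr_wpDl // mx_bound_ge0.
pose e' := Num.min 1 e; have e'0 : 0 < e' by rewrite lt_min ltr01.
have e'1 : e' <= 1 by rewrite ge_min lexx.
have e'e : e' <= e by rewrite ge_min lexx orbT.
have r0 : 0 < Num.min 1 (e' / b) by rewrite lt_min ltr01 divr_gt0.
exists (Num.min 1 (e' / b)) => // -[x' y'] [/= /affG_ballP hx /affG_ballP hy].
have [|x1 x2] := hx; first by rewrite ge_min lexx.
have [|y1 y2] := hy; first by rewrite ge_min lexx.
apply: (le_ball e'e); apply/affG_ballP => //; split; first by rewrite /= x1 y1.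
rewrite /= -x1 opprD addrACA -mulmxBl.
apply: le_lt_trans (ler_normD _ _) _.
have {}x2 : `|x.2 - x'.2| < e' / b by apply: lt_le_trans x2 _; rewrite ge_min lexx orbT.
have {}y2 : `|y.2 - y'.2| < e' / b by apply: lt_le_trans y2 _; rewrite ge_min lexx orbT.
have h1 := mulmx_norm (y.2 - y'.2) (gpow x.1).
have h2 := ler_wpM2l (mx_bound_ge0 (gpow x.1)) (ltW y2).
apply: lt_le_trans (ler_ltD (le_trans h1 h2) x2) _.
by rewrite -[X in _ + X]mul1r -mulrDl -/b mulrCA mulfV ?mulr1 // gt_eqF.
Qed.

Lemma affG_inv_continuous : continuous (fun x : G => (x^-1)%g).
Proof.
apply/ball_continuousP => x e e0; pose b := mx_bound (gpow (- x.1)) + 1.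
have b0 : 0 < b by rewrite ltr_wpDl // mx_bound_ge0.
pose e' := Num.min 1 e; have e'0 : 0 < e' by rewrite lt_min ltr01.
have e'1 : e' <= 1 by rewrite ge_min lexx.
have e'e : e' <= e by rewrite ge_min lexx orbT.
have r0 : 0 < Num.min 1 (e' / b) by rewrite lt_min ltr01 divr_gt0.
exists (Num.min 1 (e' / b)) => // y /affG_ballP; rewrite ge_min lexx => /(_ isT)[x1].
rewrite lt_min => /andP[_ x2]; apply: (le_ball e'e); apply/affG_ballP => //; split.
  by rewrite /= x1.
rewrite /= -x1 opprK addrC -mulmxBl -normrN -mulNmx opprB.
have h1 := mulmx_norm (x.2 - y.2) (gpow (- x.1)).
apply: le_lt_trans h1 _.
apply: (@le_lt_trans _ _ (b * `|x.2 - y.2|)); first by rewrite ler_wpM2r // lerDl.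
by rewrite mulrC -ltr_pdivlMr.
Qed.

Lemma affG_second_countable : second_countable (T := G).
Proof.
pose C := (int * {ffun 'I_d.+1 -> rat} * nat)%type.
pose D (c : C) : set G := [set x | c.1.1 = x.1 /\ `|(\row_i ratr (c.1.2 i)) - x.2| < c.2.+1%:R^-1].
exists (range D); first exact: (sub_countable (card_image_le _ _) (countableP _)).
split.
  move=> _ [c _ <-]; apply: affG_openP => x [h1 h2].
  exists (c.2.+1%:R^-1 - `|\row_i ratr (c.1.2 i) - x.2|); first by rewrite subr_gt0.
  move=> y xy; rewrite ltrBrDl => h; split; first by rewrite -xy.
  by apply: le_lt_trans h; exact: ler_distD.
move=> x S /nbhs_ballP[e /= e0 he].
pose e' := Num.min 1 e; have e'0 : 0 < e' by rewrite lt_min ltr01.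
have e'1 : e' <= 1 by rewrite ge_min lexx.
have e'e : e' <= e by rewrite ge_min lexx orbT.
pose q := Num.truncn (2 / e').
have rq : (q.+1%:R^-1 : R) <= e' / 2.
  by rewrite -[e' / 2]invrK invf_div lef_pV2 ?posrE ?ltr0n ?divr_gt0 // ltW // truncnS_gt.
have q0 : 0 < q.+1%:R^-1 / 2 :> R by rewrite divr_gt0 // invr_gt0 ltr0n.
have /choice[g hg] : forall i : 'I_d.+1, exists t : rat, `|ratr t - x.2 0 i| <= q.+1%:R^-1 / 2.
  move=> i; have [|t] := @rat_in_itvoo R (x.2 0 i - q.+1%:R^-1 / 2) (x.2 0 i + q.+1%:R^-1 / 2).
    by rewrite ltrD2l (lt_trans _ q0) // oppr_lt0.
  rewrite in_itv /= => /andP[h1 h2]; exists t.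
  by rewrite ler_distl (ltW h1) (ltW h2).
have hx : `|\row_i ratr (g i) - x.2| < q.+1%:R^-1.
  apply: (@le_lt_trans _ _ (q.+1%:R^-1 / 2)).
    by apply: rV_norm_le; [exact: ltW|move=> i; rewrite !mxE].
  by rewrite gtr_pMr ?invr_gt0 ?ltr0n // invf_lt1 // ltr1n.
exists (D (x.1, [ffun i => g i], q)).
  split; first by exists (x.1, [ffun i => g i], q).
  by split => //=; under eq_mx do rewrite ffunE.
move=> y [/= h1]; under eq_mx do rewrite ffunE; move=> h2.
apply: he; apply: (le_ball e'e); apply/affG_ballP => //; split => //.
apply: le_lt_trans (ler_distD (\row_i ratr (g i)) _ _) _.
rewrite distrC (splitr e'); apply: ltrD; exact: lt_le_trans rq.
Qed.

Definition affG_sheet (n : int) (u : 'rV[R]_d.+1) : G := (n, u).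

Lemma affG_sheet_continuous n : continuous (affG_sheet n).
Proof.
apply/ball_continuousP => u e e0; exists (Num.min 1 e); first by rewrite lt_min ltr01.
move=> v; rewrite -ball_normE /= => h; apply: (@le_ball _ _ _ (Num.min 1 e)).
  by rewrite ge_min lexx orbT.
by apply/affG_ballP; rewrite ?ge_min ?lexx.
Qed.

Lemma affG_snd_continuous : continuous (snd : G -> 'rV[R]_d.+1).
Proof.
apply/ball_continuousP => x e e0; exists (Num.min 1 e); first by rewrite lt_min ltr01.
move=> y /affG_ballP; rewrite ge_min lexx => /(_ isT)[_]; rewrite lt_min => /andP[_ h].
by rewrite -ball_normE.
Qed.

Lemma affG_sheet_open n : open [set x : G | x.1 = n].
Proof. by apply: affG_openP => x <-; exists 1 => // y ->. Qed.

Definition affG_chart (n : int) : chart R d.+1 G :=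
  @Chart R d.+1 G [set x | x.1 = n] setT snd (affG_sheet n) (affG_sheet_open (n:=n)) openT
    (fun _ _ => I) (fun _ _ => erefl)
    (fun x (h : x.1 = n) => let: erefl := h in
       match x return (affG_sheet x.1 x.2 = x) with (a, b) => erefl end)
    (fun _ _ => erefl)
    (fun x _ => @affG_snd_continuous x) (fun x _ => @affG_sheet_continuous n x).

Lemma affG_lie_group : lie_group R d.+1 G.
Proof.
split.
- exact: (@metric_hausdorff R G).
- exact: affG_second_countable.
- exact: affG_mul_continuous.
- exact: affG_inv_continuous.
exists (range affG_chart); split.
- split; first by move=> x; exists (affG_chart x.1); first by exists x.1.
  move=> _ _ [n _ <-] [m _ <-]; apply: affine_smooth; first by move=> x; exact: cvg_id.
  by exists id => x v h.
- move=> _ _ _ [n _ <-] [m _ <-] [l _ <-].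
  rewrite (_ : (fun uv => _) = (fun uv : 'rV[R]_d.+1 * 'rV[R]_d.+1 => uv.2 *m gpow n + uv.1)) //.
  apply: affine_smooth.
    move=> uv; apply: cvgD; last exact: cvg_fst.
    apply: (@continuous_comp _ _ _ (fun uv : 'rV[R]_d.+1 * 'rV[R]_d.+1 => uv.2) (fun u => u *m gpow n)).
      exact: cvg_snd.
    exact: mulmx_continuous.
  exists (fun uv => uv.2 *m gpow n + uv.1) => x v h /=.
  by rewrite mulmxDl -scalemxAl scalerDr addrACA.
- move=> _ _ [n _ <-] [m _ <-].
  rewrite (_ : (fun u => _) = (fun u : 'rV[R]_d.+1 => - (u *m gpow (- n)))) //.
  have mc := @mulmx_continuous R d.+1 (gpow (- n)).
  apply: affine_smooth; first by move=> u; exact: (cvgN (mc u)).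
  exists (fun u => - (u *m gpow (- n))) => x v h /=.
  by rewrite mulmxDl -scalemxAl opprD scalerN.
Qed.

(** An upper bound for the lower central series: no integer part, and translations in the image of
    (A - 1)^j. It holds from index 1 on, as the whole group has nonzero integer parts. *)
Definition affG_level (j : nat) : set G :=
  [set x | x.1 = 0 /\ exists t, x.2 = t *m rmx R ((A - 1) ^+ j)].

Lemma affG_level_subgroup j : subgroup (affG_level j).
Proof.
split.
- by split => //; exists 0; rewrite mul0mx.
- move=> x y [x1 [t xt]] [y1 [t' yt]]; split; first by rewrite /= x1 y1 addr0.
  by exists (t' + t); rewrite /= x1 gpow0 mulmx1 xt yt mulmxDl.
- move=> x [x1 [t xt]]; split; first by rewrite /= x1 oppr0.
  by exists (- t); rewrite /= x1 oppr0 gpow0 mulmx1 xt mulNmx.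
Qed.

Lemma gpow_sub1 n : exists Q : 'M[int]_d.+1, A ^ n - 1 = Q * (A - 1) /\ GRing.comm Q (A - 1).
Proof.
have cA (M : 'M[int]_d.+1) : GRing.comm M A -> GRing.comm M (A - 1).
  by move=> h; apply: commrB => //; exact: commr1.
have nat_case (m : nat) : exists Q : 'M[int]_d.+1, A ^+ m - 1 = Q * (A - 1) /\ GRing.comm Q A.
  have cS : GRing.comm (\sum_(i < m) A ^+ i) A.
    by apply: commr_sym; apply: commr_sum => i _; exact: commrX.
  by exists (\sum_(i < m) A ^+ i); rewrite subrX1; split => //; rewrite (cA _ cS).
case: n => m; first by have [Q [h1 h2]] := nat_case m; exists Q; split => //; exact: cA.
have [Q [h1 h2]] := nat_case m.+1.
have cV : GRing.comm (A ^- m.+1) A.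
  by apply: commr_sym; apply: commrV; exact: commrX.
exists (- (A ^- m.+1 * Q)); split; last by apply: cA; apply: commr_sym; apply: commrN; apply: commrM; exact: commr_sym.
rewrite NegzE -exprnN mulNr -mulrA -h1 mulrBr mulr1 mulVr ?unitrX //.
by rewrite opprB.
Qed.

(** The integer parts of a commutator cancel, and its translation part is built from differences w
    A^n - w, all divisible by A - 1. If one entry has integer part 0, a single difference of its own
    translation part remains, and one more power of A - 1 is gained. *)
Lemma affG_lower_central j : lower_central (G:=G) j.+1 `<=` affG_level j.+1.
Proof.
have key (w : 'rV[R]_d.+1) n : exists Q : 'M[int]_d.+1,
    [/\ w *m gpow n - w = w *m rmx R Q *m rmx R (A - 1) & GRing.comm Q (A - 1)].
  have [Q [h1 h2]] := gpow_sub1 n; exists Q; split => //.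
  rewrite -mulmxA -rmxM -[Q *m _]/(Q * _) -h1 /rmx map_mxB mulmxBr -/(rmx _ _) -/(gpow n).
  by rewrite -/(rmx R 1) rmx1 mulmx1.
have commE (x y : G) : [~ x, y]%g = (0, (x.2 *m gpow (- x.1) *m gpow (- y.1) - x.2 *m gpow (- x.1))
    - (y.2 *m gpow (- y.1) *m gpow (- x.1) - y.2 *m gpow (- y.1))) :> G.
  congr pair => /=; first by lia.
  rewrite !mulmxDl !mulNmx -!mulmxA -!gpowD.
  have -> : x.1 + (- y.1 - x.1) = - y.1 by lia.
  rewrite [- x.1 - y.1]addrC opprB -!addrA addrC -!addrA; congr (_ + _).
  rewrite addrC -!addrA; congr (_ + _); exact: addrC.
elim: j => [|j IH]; apply: smallest_sub; try exact: affG_level_subgroup.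
- move=> _ [x [y [_ ->]]]; rewrite commE; split => //=.
  have [Q [-> _]] := key (x.2 *m gpow (- x.1)) (- y.1).
  have [Q' [-> _]] := key (y.2 *m gpow (- y.1)) (- x.1).
  by rewrite -mulmxBl -{2}[A - 1]expr1; eexists.
- move=> _ [x [y [/IH[x1 [t xt]] ->]]]; rewrite commE; split => //=.
  rewrite x1 oppr0 gpow0 !mulmx1 subrr subr0.
  have [Q [-> cQ]] := key x.2 (- y.1); exists (t *m rmx R Q).
  rewrite xt -!mulmxA -!rmxM; congr (_ *m rmx R _).
  rewrite -[LHS]/((A - 1) ^+ j.+1 * (Q * (A - 1))) -[RHS]/(Q * (A - 1) ^+ j.+2).
  by rewrite [(A - 1) ^+ j.+2]exprSr !mulrA; congr (_ * _); apply: commr_sym; exact: commrX.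
Qed.

Lemma affG_nilpotent s : (0 < s)%N -> (A - 1) ^+ s = 0 -> nilpotent_of_step G s.
Proof.
case: s => // s _ N0; apply/seteqP; split => [x /affG_lower_central[x1 [t]]|_ ->].
  by rewrite N0 /rmx map_mx0 mulmx0 => x2; case: x x1 x2 => a b /= -> ->.
by have [[]] := lower_central_normal G s.+1.
Qed.

Definition affG_lattice : set G := [set x | intv x.2].

Lemma intvN (u : 'rV[R]_d.+1) : intv (- u) = intv u.
Proof. by apply/intvP/intvP => h i; have := h i; rewrite !mxE rpredN. Qed.

Lemma affG_lattice_discrete : affG_lattice `<=` isolated affG_lattice.
Proof.
move=> x Lx; split; first by rewrite inE.
exists (ball x 1); first exact: nbhsx_ballx.
apply/seteqP; split => [y [/affG_ballP]|_ ->]; last by split => //; exact: ballxx.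
rewrite lexx => /(_ isT)[h1 h2] Ly; case: x y Lx h1 h2 Ly => [n u] [m v] /= /intvP Lu -> h2 /intvP Lv.
congr pair; apply/rowP => i; apply/eqP; rewrite eq_sym -subr_eq0.
have := rV_norm_entry (u - v) i; rewrite !mxE => h3.
have /intrP[z hz] : u 0 i - v 0 i \is a Num.int by rewrite rpredB.
move: (le_lt_trans h3 h2); rewrite hz -intr_norm -[X in _ < X]/(1%:~R) ltr_int intr_eq0.
clear; lia.
Qed.

Lemma aff_homeo (al : 'rV[R]_d.+1) : homeomorphism (aff A al).
Proof.
have AV : A *m A^-1 = 1%:M by exact: mulrV.
have VA : A^-1 *m A = 1%:M by exact: mulVr.
split; first by apply: lipschitz_continuous; exact: aff_lipschitz.
exists (aff A^-1 (- (al *m rmx R A^-1))); split.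
- by apply: lipschitz_continuous; exact: aff_lipschitz.
- by move=> x; rewrite aff_comp AV addrN aff1.
- by move=> x; rewrite aff_comp VA mulNmx -mulmxA -rmxM VA rmx1 mulmx1 addNr aff1.
Qed.

Lemma aff_invariant (al : 'rV[R]_d.+1) : invariant_measure (aff A al) (haar R d.+1).
Proof. by move=> C bC; apply: (@haar_aff _ _ A A^-1) => //; exact: mulrV. Qed.

Definition aff_system (al : 'rV[R]_d.+1) : system R :=
  @System R (torus R d.+1) (@torus_compact R d.+1) (aff A al) (aff_homeo al) (haar R d.+1) (aff_invariant al).

(** The affine group acts transitively on the torus; the stabilizer of 0 consists of the pairs with
    integral translation part, and [(1, al)] acts as [aff A al]. *)
Lemma aff_nilsystem s al : (0 < s)%N -> (A - 1) ^+ s = 0 -> nilsystem s (aff_system al).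
Proof.
move=> s0 N0; pose p (x : G) : torus R d.+1 := tproj x.2.
have pM (h a : G) : p (h * a)%g = aff (A ^ h.1) h.2 (p a) by rewrite /p aff_proj.
exists d.+1, G, affG_lattice, (1, al), p; split.
- by split; [exact: affG_lie_group|exact: affG_nilpotent].
- split; last exact: affG_lattice_discrete; split.
  + by apply/intvP => i; rewrite mxE rpred0.
  + move=> x y /intvP h1 h2; have /intvP h3 := intv_mul (A ^ x.1) h2.
    by apply/intvP => i; rewrite mxE rpredD.
  + by move=> x h; rewrite /affG_lattice /= intvN; exact: intv_mul.
- split.
  + by move=> y; exists (0, tval y); rewrite /p tproj_val.
  + move=> a b; rewrite tprojP /affG_lattice /=.
    rewrite -[X in _ <-> is_true (intv X)]mulmxBl -intvN opprB; split; first exact: intv_mul.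
    move=> /(intv_mul (A ^ a.1)).
    by rewrite -mulmxA -/(gpow _) -/(gpow _) gpowNK mulmx1.
  + move=> U; split.
      by move=> oU; apply: open_comp => // x _; apply: continuous_comp; [exact: affG_snd_continuous|exact: tproj_continuous].
    move=> oU; rewrite openE => y Uy.
    have : (p @^-1` U) (0, tval y) by rewrite /= /p tproj_val.
    move: oU; rewrite openE => /[apply] /nbhs_ballP[e /= e0 he].
    apply/nbhs_ballP; exists (Num.min 1 e) => /=; first by rewrite lt_min ltr01.
    move=> z; rewrite torus_ballE /=; have [v -> <-] := torus_lift y z => vr.
    have := he (0, tval y + v); rewrite /= /p; apply.
    apply: (@le_ball _ _ _ (Num.min 1 e)); first by rewrite ge_min lexx orbT.
    by apply/affG_ballP; rewrite ?ge_min ?lexx //= opprD addrA subrr add0r normrN.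
- by move=> a; rewrite pM expr1z.
- move=> h B bB.
  pose be := - (h.2 *m rmx R (A ^ (- h.1))).
  have -> : [set p (h * a)%g | a in p @^-1` B] = aff (A ^ (- h.1)) be @^-1` B.
    have pow_mul (n : int) : A ^ n *m A ^ (- n) = 1%:M.
      by rewrite -[LHS]/(A ^ n * A ^ (- n)) -exprzDr // addrN expr0z.
    apply/seteqP; split => [_ [a Ba <-]|y By] /=.
      by rewrite pM aff_comp pow_mul addrN aff1.
    have [y' hy'] : exists y', y' = aff (A ^ (- h.1)) be y by eexists.
    exists (0, tval y'); rewrite ?pM /= /p /= tproj_val; first by rewrite hy'.
    rewrite hy' aff_comp.
    have := pow_mul (- h.1); rewrite opprK => ->.
    by rewrite /be mulNmx -mulmxA -/(gpow _) -/(gpow _) gpowNK mulmx1 addNr aff1.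
  apply: (@haar_aff _ _ _ (A ^ h.1)) => //.
  by rewrite -[LHS]/(A ^ (- h.1) * A ^ h.1) -exprzDr // addNr expr0z.
Qed.

End affine_group.

(** * Maximality of the factor forgetting the top fibre *)

Section partial_integral.
Context d1 d2 (T1 : measurableType d1) (T2 : measurableType d2) (R : realType)
  (P1 : probability T1 R) (P2 : probability T2 R).

Lemma bmeas_partial (f : T1 * T2 -> R) : bmeas f -> bmeas (fun y => expect P1 (fun x => f (x, y))).
Proof.
move=> bf; split.
  have h := measurable_fubini_G (bmeas_integrable (P1 \x P2)%E bf).
  exact: (measurableT_comp (@fine_measurable R setT measurableT) h).
have [_ [M hM]] := bf; exists M => y; apply: expect_norm => //.
by apply: (bmeas_comp _ bf); exact: measurable_pair2.
Qed.

Lemma bmeas_partial1 (f : T1 * T2 -> R) : bmeas f -> bmeas (fun x => expect P2 (fun y => f (x, y))).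
Proof.
move=> bf; split.
  have h := measurable_fubini_F (bmeas_integrable (P1 \x P2)%E bf).
  exact: (measurableT_comp (@fine_measurable R setT measurableT) h).
have [_ [M hM]] := bf; exists M => x; apply: expect_norm => //.
by apply: (bmeas_comp _ bf); exact: measurable_pair1.
Qed.

Lemma expect_prod_swap (f : T1 * T2 -> R) : bmeas f ->
  expect (P1 \x P2)%E f = expect P2 (fun y => expect P1 (fun x => f (x, y))).
Proof.
move=> bf; rewrite /expect /Rintegral.
rewrite -(integral21_prod_meas1 (bmeas_integrable (P1 \x P2)%E bf)).
congr fine; apply: eq_integral => y _; rewrite /fubini_G fineK //.
apply: integrable_fin_num => //.
have : bmeas (fun x => f (x, y)).
  by apply: (bmeas_comp _ bf); exact: measurable_pair2.
by move/(bmeas_integrable P1).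
Qed.

End partial_integral.

Section sections.
Variables (R : realType) (d : nat).

Lemma expect_haar_succ (f : torus R d.+1 -> R) : bmeas (f : borel (torus R d.+1) -> R) ->
  bmeas (f \o @tcons R d : borel (torus R 1) * borel (torus R d) -> R) /\
  expect (haar R d.+1) f = expect (circle_haar R \x haar R d)%E (f \o @tcons R d).
Proof.
move=> bf; split; first exact: (bmeas_comp (@measurable_tcons R d) bf).
exact: expect_push.
Qed.

Lemma tcons_lipschitz (t : torus R 1) : lipschitz (fun y : torus R d => tcons (t, y)).
Proof.
exists 1 => // x y; rewrite mul1r; apply: tdist_le => [|i]; first exact: tdist_ge0.
rewrite !tcons_val /= -(@splitK 1 d i); case: (@fintype.split 1 d i) => j /=.
  by rewrite !(@row_mxEl R 1 1 d) subrr dZ0 tdist_ge0.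
by rewrite !(@row_mxEr R 1 1 d); exact: tdist_entry.
Qed.

Definition drop0 (y : torus R d.+1) : torus R d := tproj (rsubmx (tval y : 'rV_(1 + d))).

Lemma drop0_tcons t y : drop0 (tcons (t, y)) = y.
Proof. by rewrite /drop0 tcons_val /= row_mxKr tproj_val. Qed.

Lemma drop0_val y i : tval (drop0 y) 0 i = tval y 0 (rshift 1 i : 'I_d.+1).
Proof.
rewrite /drop0 /= !mxE frac_id //; have /forallP := tval_in y; exact.
Qed.

Lemma drop0_lipschitz : lipschitz drop0.
Proof.
exists 1 => // x y; rewrite mul1r; apply: tdist_le => [|i]; first exact: tdist_ge0.
by rewrite !drop0_val; exact: tdist_entry.
Qed.

Lemma drop0_haar A : borel_set A -> haar R d.+1 (drop0 @^-1` A) = haar R d A.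
Proof.
move=> bA; have md := measurable_lipschitz drop0_lipschitz.
rewrite -(pushE (haar R d.+1) md); apply: haar_unique => // m c m0.
rewrite expect_push; last exact: bmeas_tchar.
have [bf ->] := expect_haar_succ (bmeas_lipschitz drop0_lipschitz (bmeas_tchar m c)).
rewrite expect_prod //; under eq_fun do (under eq_fun do rewrite /= drop0_tcons; rewrite haar_char //).
exact: expect_cst.
Qed.

Lemma expect_pos (X : pmetricType R) (P : probability (borel X) R) (f : X -> R) :
  bmeas (f : borel X -> R) -> (forall x, 0 <= f x) -> expect P f = 0 -> exists x, f x = 0.
Proof.
move=> bf f0 Ef; have [|B [bB mB hB]] := @expect_orth_continuous R X P f bf.
  move=> g gc g01; apply/eqP; rewrite eq_le; apply/andP; split; last first.
    by apply: expect_ge0 => x; rewrite mulr_ge0 //; have /andP[] := g01 x.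
  have bg : bmeas (g : borel X -> R).
    by apply: (@bmeas_continuous R X g 1) => //; exact: min1_norm.
  rewrite -Ef -subr_ge0 -expectB //; last exact: bmeasM.
  apply: expect_ge0 => x; rewrite subr_ge0 ler_piMr //; by have /andP[] := g01 x.
apply: contrapT => hn; have BT : B = setT.
  by apply/seteqP; split => // x _; apply: hB => /= h; apply: hn; exists x.
by move: mB; rewrite BT probability_setT => /eqP; rewrite eqe oner_eq0.
Qed.

(** By Fubini the measure of the bad section at [t] has mean 0, hence vanishes for some [t]. *)
Lemma ae_section (P : torus R d.+1 -> Prop) : {ae haar R d.+1, forall y, P y} ->
  exists t, {ae haar R d, forall y, P (tcons (t, y))}.
Proof.
move=> [B [bB mB hB]]; have bI : bmeas (\1_B : borel (torus R d.+1) -> R) by exact: bmeas_indic.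
have [bf E] := expect_haar_succ bI.
move: E; rewrite expect_indic // mB /= expect_prod // => E.
have bS t : borel_set ((fun y : torus R d => tcons (t, y)) @^-1` B).
  by rewrite -[_ @^-1` _]setTI; exact: (measurable_lipschitz (tcons_lipschitz t)).
have [||t ht] := @expect_pos _ (circle_haar R) (fun t => expect (haar R d) (fun y => (\1_B : _ -> R) (tcons (t, y)))) _ _ (esym E).
- exact: (bmeas_partial1 (circle_haar R) (haar R d) bf).
- by move=> t; apply: expect_ge0 => y; rewrite indicE.
exists t; exists ((fun y : torus R d => tcons (t, y)) @^-1` B); split; first exact: bS.
  have := @expect_indic _ (borel (torus R d)) R (haar R d) _ (bS t).
  rewrite [LHS](_ : _ = 0); last by rewrite -ht; congr expect; apply/funext => y; rewrite !indicE.
  move=> h; apply/eqP; rewrite -[X in X == _]fineK; last by apply: fin_num_measure; exact: bS.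
  by rewrite -h.
by move=> y /= nP; exact: hB.
Qed.

End sections.

Lemma ae_imp d (T : measurableType d) (R : realType) (P : probability T R) (A C : T -> Prop) :
  (forall x, A x -> C x) -> {ae P, forall x, A x} -> {ae P, forall x, C x}.
Proof. by move=> h; apply: filterS. Qed.

Lemma ae_imp2 d (T : measurableType d) (R : realType) (P : probability T R) (A B C : T -> Prop) :
  (forall x, A x -> B x -> C x) -> {ae P, forall x, A x} -> {ae P, forall x, B x} ->
  {ae P, forall x, C x}.
Proof.
move=> h hA hB; have : {ae P, forall x, A x /\ B x} by exact: filterI hA hB.
by apply: filterS => x [hx hx']; exact: h.
Qed.

(** * Orthogonality of nilfactors to the fibre characters *)

Section fiber_invariance.
Variables (R : realType) (d s : nat) (S : torus R d.+1 -> torus R d.+1).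
Let Y := torus R d.+1.
Hypothesis lS : lipschitz S.
Hypothesis pS : forall A, borel_set A -> haar R d.+1 (S @^-1` A) = haar R d.+1 A.
(* Along an orbit, a character that is nontrivial on the fibres of [drop0] oscillates like a
   polynomial of degree [s + 1] with irrational leading coefficient. *)
Hypothesis fiber_phase : forall (m : 'rV[int]_d.+1) c, m 0 0 != 0 -> exists2 g, irr g &
  forall y : Y, exists2 u, phase s.+1 g u & forall n, tchar m c (iter n S y) = tc (u n).

Lemma drop0_proj (u : 'rV[R]_d.+1) : drop0 (tproj u) = tproj (rsubmx (u : 'rV_(1 + d))).
Proof.
apply/tprojP/intvP => i; have /intvP/(_ (rshift 1 i)) := tval_proj u.
by rewrite !mxE.
Qed.

Lemma drop0_shift (v : 'rV[R]_d.+1) (y : Y) : (forall i, i != ord0 -> v 0 i = 0) ->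
  drop0 (tshift v y) = drop0 y.
Proof.
move=> v0; rewrite /tshift drop0_proj /drop0; congr tproj; apply/rowP => i.
by rewrite !mxE v0 ?addr0.
Qed.

Lemma ae_pull (f : Y -> Y) (P : Y -> Prop) : measurable_fun setT (f : borel Y -> borel Y) ->
  (forall A, borel_set A -> haar R d.+1 (f @^-1` A) = haar R d.+1 A) ->
  {ae haar R d.+1, forall y, P y} -> {ae haar R d.+1, forall y, P (f y)}.
Proof.
move=> mf pf [B [bB mB hB]]; exists (f @^-1` B); split.
- by rewrite -[_ @^-1` _]setTI; exact: mf.
- by rewrite -mB; exact: pf.
- by move=> y /= nP; exact: hB.
Qed.

Lemma iter_preserves n : measurable_fun setT (iter n S : borel Y -> borel Y) /\
  forall A, borel_set A -> haar R d.+1 (iter n S @^-1` A) = haar R d.+1 A.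
Proof.
have l m : lipschitz (iter m S).
  elim: m => [|m IH]; first exact: lipschitz_id.
  exact: (lipschitz_comp lS IH).
split; first exact: measurable_lipschitz.
elim: n => // n IH A bA; rewrite -[LHS]/(haar R d.+1 (iter n S @^-1` (S @^-1` A))) IH ?pS //.
by rewrite -[_ @^-1` _]setTI; exact: (measurable_lipschitz lS).
Qed.

Section one_factor.
Variables (N : system R) (f : Y -> N).
Hypothesis nN : nilsystem s N.
Hypothesis mf : measurable_fun setT (f : borel Y -> borel N).
Hypothesis fS : {ae haar R d.+1, forall y, trans N (f y) = f (S y)}.

Lemma iter_factor n : {ae haar R d.+1, forall y, f (iter n S y) = iter n (trans N) (f y)}.
Proof.
elim: n => [|n IH]; first by apply: nearW.
have [mi pi] := iter_preserves n.
by apply: ae_imp2 (ae_pull mi pi fS) IH => y /= h1 h2; rewrite -h1 h2.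
Qed.

(** By invariance the integral equals that of the average along the orbit, which is uniformly small:
    an orbit of a nilsystem of step s meets a phase of degree s + 1. *)
Lemma fiber_orthogonal (phi : N -> R) (m : 'rV[int]_d.+1) c : continuous phi ->
  (forall x, 0 <= phi x <= 1) -> m 0 0 != 0 ->
  expect (haar R d.+1) (fun y => phi (f y) * tchar m c y) = 0.
Proof.
move=> cphi phi01 m0; have [g ig hg] := fiber_phase c m0.
have cT n : continuous (phi \o iter n (trans N)).
  elim: n => [|n IH]; first exact: cphi.
  move=> x; rewrite (_ : phi \o _ = (phi \o iter n (trans N)) \o trans N).
    apply: continuous_comp; last exact: IH.
    by have [h _] := trans_homeo N; exact: h.
  by apply/funext => z; rewrite /= -iterS iterSr.
have bT n : bmeas ((fun y : Y => phi (iter n (trans N) (f y)) * tchar m c (iter n S y)) : borel Y -> R).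
  have bp : bmeas (phi \o iter n (trans N) : borel N -> R).
    by apply: (@bmeas_continuous R N _ 1) => //; apply: min1_norm => x; exact: phi01.
  exact: (bmeasM (bmeas_comp mf bp) (bmeas_comp (iter_preserves n).1 (bmeas_tchar m c))).
have E n : expect (haar R d.+1) (fun y => phi (iter n (trans N) (f y)) * tchar m c (iter n S y)) =
    expect (haar R d.+1) (fun y => phi (f y) * tchar m c y).
  have [mi pi] := iter_preserves n.
  have b0 := bT 0%N; rewrite -(expect_haar_preserved mi pi b0).
  apply: expect_ae; [exact: bT|exact: (bmeas_comp mi b0)|].
  by apply: ae_imp (iter_factor n) => y /= ->.
apply/eqP; rewrite -normr_le0; apply/ler_addgt0Pr => e e0; rewrite add0r.
have [M hM] := nilsystem_phase_sum nN cphi ig e0.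
have bs : bmeas ((fun y => \sum_(i < M.+1) phi (iter i (trans N) (f y)) * tchar m c (iter i S y)) : borel Y -> R).
  by apply: (@bmeas_sum _ (borel Y) R 'I_M.+1 _
    (fun i y => phi (iter i (trans N) (f y)) * tchar m c (iter i S y))) => i; exact: bT.
have bnd y : `|\sum_(i < M.+1) phi (iter i (trans N) (f y)) * tchar m c (iter i S y)| <= e * M.+1%:R.
  have [u hu hy] := hg y.
  by under eq_bigr do rewrite hy; exact: (hM _ (leqnSn M)).
have := expect_norm (haar R d.+1) bs bnd.
rewrite (@expect_sum _ (borel Y) R (haar R d.+1) 'I_M.+1 _
    (fun i y => phi (iter i (trans N) (f y)) * tchar m c (iter i S y))) => [|i]; last exact: bT.
rewrite (eq_bigr (fun=> expect (haar R d.+1) (fun y => phi (f y) * tchar m c y))); last by move=> i _; exact: E.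
by rewrite sumr_const card_ord -[X in `|X|]mulr_natl normrM normr_nat mulrC ler_pM2r ?ltr0n.
Qed.

(* [g] integrates [phi \o f] over the fibres of [drop0]; both sides have the same integral
   against every character. *)
Lemma fiber_average (phi : N -> R) : continuous phi -> (forall x, 0 <= phi x <= 1) ->
  exists2 g : torus R d -> R, bmeas (g : borel (torus R d) -> R) &
  {ae haar R d.+1, forall y, phi (f y) = g (drop0 y)}.
Proof.
move=> cphi phi01; have bp : bmeas (phi : borel N -> R).
  by apply: (@bmeas_continuous R N _ 1) => //; exact: min1_norm.
have bF : bmeas (phi \o f : borel Y -> R) := bmeas_comp mf bp.
have [bFt _] := expect_haar_succ bF.
pose g (y : torus R d) : R := expect (circle_haar R) (fun t => (phi \o f) (tcons (t, y))).
have bg : bmeas (g : borel (torus R d) -> R) := bmeas_partial (circle_haar R) (haar R d) bFt.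
have bgd : bmeas (g \o @drop0 R d : borel Y -> R) := bmeas_lipschitz (@drop0_lipschitz R d) bg.
exists g => //; pose G (y : Y) := phi (f y) - g (drop0 y).
have bG : bmeas (G : borel Y -> R).
  by rewrite /G; under eq_fun do rewrite -mulN1r; exact: (bmeasD bF (bmeasZ (-1) bgd)).
have Echar (m : 'rV[int]_d.+1) c : expect (haar R d.+1) (fun y => G y * tchar m c y) = 0.
  have bt := bmeas_tchar (R := R) m c.
  have b1 := bmeasM bF bt; have b2 := bmeasM bgd bt.
  have -> : expect (haar R d.+1) (fun y => G y * tchar m c y) =
      expect (haar R d.+1) (fun y => phi (f y) * tchar m c y) -
      expect (haar R d.+1) (fun y => g (drop0 y) * tchar m c y).
    by rewrite -expectB //; congr expect; apply/funext => y; rewrite /G mulrBl.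
  have [m0|m0] := eqVneq (m 0 0) 0; last first.
    rewrite fiber_orthogonal // sub0r; apply/eqP; rewrite oppr_eq0; apply/eqP.
    have m0' : (m 0 0)%:~R != 0 :> R by rewrite intr_eq0.
    (* A translation of the fibre by half a period of the character changes its sign and leaves g
       (drop0 y) unchanged. *)
    apply: (@expect_antisym _ _ ((2 * (m 0 0)%:~R)^-1 *: delta_mx 0 0)) => // y.
    rewrite drop0_shift => [|i /negbTE i0]; last by rewrite !mxE i0 andbF mulr0.
    rewrite -mulrN tchar_shift; congr (_ * _).
    rewrite /tchar -tc_half; congr tc.
    rewrite [dotp m (_ *: _)](_ : _ = 2^-1); first by ring.
    rewrite /dotp big_ord_recl big1 => [|i _]; last by rewrite !mxE /= mulr0 mulr0.
    by rewrite !mxE eqxx mulr1 addr0 invfM mulrCA mulfV // mulr1.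
  pose m' : 'rV[int]_d := \row_i m 0 (lift ord0 i).
  have tE y : tchar m c y = tchar m' c (drop0 y).
    rewrite /tchar; congr (tc (_ + _)); rewrite /dotp big_ord_recl m0 mul0r add0r.
    apply: eq_bigr => i _; rewrite drop0_val mxE; congr (_ * tval y 0 _).
    exact: val_inj.
  have [b1t E1] := expect_haar_succ b1; have [b2t E2] := expect_haar_succ b2.
  rewrite [X in X - _]E1 [X in _ - X]E2 !expect_prod_swap //; apply/eqP; rewrite subr_eq0; apply/eqP.
  congr expect; apply/funext => y.
  have -> : (fun t => ((fun y => phi (f y) * tchar m c y) \o @tcons R d) (t, y)) =
      (fun t => tchar m' c y * (phi \o f) (tcons (t, y))).
    by apply/funext => t /=; rewrite tE drop0_tcons mulrC.
  have -> : (fun t => ((fun y => g (drop0 y) * tchar m c y) \o @tcons R d) (t, y)) =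
      (fun=> g y * tchar m' c y).
    by apply/funext => t /=; rewrite tE drop0_tcons.
  have bv : bmeas ((fun t => (phi \o f) (tcons (t, y))) : borel (torus R 1) -> R).
    by apply: (bmeas_comp _ bFt); exact: measurable_pair2.
  by rewrite expect_cst (expectZ (circle_haar R) (tchar m' c y) bv) mulrC.
have Etrig h : trig h -> expect (haar R d.+1) (fun y => G y * h y) = 0.
  elim=> [m c|h1 h2 t1 e1 t2 e2|a {}h t e1]; first exact: Echar.
  - under eq_fun do rewrite mulrDr.
    by rewrite expectD ?e1 ?e2 ?addr0 //; apply: bmeasM => //; exact: bmeas_trig.
  - under eq_fun do rewrite mulrCA.
    by rewrite expectZ ?e1 ?mulr0 //; apply: bmeasM => //; exact: bmeas_trig.
have G0 : {ae haar R d.+1, forall y, G y = 0}.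
  apply: expect_orth_continuous => // h ch h01.
  apply/eqP; rewrite -normr_le0; apply/ler_addgt0Pr => e e0; rewrite add0r.
  have [_ [M hM]] := bG; have M0 : 0 <= M by apply: le_trans (hM point).
  have M1 : 0 < M + 1 by rewrite ltr_wpDl.
  have [q tq hq] := trig_dense ch (divr_gt0 e0 M1).
  have bh : bmeas (h : borel Y -> R) by exact: bmeas_torus.
  have bq : bmeas (q : borel Y -> R) by exact: bmeas_trig.
  rewrite -[X in `|X|]subr0 -(Etrig q tq) -expectB; [|exact: bmeasM|exact: bmeasM].
  apply: expect_norm.
    under eq_fun do rewrite -mulrBr; apply: bmeasM => //.
    by under eq_fun do rewrite -mulN1r; apply: bmeasD => //; exact: bmeasZ.
  move=> y; rewrite -mulrBr normrM.
  apply: le_trans (ler_pM (normr_ge0 _) (normr_ge0 _) (hM y) (hq y)) _.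
  by rewrite mulrCA ler_piMr ?(ltW e0) // ler_pdivrMr // mul1r lerDl.
by apply: ae_imp G0 => y /eqP; rewrite subr_eq0 => /eqP.
Qed.

(** A continuous function that is positive exactly on [E] is almost everywhere a function of
    [drop0], and its positivity set descends with it. *)
Lemma fiber_measurable (E : set N) : open E -> exists2 D : set (torus R d), borel_set D &
  {ae haar R d.+1, forall y, E (f y) <-> D (drop0 y)}.
Proof.
move=> oE; have [E0|/set0P En] := eqVneq (~` E) set0.
  exists setT; first exact: (@measurableT _ (borel (torus R d))).
  apply: nearW => y; split => // _; apply: contrapT => h.
  by rewrite -[False]/(set0 (f y)) -E0.
have [phi [cphi phi0 hphi]] := dist_to_closed (open_closedC oE) En.
pose psi x := Num.min 1 (phi x).
have cpsi : continuous psi by move=> x; apply: continuous_min; [exact: cvg_cst|exact: cphi].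
have psi01 x : 0 <= psi x <= 1 by rewrite le_min ler01 phi0 ge_min lexx.
have psiE x : E x <-> 0 < psi x.
  rewrite lt_min ltr01 lt_neqAle phi0 andbT /=; split.
    by move=> Ex; apply/eqP => /esym/hphi; apply.
  by move=> /eqP h; apply: contrapT => nE; apply: h; apply/esym/hphi.
have [g [mg _] hg] := fiber_average cpsi psi01.
exists [set y | 0 < g y].
  have := mg measurableT `]0, +oo[%classic (measurable_itv _); rewrite setTI => h.
  rewrite (_ : [set y | 0 < g y] = g @^-1` `]0, +oo[%classic) //.
  by apply/seteqP; split => y /=; rewrite in_itv /= andbT.
by apply: ae_imp hg => y h; rewrite psiE h.
Qed.

End one_factor.

End fiber_invariance.

Lemma ae_preimage d d' (T : measurableType d) (T' : measurableType d') (R : realType)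
    (P : probability T R) (P' : probability T' R) (f : T -> T') (Q : T' -> Prop) :
  measurable_fun setT f -> (forall B, measurable B -> P (f @^-1` B) = P' B) ->
  {ae P', forall y, Q y} -> {ae P, forall x, Q (f x)}.
Proof.
move=> mf pf [B [bB mB hB]]; exists (f @^-1` B); split.
- by rewrite -[_ @^-1` _]setTI; exact: mf.
- by rewrite -mB; exact: pf.
- by move=> y /= nP; exact: hB.
Qed.

Lemma ae_eq_measure d (T : measurableType d) (R : realType) (P : probability T R) (A B : set T) :
  measurable A -> measurable B -> {ae P, forall x, A x <-> B x} -> P A = P B.
Proof.
move=> mA mB AB; rewrite -[LHS]fineK ?fin_num_measure // -[RHS]fineK ?fin_num_measure //.
congr (_%:E); rewrite -!expect_indic //; apply: expect_ae; [exact: bmeas_indic|exact: bmeas_indic|].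
by apply: ae_imp AB => x h; rewrite !indicE; congr (_%:R); congr nat_of_bool; apply/idP/idP; rewrite !inE => /h.
Qed.

Section factor_maps.
Variable R : realType.
Implicit Types X Y Z : system R.

Lemma ae_factor X Y (pi : X -> Y) (Q : Y -> Prop) : factor_map pi ->
  {ae mu Y, forall y, Q y} -> {ae mu X, forall x, Q (pi x)}.
Proof. by move=> [mpi _ ppi]; exact: (ae_preimage mpi ppi). Qed.

Lemma factor_comp X Y Z (pi : X -> Y) (rho : Y -> Z) : factor_map pi -> factor_map rho ->
  factor_map (rho \o pi).
Proof.
move=> fpi frho; have [mpi epi ppi] := fpi; have [mrho erho prho] := frho; split.
- exact: (measurableT_comp mrho mpi).
- by apply: ae_imp2 (ae_factor fpi erho) epi => x /= h1 h2; rewrite h1 h2.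
- move=> B bB; rewrite -(prho B bB) -ppi //.
  by rewrite -[_ @^-1` _]setTI; exact: mrho.
Qed.

Lemma factor_id X : factor_map (@id X).
Proof. by split => //; exact: nearW. Qed.

Lemma nilsystem_inverse_limit k X : nilsystem k X -> inverse_limit_of_nilsystems k X.
Proof.
move=> nX; exists (fun=> X), (fun=> id), (fun=> id); split => //.
- by move=> _; exact: factor_id.
- by move=> _; exact: factor_id.
- by move=> _; exact: nearW.
move=> A bA; exists A; last by rewrite setDv setUid measure0.
by apply: sub_gen_smallest; exists 0%N => //; exists A => //; rewrite setTI.
Qed.

(** A countable base, numbered through an injection into the natural numbers; a number that is no
    index gives the empty set. *)
Lemma separating_opens X : exists2 E : nat -> set X, (forall n, open (E n)) &
  forall x y : X, (forall n, E n x <-> E n y) -> x = y.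
Proof.
have [B cB [oB hB]] := compact_second_countable (@space_compact R X).
have /countable_injP[f finj] := cB.
pose E n := \bigcup_(U in [set U | B U /\ f U = n]) U.
exists E; first by move=> n; apply: bigcup_open => U [BU _]; exact: oB.
move=> x y h; apply: contrapT => xy.
have [U [oU Ux nUy]] : exists U : set X, [/\ open U, U x & ~ U y].
  exists (~` [set y]); split; [|by []|by move=> /(_ erefl)].
  by apply: closed_openC; apply: accessible_closed_set1; apply: hausdorff_accessible; exact: metric_hausdorff.
have [V [BV Vx] VU] := hB x U (open_nbhs_nbhs (conj oU Ux)).
have : E (f V) y by apply/h; exists V.
move=> [V' [BV' e] V'y]; apply: nUy; apply: VU.
by rewrite (_ : V = V') //; apply: finj; rewrite ?inE.
Qed.

End factor_maps.

(** * Descent of factors along the projection *)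

Section maximality.
Variables (R : realType) (d s : nat) (S : torus R d.+1 -> torus R d.+1) (S' : torus R d -> torus R d).
Let Y := torus R d.+1.
Hypothesis lS : lipschitz S.
Hypothesis pS : forall A, borel_set A -> haar R d.+1 (S @^-1` A) = haar R d.+1 A.
Hypothesis fiber_phase : forall (m : 'rV[int]_d.+1) c, m 0 0 != 0 -> exists2 g, irr g &
  forall y : Y, exists2 u, phase s.+1 g u & forall n, tchar m c (iter n S y) = tc (u n).
Hypothesis dropS : forall y, drop0 (S y) = S' (drop0 y).
Variables (W : system R) (h : Y -> W).
Hypothesis mh : measurable_fun setT (h : borel Y -> borel W).
Hypothesis ph : forall B, borel_set B -> haar R d.+1 (h @^-1` B) = mu W B.
Hypothesis hS : {ae haar R d.+1, forall y, trans W (h y) = h (S y)}.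

Definition fiber_class (N : Type) (f : Y -> N) : set (set N) := [set E |
  exists2 D : set (torus R d), borel_set D & {ae haar R d.+1, forall y, E (f y) <-> D (drop0 y)}].

Lemma fiber_class_sigma_algebra (N : Type) (f : Y -> N) : sigma_algebra setT (fiber_class f).
Proof.
split.
- exists set0; first exact: (@measurable0 _ (borel (torus R d))).
  by apply: nearW.
- move=> E [D bD hD]; exists (~` D); first exact: (@measurableC _ (borel (torus R d))).
  by apply: ae_imp hD => y [h1 h2]; split => [[_ nE] /h2//|nD]; split => // /h1.
- move=> E hE; have /choice[D hD] : forall n, exists D, borel_set D /\
      {ae haar R d.+1, forall y, E n (f y) <-> D (drop0 y)}.
    by move=> n; have [D h1 h2] := hE n; exists D.
  exists (\bigcup_n D n).
    by apply: (@bigcup_measurable _ (borel (torus R d))) => n _; have [] := hD n.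
  have H n : {ae haar R d.+1, forall y, E n (f y) <-> D n (drop0 y)} by have [] := hD n.
  apply: ae_imp (ae_foralln H) => y hy; split => -[n _ hn]; exists n => //; exact/hy.
Qed.

(** The class is a sigma-algebra containing the preimages of the open sets of each nilsystem of the
    tower, hence all that the tower generates; every Borel set of [W] agrees with such a set modulo
    a null set. *)
Lemma fiber_class_borel : inverse_limit_of_nilsystems s W ->
  forall A, borel_set A -> fiber_class h A.
Proof.
move=> [N [p [q [nN fp _ _ gen]]]] A bA.
have pB i (E : set (N i)) : borel_set E -> fiber_class h (p i @^-1` E).
  move=> bE; have [mp ep pp] := fp i.
  have mf : measurable_fun setT (p i \o h : borel Y -> borel (N i)) := measurableT_comp mp mh.
  have ef : {ae haar R d.+1, forall y, trans (N i) ((p i \o h) y) = (p i \o h) (S y)}.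
    by apply: ae_imp2 (ae_preimage mh ph ep) hS => y /= -> ->.
  suff : fiber_class (p i \o h) E by [].
  move: E bE; apply: smallest_sub; first exact: fiber_class_sigma_algebra.
  move=> E oE; have [D bD hD] := fiber_measurable lS pS fiber_phase (nN i) mf ef oE.
  by exists D.
have [B hB AB] := gen A bA.
have [D bD hD] : fiber_class h B.
  move: B hB {AB}; apply: smallest_sub; first exact: fiber_class_sigma_algebra.
  by move=> _ [i _ [E bE <-]]; rewrite setTI; exact: pB.
have bB : borel_set B.
  move: B hB {AB hD}; apply: smallest_sub; first exact: (@sigma_algebra_measurable _ (borel W)).
  move=> _ [i _ [E bE <-]]; have [mp _ _] := fp i; exact: mp.
exists D => //; have nAB : {ae mu W, forall w, A w <-> B w}.
  exists ((A `\` B) `|` (B `\` A)); split => //.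
    by apply: (@measurableU _ (borel W)); apply: (@measurableD _ (borel W)).
  move=> w /= nAw; have [Aw|Aw] := pselect (A w); have [Bw|Bw] := pselect (B w).
  - by case: nAw.
  - by left.
  - by right.
  - by case: nAw.
by apply: ae_imp2 (ae_preimage mh ph nAB) hD => y h1 h2; rewrite h1.
Qed.

(** Countably many open sets separate the points of [W], and almost everywhere each of them is seen
    through [drop0]. So [h] is almost everywhere determined by [drop0], and restricting it to a
    generic section of the fibration gives [theta]. *)
Lemma factor_through_drop0 : inverse_limit_of_nilsystems s W -> exists theta : torus R d -> W,
  [/\ measurable_fun setT (theta : borel (torus R d) -> borel W),
      {ae haar R d, forall y, trans W (theta y) = theta (S' y)},
      forall B, borel_set B -> haar R d (theta @^-1` B) = mu W B &
      {ae haar R d.+1, forall y, theta (drop0 y) = h y}].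
Proof.
move=> lW; have [E oE sepE] := separating_opens W.
have /choice[D hD] : forall n, exists D : set (torus R d),
    {ae haar R d.+1, forall y, E n (h y) <-> D (drop0 y)}.
  by move=> n; have [D _ hD] := fiber_class_borel lW (borel_open (oE n)); exists D.
have hD' := ae_foralln hD.
have [t ht] := ae_section hD'.
pose theta y := h (tcons (t, y)); exists theta.
have mth : measurable_fun setT (theta : borel (torus R d) -> borel W).
  have mt : measurable_fun setT ((fun y => tcons (t, y)) : borel (torus R d) -> borel Y).
    by apply: measurable_lipschitz; exact: tcons_lipschitz.
  by move: (measurableT_comp mh mt).
have md := measurable_lipschitz (@drop0_lipschitz R d).
have thE : {ae haar R d.+1, forall y, theta (drop0 y) = h y}.
  apply: ae_imp2 hD' (ae_preimage md (@drop0_haar R d) ht) => y h1 h2.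
  by apply: sepE => n; rewrite h2 drop0_tcons h1.
split => //.
- have : {ae haar R d.+1, forall y, trans W (theta (drop0 y)) = theta (S' (drop0 y))}.
    have mS := measurable_lipschitz lS.
    have a1 : {ae haar R d.+1, forall y, trans W (theta (drop0 y)) = h (S y)}.
      by apply: ae_imp2 thE hS => y -> ->.
    by apply: ae_imp2 a1 (ae_preimage mS pS thE) => y -> <-; rewrite dropS.
  move=> /ae_section[t1 ht1]; apply: ae_imp ht1 => y; by rewrite drop0_tcons.
- move=> B bB; have bT : borel_set (theta @^-1` B) by rewrite -[_ @^-1` _]setTI; exact: mth.
  rewrite -(drop0_haar bT) -(ph bB); apply: ae_eq_measure.
  - by rewrite -[_ @^-1` _]setTI; exact: md.
  - by rewrite -[_ @^-1` _]setTI; exact: mh.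
  - by apply: ae_imp thE => y /= ->.
Qed.

End maximality.

(** * The example *)

Section tower_algebra.
Variable R : realType.

(** The chain of x-coordinates has length n + 1 and z stands apart, so the exponent is one less than
    the dimension, and the step of the nilsystem is k = n + 1. *)
Lemma tower_pow n : tower_mx n.+2 ^+ n.+1 = 0.
Proof.
have H s (v : 'rV[int]_n.+2) (j : 'I_n.+2) : (n <= j + s)%N -> (v *m tower_mx n.+2 ^+ s.+1) 0 j = 0.
  have E (u : 'rV[int]_n.+2) i : (u *m tower_mx n.+2) 0 i =
      \sum_(l < n.+2 | (l == i.+1 :> nat) && (l.+1 < n.+2)%N) u 0 l.
    rewrite mxE [RHS]big_mkcond; apply: eq_bigr => l _; rewrite !mxE.
    by case: ifP => _; rewrite ?mulr1 ?mulr0.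
  elim: s j => [|s IH] j h; rewrite exprSr mulmxA E big1 // => i /andP[/eqP ij hi].
    by move: hi; rewrite ij !ltnS ltnNge -[nat_of_ord j]addn0 h.
  by apply: IH; rewrite ij addSnnS.
apply/row_matrixP => i; rewrite rowE row0; apply/rowP => j; rewrite H ?mxE //.
exact: leq_addl.
Qed.

Lemma tower_unit d : (1%:M + tower_mx d.+1) \is a GRing.unit.
Proof.
have [N' [h _ _]] := tower_inv R d.+1.
by apply/unitrP; exists (1%:M + N'); split; [exact: h|exact: (mulmx1C h)].
Qed.

Lemma tower_sub1 d : (1%:M + tower_mx d.+1) - 1 = tower_mx d.+1.
Proof. by rewrite addrC addKr. Qed.

(** The dual shift moves the coefficient of the top coordinate one place per step. At j = n it has
    reached x_1, where [tower_al] has the entry a; this makes the leading coefficient of the phase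
    irrational. *)
Lemma mpow_corner n (m : 'rV[int]_n.+2) j (i : 'I_n.+2) : (j <= n)%N -> i = j :> nat ->
  mpow (tower_mx n.+2) j m 0 i = m 0 0.
Proof.
elim: j i => [|j IH] i jn ij /=; first by congr (m 0 _); apply: val_inj.
have jn2 : (j < n.+2)%N by rewrite ltnW // ltnS ltnW.
rewrite tower_mulT (bigD1 (Ordinal jn2)) /=; last by rewrite ij eqxx !ltnS.
rewrite big1 ?addr0 => [|l /andP[/andP[/eqP il _] /eqP ne]]; first by apply: IH => //; exact: ltnW.
by case: ne; apply: val_inj => /=; move: il; rewrite ij => -[].
Qed.

Lemma mpow_top n (m : 'rV[int]_n.+2) : mpow (tower_mx n.+2) n.+1 m = 0.
Proof.
apply/rowP => i; rewrite [RHS]mxE; have [hi|hi] := ltnP i n.+1; first exact: mpow_entry.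
rewrite /= tower_mulT big1 // => j /andP[_ h].
by move: h; rewrite !ltnS leqNgt hi.
Qed.

Lemma drop0_tower n (a b : R) (y : torus R n.+2) :
  drop0 (aff (1%:M + tower_mx n.+2) (tower_al a b n.+2) y) =
  aff (1%:M + tower_mx n.+1) (tower_al a b n.+1) (drop0 y).
Proof.
rewrite {1}/aff drop0_proj [drop0 y]/drop0 aff_proj; congr tproj.
rewrite !rmxD !rmx1 !mulmxDr !mulmx1; apply/rowP => i.
rewrite [LHS]mxE [LHS]mxE [RHS]mxE; congr (_ + _); last by rewrite !mxE /=.
rewrite [LHS]mxE [RHS]mxE; congr (_ + _); first by rewrite mxE.
rewrite [LHS]mxE [RHS]mxE big_ord_recl !mxE /= mulr0 add0r.
apply: eq_bigr => j _; rewrite !mxE /=; congr (tval y 0 _ * _); exact: val_inj.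
Qed.

End tower_algebra.

(** A set of full measure meets its preimage under [V], so it contains some [y] together with [V y],
    and [theta] cannot be injective on it. *)
Lemma shift_not_isomorphism (R : realType) (Y : system R) (Z : system R) (theta : Y -> Z) (V : Y -> Y) :
  measurable_fun setT (V : borel Y -> borel Y) ->
  (forall B, borel_set B -> mu Y (V @^-1` B) = mu Y B) ->
  (forall y, theta (V y) = theta y) -> (forall y, V y <> y) -> ~ is_isomorphism theta.
Proof.
move=> mV pV tV nV [_ [X0 [Y0 [[bX mX] _ [_ inj _] _]]]].
have ae0 : {ae mu Y, forall y, X0 y}.
  exists (~` X0); split => //; first exact: (@measurableC _ (borel Y)).
  by rewrite probability_setC // mX subee.
have h : {ae mu Y, forall y, X0 y /\ X0 (V y)}.
  by apply: ae_imp2 ae0 (ae_preimage mV pV ae0) => y.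
have [y [y1 y2]] : exists y, X0 y /\ X0 (V y).
  apply: contrapT => hn; move: h => [B [bB mB hB]].
  have BT : B = setT by apply/seteqP; split => // y _; apply: hB => /= hy; apply: hn; exists y.
  by move: mB; rewrite BT probability_setT => /eqP; rewrite eqe oner_eq0.
by apply: (nV y); apply: inj; rewrite ?inE.
Qed.

Section point_system.
Variable R : realType.

Lemma torus0_eq (x y : torus R 0) : x = y.
Proof. by rewrite -[x]tproj_val -[y]tproj_val; congr tproj; apply/rowP => -[]. Qed.

Lemma point_homeo : homeomorphism (@id (torus R 0)).
Proof. by split; [move=> x; exact: cvg_id|exists id; split => // x; exact: cvg_id]. Qed.

Definition point_system : system R :=
  @System R (torus R 0) (@torus_compact R 0) id point_homeo (haar R 0) (fun _ _ => erefl).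

Lemma point_factor (X : system R) : factor_map (fun _ : X => point : point_system).
Proof.
split; first exact: measurable_cst.
- by apply: nearW => x; exact: torus0_eq.
- move=> B bB; have [Bp|Bp] := pselect (B point).
    have -> : B = setT by apply/seteqP; split => // x _; rewrite (torus0_eq x point).
    by rewrite preimage_setT !probability_setT.
  have -> : B = set0 by apply/seteqP; split => // x; rewrite (torus0_eq x point).
  by rewrite preimage_set0 !measure0.
Qed.

End point_system.

Section tower_system.
Variables (R : realType) (n : nat) (a b : R).
Hypothesis ab : forall v w : int, (v != 0) || (w != 0) -> irr (v%:~R * a + w%:~R * b).

Definition tower_system d : system R := aff_system (tower_unit R d) (tower_al a b d.+1).

Lemma tower_nilsystem d : nilsystem d.+1 (tower_system d.+1).
Proof. by apply: aff_nilsystem => //; rewrite tower_sub1 tower_pow. Qed.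

Let S : torus R n.+2 -> torus R n.+2 := aff (1%:M + tower_mx n.+2) (tower_al a b n.+2).

Lemma tower_fiber_phase (m : 'rV[int]_n.+2) c : m 0 0 != 0 -> exists2 g, irr g &
  forall y : torus R n.+2, exists2 u, phase n.+1 g u & forall i, tchar m c (iter i S y) = tc (u i).
Proof.
move=> m0; exists (dotp (mpow (tower_mx n.+2) n m) (tower_al a b n.+2)).
  apply: (tower_al_irr ab); last exact: (mpow_top m).
  apply: contra m0 => /eqP h; have nn : (n < n.+2)%N by rewrite ltnW.
  by rewrite -(@mpow_corner n m n (Ordinal nn)) // h mxE.
move=> y; exists (fun i => dotp m (lift_orbit (tower_mx n.+2) (tower_al a b n.+2) (tval y) i) + c).
  by apply: phase_lift_orbit; exact: mpow_top.
by move=> i; rewrite -tchar_proj -iter_aff tproj_val.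
Qed.

Lemma tower_limit : exists F F' j p : torus R n.+2 -> torus R n.+2,
  [/\ [/\ continuous F, continuous F', cancel F F', cancel F' F &
         forall A, borel_set A -> haar R n.+2 (F @^-1` A) = haar R n.+2 A],
      [/\ measurable_fun setT (j : borel (torus R n.+2) -> borel (torus R n.+2)),
          measurable_fun setT (p : borel (torus R n.+2) -> borel (torus R n.+2)),
          forall A, borel_set A -> haar R n.+2 (j @^-1` A) = haar R n.+2 A &
          forall A, borel_set A -> haar R n.+2 (p @^-1` A) = haar R n.+2 A],
      [/\ {ae haar R n.+2, forall y, p (j y) = y}, {ae haar R n.+2, forall x, j (p x) = x},
          {ae haar R n.+2, forall x, S (p x) = p (F x)} & {ae haar R n.+2, forall y, j (S y) = F (j y)}] &
      forall c, mixes c F /\ averages c F].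
Proof.
have [N' [h _ _]] := tower_inv R n.+2; have h' := mulmx1C h.
pose S' : torus R n.+2 -> torus R n.+2 := aff (1%:M + N') (- (tower_al a b n.+2 *m rmx R (1%:M + N'))).
apply: (@limit_system R n.+2 S S').
- exact: aff_lipschitz.
- exact: aff_lipschitz.
- by move=> x; rewrite /S /S' aff_comp h' addrN aff1.
- by move=> x; rewrite /S /S' aff_comp h mulNmx -mulmxA -rmxM h rmx1 mulmx1 addNr aff1.
- by move=> A bA; exact: (haar_aff _ h').
- move=> f e cf e0; apply: uniform_average => //.
    by exists n.+2 => m; exact: mpow_nil.
  by move=> m; exact: tower_al_irr.
- by move=> e x y; exact: key_lemma.
Qed.

End tower_system.

Theorem proposition4p9 (R : realType) (k : nat) (k_ge1 : (1 <= k)%N) :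
  exists X : system R,
    [/\ strictly_ergodic X,
        topologically_weak_mixing X &
        Z_nontrivial_extension k X].
Proof.
case: k k_ge1 => // n _; have [a [b ab]] := independent_pair R.
have [F [F' [j [p [[cF cF' FK FK' pF] [mj mp pj pp] [pjK jpK Sp jS] stg]]]]] := @tower_limit R n a b ab.
have hF : homeomorphism F by split => //; exists F'.
pose X : system R := @System R (torus R n.+2) (@torus_compact R n.+2) F hF (haar R n.+2) pF.
pose Y := tower_system a b n.+1.
have avF c : averages c F by have [] := stg c.
have mixF c : mixes c F by have [] := stg c.
have fp : @factor_map R X Y p by [].
have fj : @factor_map R Y X j.
  split; [exact: mj| |exact: pj].
  by apply: ae_imp jS => y e; exact: esym e.
have nY : nilsystem n.+1 Y by exact: tower_nilsystem.
have pE Q : {ae haar R n.+2, forall y, Q y} -> {ae haar R n.+2, forall x, Q (p x)}.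
  exact: (ae_preimage mp pp).
have [Z' [pi' [theta [zZ' fth thE [v nv thv]]]]] : exists (Z' : system R) (pi' : X -> Z') (theta : Y -> Z'),
    [/\ is_Z n pi', factor_map theta, {ae mu X, forall x, theta (p x) = pi' x} &
      exists2 v : 'rV[R]_n.+2, ~~ intv v & forall y : torus R n.+2, theta (tshift v y) = theta y].
  (* Half a turn in the top fibre: invisible once that coordinate is forgotten, yet without fixed
     points. *)
  pose v : 'rV[R]_n.+2 := 2^-1 *: delta_mx 0 0.
  have nv : ~~ intv v.
    apply/negP => /intvP/(_ 0); rewrite !mxE eqxx mulr1 => /intrP[z hz].
    have : (1 : int)%:~R = (2 * z)%:~R :> R by rewrite intrM -hz mulfV.
    by move/eqP; rewrite eqr_int => /eqP; lia.
  (* For k = 1 the factor Z_0 is the point and not the rotation that remains on z. *)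
  have [n0|[n' n1]] : n = 0%N \/ exists n', n = n'.+1 by case: (n) => [|n']; [left|right; exists n'].
    exists (point_system R), (fun=> point), (fun=> point); split => //.
    - split; first exact: (point_factor X).
      by rewrite n0; exact: torus0_eq.
    - exact: (point_factor Y).
    - exact: nearW.
    - by exists v.
  pose Z' := tower_system a b n.
  have dF : @factor_map R Y Z' (@drop0 R n.+1).
    split.
    - by apply: measurable_lipschitz; exact: drop0_lipschitz.
    - by apply: nearW => y; exact: esym (drop0_tower a b y).
    - by move=> B; exact: drop0_haar.
  exists Z', (@drop0 R n.+1 \o p), (@drop0 R n.+1); split.
  - split; first exact: (factor_comp fp dF).
    rewrite {1}n1; split.
      by apply: nilsystem_inverse_limit; rewrite /Z' n1; exact: tower_nilsystem.
    (* Through [j] a factor of [X] becomes one of [Y]; there it descends along [drop0], and [p]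
       brings the identity back to [X]. *)
    move=> W rho frho lW; have [mh eh ph] := factor_comp fj frho.
    have [theta [mth eth pth thE]] := factor_through_drop0 (aff_lipschitz _ _)
      (aff_invariant (tower_unit R n.+1) (tower_al a b n.+2)) (tower_fiber_phase ab)
      (@drop0_tower R n a b) mh ph eh lW.
    exists theta; first by split.
    by apply: ae_imp2 jpK (pE _ thE) => x /= h1 h2; rewrite h2 h1.
  - exact: dF.
  - exact: nearW.
  - by exists v => // y; apply: drop0_shift => i /negbTE i0; rewrite !mxE i0 andbF mulr0.
exists X; split.
- split.
    by move=> A; exact: (F_minimal avF).
  by move=> P hP A bA; exact: (F_uniquely_ergodic cF avF hP).
- exact: F_weak_mixing.
exists Y, Z', p, pi', theta; split => //.
- split => //; split; first exact: nilsystem_inverse_limit.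
  (* [j] inverts [p] almost everywhere, so every factor map of [X] passes through [p]. *)
  move=> W rho frho lW; exists (rho \o j); first exact: (factor_comp fj frho).
  by apply: ae_imp jpK => x /= ->.
- apply: (@shift_not_isomorphism R Y Z' theta (tshift v)).
  + by apply: measurable_lipschitz; exact: tshift_lipschitz.
  + by move=> B; exact: haar_shift.
  + exact: thv.
  + move=> y h; move/negP: nv; apply.
    have : tproj (tval (y : torus R n.+2) + v) = tproj (tval (y : torus R n.+2)).
      by rewrite tproj_val; exact: h.
    by move/tprojP; rewrite addrAC subrr add0r.
Qed.
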